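(* Let $p_1,q_1,q_2\in(0,\infty]$ and $p_2\in(0,\infty)$ with $(p_1,q_1)\ne(p_2,q_2)$, let $n\in\mathbb{N}$, and for each $m\in\mathbb{N}$ let $X^m$ be uniformly distributed on $\mathbb{B}_{p_1,q_1}^{m,n}$. Let $\Theta_1$ be a random vector distributed according to the cone measure on $\mathbb{S}_{q_1}^{n-1}$. Then, as $m\to\infty$, $$\sqrt m\Biggl(\frac{m^{1/p_1-1/p_2}}{\bigl(M_{p_1/n}^{p_2/n}\,\mathbb{E}[\lVert\Theta_1\rVert_{q_2}^{p_2}]\bigr)^{1/p_2}}\lVert X^m\rVert_{p_2,q_2}-1\Biggr)\longrightarrow\sigma N\quad\text{in distribution},$$ where $N$ is a standard Gaussian random variable and $$\sigma^2:=\frac{1}{np_1}-\frac{1}{p_2^2}-\frac{2C_{p_1/n}^{p_1/n,\,p_2/n}}{p_1p_2M_{p_1/n}^{p_2/n}}+\frac{M_{p_1/n}^{2p_2/n}\,\mathbb{E}[\lVert\Theta_1\rVert_{q_2}^{2p_2}]}{\bigl(p_2M_{p_1/n}^{p_2/n}\,\mathbb{E}[\lVert\Theta_1\rVert_{q_2}^{p_2}]\bigr)^2}.$$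
   Context: For $p\in(0,\infty]$, $\lVert x\rVert_p=(\sum_{i}|x_i|^p)^{1/p}$ if $p<\infty$ and $\lVert x\rVert_\infty=\max_i|x_i|$ on $\mathbb{R}^n$; $\mathbb{B}_p^n$, $\mathbb{S}_p^{n-1}$ are the unit ball and unit sphere, $\omega_p^n$ is the volume of $\mathbb{B}_p^n$. For $x\in\mathbb{R}^{m\times n}$, $\lVert x\rVert_{p,q}:=\bigl\lVert\bigl(\lVert(x_{i,j})_{j\le n}\rVert_q\bigr)_{i\le m}\bigr\rVert_p$ and $\mathbb{B}_{p,q}^{m,n}:=\{x\in\mathbb{R}^{m\times n}:\lVert x\rVert_{p,q}\le1\}$. The cone measure on $\mathbb{S}_q^{n-1}$ is $\kappa_q^{n-1}(A):=\mathrm{vol}_n(\{sa:s\in[0,1],a\in A\})/\omega_q^n$ for Borel $A\subset\mathbb{S}_q^{n-1}$. Conventions for $p=\infty$: $c/p:=0$ for $c\in\mathbb{R}$, $p/c:=\infty$ for $c\in(0,\infty)$, $p^{1/p}:=1$ (also $p^{\alpha/p}:=1$). Notation (superscripts are indices, not powers): $M_p^\alpha:=\frac{p^{\alpha/p}}{\alpha+1}\frac{\Gamma(\frac{\alpha+1}{p}+1)}{\Gamma(\frac1p+1)}$ for $p\in(0,\infty]$, $\alpha\in(0,\infty)$, and $M_\infty^\infty:=1$; $C_p^{\alpha,\beta}:=M_p^{\alpha+\beta}-M_p^\alpha M_p^\beta$ for $\alpha,\beta\in(0,\infty)$; $C_\infty^{\infty,\beta}:=0$ for $\beta\in(0,\infty)$.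 *)

(* Defs.v *)
From HB Require Import structures.
From mathcomp Require Import all_boot all_order all_algebra.
From mathcomp Require Import all_classical all_reals all_analysis.
From mathcomp Require Import measurable_realfun.

Set Implicit Arguments.
Unset Strict Implicit.
Unset Printing Implicit Defensive.

Import Order.TTheory GRing.Theory Num.Theory numFieldNormedType.Exports.

Local Open Scope classical_set_scope.
Local Open Scope ring_scope.

Section constants.
Context {R : realType}.
Implicit Types (a b c : R) (p : \bar R).

Definition Gamma (x : R) : R :=
  \int[lebesgue_measure]_(t in `]0, +oo[) (t `^ (x - 1) * expR (- t)).

(* The quotient c / p for p in (0, +oo], which is 0 when p = +oo. *)
Definition divy c p : R := fine (c%:E / p)%E.

(* The power p ^ (a / p), which is 1 by convention when p = +oo. *)
Definition powy p a : R := if p is r%:E then r `^ (a / r) else 1.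

(* The moment E|Z|^a of the density proportional to exp(-|z|^p / p), or of the
   uniform law on [-1, 1] when p = +oo. *)
Definition Mconst p a : R :=
  powy p a / (a + 1) * (Gamma (divy (a + 1) p + 1) / Gamma (divy 1 p + 1)).

(* The first upper index may be +oo (together with p); the value is then 0. *)
Definition Cconst p (a : \bar R) b : R :=
  if a is r%:E then Mconst p (r + b) - Mconst p r * Mconst p b else 0.

End constants.

(* Vectors are n.-tuple R; an m x n matrix is the m-tuple of its rows. *)
Section norms.
Context {R : realType}.
Implicit Types p q : \bar R.

(* The value at -oo is a dummy. *)
Definition lpnorm n p (x : n.-tuple R) : R :=
  match p with
  | r%:E => (\sum_(i < n) `|tnth x i| `^ r) `^ r^-1
  | +oo%E => \big[Num.max/0]_(i < n) `|tnth x i|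
  | -oo%E => 0
  end.

Definition mixed_norm m n p q (x : m.-tuple (n.-tuple R)) : R :=
  lpnorm p [tuple lpnorm q (tnth x i) | i < m].

Definition lpball n p : set (n.-tuple R) := [set x | lpnorm p x <= 1].

Definition lpsphere n p : set (n.-tuple R) := [set x | lpnorm p x = 1].

Definition mixed_ball m n p q : set (m.-tuple (n.-tuple R)) :=
  [set x | mixed_norm p q x <= 1].

Lemma measurable_lpnorm n p : measurable_fun [set: n.-tuple R] (@lpnorm n p).
Proof.
have mabs i : measurable_fun [set: n.-tuple R] (fun x => `|tnth x i|).
  by apply: measurableT_comp => //; exact: measurable_tnth.
case: p => [r||] /=; last exact: measurable_cst.
- apply: (measurableT_comp (measurable_powR _)).
  apply: measurable_sum => i.
  exact: (measurableT_comp (measurable_powR _)).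
- rewrite /lpnorm.
  elim: (index_enum _) => [|i s ih].
    by under eq_fun do rewrite big_nil; exact: measurable_cst.
  by under eq_fun do rewrite big_cons; exact: measurable_maxr.
Qed.

Lemma measurable_mixed_norm m n p q :
  measurable_fun [set: m.-tuple (n.-tuple R)] (@mixed_norm m n p q).
Proof.
apply: (measurableT_comp (@measurable_lpnorm m p)).
apply/measurable_fun_tnthP => i.
rewrite (_ : _ \o _ = @lpnorm n q \o (fun x => tnth x i)); last first.
  by apply/funext => x /=; rewrite tnth_mktuple.
apply: (measurableT_comp (@measurable_lpnorm n q)).
exact: measurable_tnth.
Qed.

HB.instance Definition _ n p := isMeasurableFun.Build _ _ _ _
  (@lpnorm n p) (@measurable_lpnorm n p).

HB.instance Definition _ m n p q := isMeasurableFun.Build _ _ _ _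
  (@mixed_norm m n p q) (@measurable_mixed_norm m n p q).

End norms.

Section tuple_measure.
Local Open Scope ereal_scope.
Context d (T : measurableType d) (R : realType) (mu : set T -> \bar R).

(* The n-fold product of mu on the product sigma-algebra of n.-tuple T,
   obtained by transporting the binary product along (t, x) |-> t :: x. *)
Fixpoint tuple_measure n : set (n.-tuple T) -> \bar R :=
  match n with
  | 0 => \d_([tuple] : 0.-tuple T)
  | n'.+1 => pushforward (mu \x @tuple_measure n')
               (fun x : T * n'.-tuple T => [tuple of x.1 :: x.2])
  end.

End tuple_measure.
Arguments tuple_measure {d T R} mu n _.

Definition volume (R : realType) n : set (n.-tuple R) -> \bar R :=
  tuple_measure lebesgue_measure n.
Arguments volume {R} n _.

Definition mixed_volume (R : realType) m n :
    set (m.-tuple (n.-tuple R)) -> \bar R :=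
  tuple_measure (volume n) m.
Arguments mixed_volume {R} m n _.

Section laws.
Context {R : realType}.

Definition cone n (A : set (n.-tuple R)) : set (n.-tuple R) :=
  [set [tuple s * tnth a i | i < n] | s in `[0, 1] & a in A].

Definition cone_measure n (q : \bar R) (A : set (n.-tuple R)) : \bar R :=
  (volume n (cone A) / volume n (lpball q))%E.

Definition uniform_on_mixed_ball d (T : measurableType d) (P : probability T R)
    m n (p q : \bar R) (X : {RV P >-> m.-tuple (n.-tuple R)}) : Prop :=
  forall A, measurable A ->
    distribution P X A =
      (mixed_volume m n (A `&` mixed_ball p q) /
       mixed_volume m n (mixed_ball p q))%E.

(* The cone measure, carried by the sphere, is extended by 0 to the whole
   space. *)
Definition cone_distributed d (T : measurableType d) (P : probability T R)
    n (q : \bar R) (X : {RV P >-> n.-tuple R}) : Prop :=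
  forall A, measurable A ->
    distribution P X A = cone_measure q (A `&` lpsphere q).

Definition standard_gaussian d (T : measurableType d) (P : probability T R)
    (X : {RV P >-> R}) : Prop :=
  forall A, measurable A -> distribution P X A = normal_prob 0 1 A.

(* Convergence of the distribution functions at every continuity point of the
   limit; the variables may live on different probability spaces. *)
Definition cvg_in_distribution (d : nat -> measure_display)
    (T : forall m, measurableType (d m)) (P : forall m, probability (T m) R)
    (X : forall m, {RV (P m) >-> R})
    d' (T' : measurableType d') (P' : probability T' R)
    (Y : {RV P' >-> R}) : Prop :=
  forall x : R, {for x, continuous (cdf Y)} ->
    cdf (X m) x @[m --> \oo] --> cdf Y x.

End laws.
Arguments cvg_in_distribution {R d T} P X {d' T'} P' Y.

Section statistic.
Context {R : realType}.

(* The norm is normalized by c ^ (1 / p2); the limit theorem takes for c the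
   product of the M constant and the p2-th moment of the q2-norm of a vector
   distributed according to the cone measure. *)
Definition clt_statistic m n (p1 : \bar R) (p2 : R) (q2 : \bar R) (c : R)
    (x : m.-tuple (n.-tuple R)) : R :=
  Num.sqrt m%:R *
    (m%:R `^ (divy 1 p1 - 1 / p2) / c `^ (1 / p2) * mixed_norm p2%:E q2 x - 1).

Lemma measurable_clt_statistic m n p1 p2 q2 c :
  measurable_fun [set: m.-tuple (n.-tuple R)] (@clt_statistic m n p1 p2 q2 c).
Proof.
apply: measurable_funM => //; apply: measurable_funB => //.
by apply: measurable_funM => //; exact: measurable_mixed_norm.
Qed.

HB.instance Definition _ m n p1 p2 q2 c := isMeasurableFun.Build _ _ _ _
  (@clt_statistic m n p1 p2 q2 c) (@measurable_clt_statistic m n p1 p2 q2 c).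

End statistic.

(* Main.v *)
From HB Require Import structures.
Require Import Defs.
From mathcomp Require Import all_boot all_order all_algebra.
From mathcomp Require Import all_classical all_reals all_analysis.
From mathcomp Require Import measurable_realfun.
From mathcomp Require Import ring lra.

Set Implicit Arguments.
Unset Strict Implicit.
Unset Printing Implicit Defensive.

Import Order.TTheory GRing.Theory Num.Theory numFieldNormedType.Exports.

Local Open Scope classical_set_scope.
Local Open Scope ring_scope.

(* Let Y be an m x n matrix with independent rows of density proportional to
   exp (- |y|_q1 ^ p1) (uniform on the unit q1-ball when p1 = +oo).  The joint
   density is a function of the mixed norm N only, so on events invariant under
   dilations the laws of X and Y agree.  Up to the factor N X, which exceeds
   1 - eps / sqrt m except on an event of probability (1 - eps / sqrt m) ^ (n m),
   the statistic is the dilation-invariant quotient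
   (sum_i |Y_i|_q2 ^ p2) ^ (1 / p2) / (sum_i |Y_i|_q1 ^ p1) ^ (1 / p1)
   of sums of i.i.d. terms; when p1 = +oo the law of X is that of Y and the
   denominator is absent.  A central limit theorem (by Lindeberg replacement
   against the heat flow of the Gaussian distribution function) and the delta
   method give the limit.  The moments follow from the polar decomposition of
   Lebesgue measure, under which Y_i / |Y_i|_q1 has the cone measure as law and
   is independent of |Y_i|_q1. *)

(** * Product measures on tuples *)

(** The variance may vanish: for n = 1 and p1 = p2 the dilation-invariant quotient is constant. The
    limit is then the point mass at 0, whose distribution function jumps there. This shapes all
    limit statements: they concern [gaussian_lim] at points with [s2 != 0 \/ t != 0], which are the
    continuity points of the limit, and every auxiliary point t + eta or t - eta is chosen to
    satisfy the same condition. The logarithm of the quotient is, to first order, the average over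
    the rows of zeta = (|Y|_q2 ^ p2 / E - 1) / p2 - (|Y|_q1 ^ p1 / E' - 1) / p1, where E and E' are
    the two expectations, so that sigma^2 is the variance of zeta and the term with C comes from the
    covariance of its two parts. The heat flow suits the replacement argument because smoothing by a
    Gaussian and increasing the variance are the same operation: trading one step of the walk for an
    increment of variance costs a third moment, and the errors of m steps of size 1 / sqrt m add up
    to O(1 / sqrt m) for a fixed width of the smoothing. Third moments are at hand since powers of
    the row norms have all moments. *)

Section tuple_measure_theory.
Local Open Scope ereal_scope.
Context d (T : measurableType d) (R : realType).
Implicit Types mu nu : {sigma_finite_measure set T -> \bar R}.

Definition tuple_cons n (x : T * n.-tuple T) : n.+1.-tuple T :=
  [tuple of x.1 :: x.2].

Lemma measurable_tuple_cons n : measurable_fun setT (@tuple_cons n).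
Proof. exact: measurable_cons. Qed.

Let tuple_uncons n (x : n.+1.-tuple T) : T * n.-tuple T :=
  (thead x, [tuple of behead x]).

Let measurable_tuple_uncons n : measurable_fun setT (@tuple_uncons n).
Proof.
apply: measurable_fun_pair; last exact: measurable_behead.
exact: measurable_tnth.
Qed.

(** The product at each stage is a measure only once the previous one is known to be sigma-finite,
    so the structure is carried through the induction as an existential and attached to
    [tuple_measure] afterwards. The exhausting sets are rectangles of two exhaustions. These are
    taken increasing, so that a point lying in [F i] and in [G j] lies in the rectangle of index
    [maxn i j]. *)
Lemma tuple_measure_sigma_finite_exists mu n :
  exists M : {sigma_finite_measure set (n.-tuple T) -> \bar R},
    tuple_measure mu n = M.
Proof.
elim: n => [|n [M E]]; first by exists (\d_([tuple] : 0.-tuple T)).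
pose m0 : {measure set _ -> \bar R} := (mu \x M)%E.
pose m : {measure set (n.+1.-tuple T) -> \bar R} :=
  measure_function_pushforward__canonical__measure_function_Measure m0
    (@measurable_tuple_cons n).
have sf : sigma_finite setT m.
  have /sigma_finiteP[F [TF ndF Foo]] := sigma_finiteT mu.
  have /sigma_finiteP[G [TG ndG Goo]] := sigma_finiteT M.
  have cK : @tuple_uncons n \o @tuple_cons n = id.
    apply/funext => -[x t] /=; rewrite /tuple_uncons /tuple_cons/=; congr pair.
    exact/val_inj.
  exists (fun i => @tuple_uncons n @^-1` (F i `*` G i)).
    rewrite -preimage_bigcup; apply/esym/seteqP; split => // y _ /=.
    have [i _ Fi] : (\bigcup_i F i) (tuple_uncons y).1 by rewrite -TF.
    have [j _ Gj] : (\bigcup_i G i) (tuple_uncons y).2 by rewrite -TG.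
    exists (maxn i j) => //; split.
    - by apply: subsetPset Fi; exact/ndF/leq_maxl.
    - by apply: subsetPset Gj; exact/ndG/leq_maxr.
  move=> i; have [mF Fi] := Foo i; have [mG Gi] := Goo i; split.
    rewrite -[X in measurable X]setTI; apply: measurable_tuple_uncons => //.
    exact: measurableX.
  rewrite /m /= /pushforward -comp_preimage [_ \o _]cK preimage_id.
  by rewrite product_measure1E// lte_mul_pinfty// ge0_fin_numE.
pose H := Measure_isSigmaFinite.Build _ _ _ m sf.
pose m' : {sigma_finite_measure set (n.+1.-tuple T) -> \bar R} :=
  HB.pack (m : set _ -> \bar R) (Measure.on m) H.
by exists m'; rewrite /= E.
Qed.

Definition tuple_sfmeasure mu n :
  {sigma_finite_measure set (n.-tuple T) -> \bar R} :=
  projT1 (cid (tuple_measure_sigma_finite_exists mu n)).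

Lemma tuple_sfmeasureE mu n : tuple_sfmeasure mu n = tuple_measure mu n :> (set _ -> _).
Proof. by rewrite /tuple_sfmeasure; case: cid. Qed.

Section instances.
Variables (mu : {sigma_finite_measure set T -> \bar R}) (n : nat).

Let tm0 : tuple_measure mu n set0 = 0.
Proof. by rewrite -tuple_sfmeasureE measure0. Qed.

Let tm_ge0 A : 0 <= tuple_measure mu n A.
Proof. by rewrite -tuple_sfmeasureE measure_ge0. Qed.

Let tm_sigma : semi_sigma_additive (tuple_measure mu n).
Proof. by rewrite -tuple_sfmeasureE; exact: measure_semi_sigma_additive. Qed.

HB.instance Definition _ := isMeasure.Build _ _ _
  (tuple_measure mu n) tm0 tm_ge0 tm_sigma.

Let tm_sigma_finite : sigma_finite setT (tuple_measure mu n).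
Proof. by rewrite -tuple_sfmeasureE; exact: sigma_finiteT. Qed.

HB.instance Definition _ := Measure_isSigmaFinite.Build _ _ _
  (tuple_measure mu n) tm_sigma_finite.
End instances.

Lemma tuple_measureS mu n (A : set (n.+1.-tuple T)) :
  tuple_measure mu n.+1 A =
  \int[mu]_x tuple_measure mu n [set t | A (tuple_cons (x, t))].
Proof.
rewrite /= /pushforward /product_measure1; apply: eq_integral => x _ /=.
by congr (tuple_measure mu n _); apply/seteqP; split => t; rewrite /xsection/= inE.
Qed.

Lemma ge0_integral_tuple_measureS mu n (f : n.+1.-tuple T -> \bar R) :
  measurable_fun setT f -> (forall x, 0 <= f x) ->
  \int[tuple_measure mu n.+1]_x f x =
  \int[mu]_x \int[tuple_measure mu n]_t f (tuple_cons (x, t)).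
Proof.
move=> mf f0 /=.
rewrite (ge0_integral_pushforward (@measurable_tuple_cons n))//.
rewrite preimage_setT fubini_tonelli1//.
  exact: measurableT_comp (@measurable_tuple_cons n).
by move=> x; exact: f0.
Qed.

Lemma integral_tuple_measure0 mu (f : 0.-tuple T -> \bar R) :
  \int[tuple_measure mu 0]_x f x = f [tuple].
Proof.
rewrite /= integral_dirac//; first by rewrite diracT mul1e.
move=> _ A mA; rewrite setTI.
have [h|h] := pselect ((f @^-1` A) [tuple]).
  rewrite (_ : _ @^-1` _ = setT)//; apply/seteqP; split => // t _.
  by rewrite tuple0.
rewrite (_ : _ @^-1` _ = set0)//; apply/seteqP; split => // t.
by rewrite tuple0.
Qed.

Lemma measurable_section_tuple n (A : set (n.+1.-tuple T)) x : measurable A ->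
  measurable [set t | A (tuple_cons (x, t))].
Proof.
move=> mA; rewrite -[X in measurable X]setTI.
have : measurable_fun setT (fun t : n.-tuple T => tuple_cons (x, t)).
  by apply: measurableT_comp => //; exact: measurable_tuple_cons.
exact.
Qed.

Lemma measurable_tuple_measure_section mu n (A : set (n.+1.-tuple T)) :
  measurable A ->
  measurable_fun setT (fun x => tuple_measure mu n [set t | A (tuple_cons (x, t))]).
Proof.
move=> mA.
have mA' : measurable ((@tuple_cons n) @^-1` A).
  by rewrite -[X in measurable X]setTI; exact: measurable_tuple_cons.
have := measurable_fun_xsection (tuple_measure mu n) mA'.
congr measurable_fun; apply/funext => x /=; congr (tuple_measure mu n _).
by apply/seteqP; split => t; rewrite /xsection/= inE.
Qed.

(** Slice along the first coordinate: the induction rescales the slices, and the outer integral is a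
    change of variables, the image of [mu] under [s] being [k] times [mu]. The map [s] is arbitrary
    because the lemma is applied twice, to Lebesgue measure for [volume] and to [volume] for
    [mixed_volume]. *)
Lemma tuple_measure_scale mu (s : T -> T) (k : R) n (A : set (n.-tuple T)) :
  measurable_fun setT s -> (0 <= k)%R ->
  (forall B, measurable B -> mu (s @^-1` B) = k%:E * mu B) ->
  measurable A ->
  tuple_measure mu n ((fun x => map_tuple s x) @^-1` A) =
    (k ^+ n)%:E * tuple_measure mu n A.
Proof.
move=> ms k0 hs; elim: n A => [|n ih] A mA.
  rewrite expr0 mul1e /=; congr (\d_ _ _); apply/seteqP; split => t /=;
  by rewrite (_ : map_tuple s t = t)// [LHS]tuple0 [RHS]tuple0.
have mS := measurable_tuple_measure_section mu mA.
rewrite !tuple_measureS.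
transitivity (\int[mu]_x ((k ^+ n)%:E *
    tuple_measure mu n [set t | A (tuple_cons (s x, t))])).
  apply: eq_integral => x _; rewrite -ih; last exact: measurable_section_tuple.
  congr (tuple_measure mu n _); apply/seteqP; split => t /=;
  by rewrite (_ : map_tuple s _ = tuple_cons (s x, map_tuple s t))//; apply/val_inj.
rewrite ge0_integralZl//; last 2 first.
- exact: (measurableT_comp mS ms).
- by rewrite lee_fin exprn_ge0.
rewrite exprSr EFinM -muleA; congr (_ * _).
pose g y := tuple_measure mu n [set t | A (tuple_cons (y, t))].
transitivity (\int[pushforward mu s]_y g y).
  by rewrite (ge0_integral_pushforward ms)// => y _; exact: measure_ge0.
transitivity (\int[mscale (NngNum k0) mu]_y g y).
  by apply: eq_measure_integral => B mB _; exact: hs.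
by rewrite ge0_integral_mscale// => x _; exact: measure_ge0.
Qed.

End tuple_measure_theory.

Section tuple_probability.
Local Open Scope ereal_scope.
Context d (T : measurableType d) (R : realType).
Variables (P : probability T R) (n : nat).

Let tmT : tuple_measure P n setT = 1.
Proof.
elim: n => [|k ih]; first by rewrite /= diracT.
rewrite tuple_measureS; under eq_integral do rewrite ih.
by rewrite integral_cst// mul1e; exact: probability_setT.
Qed.

HB.instance Definition _ := Measure_isProbability.Build _ _ _
  (tuple_measure P n) tmT.
End tuple_probability.

Section density.
Local Open Scope ereal_scope.
Context d (T : measurableType d) (R : realType).
Variables (mu nu : {sigma_finite_measure set T -> \bar R}) (w : T -> R).
Hypotheses (mw : measurable_fun setT w) (w0 : forall x, (0 <= w x)%R).
Hypothesis hnu : forall A, measurable A ->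
  nu A = \int[mu]_x (\1_A x * w x)%:E.

Import HBNNSimple.

Lemma ge0_integral_density (f : T -> \bar R) :
  measurable_fun setT f -> (forall x, 0 <= f x) ->
  \int[nu]_x f x = \int[mu]_x (f x * (w x)%:E).
Proof.
move=> mf f0.
pose f_ := nnsfun_approx measurableT mf.
have cvf x : EFin \o f_ ^~ x @ \oo --> f x by apply: cvg_nnsfun_approx.
transitivity (limn (fun n => \int[nu]_x (f_ n x)%:E)).
  rewrite -monotone_convergence//.
  - by apply: eq_integral => x _; apply/esym/cvg_lim => //; exact: cvf.
  - by move=> n; exact/measurable_EFinP.
  - by move=> n x _; rewrite lee_fin.
  - by move=> x _ a b ab; rewrite lee_fin; exact/lefP/nd_nnsfun_approx.
transitivity (limn (fun n => \int[mu]_x (f_ n x * w x)%:E)); last first.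
  rewrite -monotone_convergence//.
  - apply: eq_integral => x _; apply/cvg_lim => //.
    under eq_fun do rewrite EFinM.
    by apply: cvgeZr => //; exact: cvf.
  - by move=> n; apply/measurable_EFinP; apply: measurable_funM.
  - by move=> n x _; rewrite lee_fin mulr_ge0.
  - move=> x _ a b ab; rewrite lee_fin ler_wpM2r//.
    exact/lefP/nd_nnsfun_approx.
congr (limn _); apply/funext => n.
transitivity (\sum_(r \in range (f_ n)) r%:E * nu (f_ n @^-1` [set r])).
  by rewrite integralT_nnsfun sintegralE.
transitivity (\int[mu]_x (\sum_(r \in range (f_ n))
    (r * \1_(f_ n @^-1` [set r]) x)%:E * (w x)%:E)); last first.
  apply: eq_integral => x _.
  rewrite EFinM [in RHS]fimfunE -fsumEFin// ge0_mule_fsuml// => r.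
  by rewrite EFinM nnfun_muleindic_ge0.
rewrite ge0_integral_fsum//; last 2 first.
- move=> r; apply/measurable_EFinP; apply: measurable_funM => //.
  exact: measurable_funM.
- move=> r x _; rewrite mule_ge0 ?lee_fin//.
  by rewrite -lee_fin EFinM nnfun_muleindic_ge0.
apply: eq_fsbigr => r _; rewrite hnu//.
have [r0|r0] := leP 0%R r; last first.
  rewrite preimage_nnfun0//.
  rewrite !integral0_eq ?mule0// => x _; rewrite indicE in_set0 /=.
    by rewrite mul0r.
  by rewrite mulr0 mul0e.
under [RHS]eq_integral do rewrite -EFinM -mulrA EFinM.
rewrite ge0_integralZl//.
- apply/measurable_EFinP; apply: measurable_funM => //.
- by move=> x _; rewrite lee_fin mulr_ge0// indicE.
Qed.

Lemma tuple_measure_density n (A : set (n.-tuple T)) : measurable A ->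
  tuple_measure nu n A =
  \int[tuple_measure mu n]_x (\1_A x * \prod_(i < n) w (tnth x i))%:E.
Proof.
elim: n A => [|n ih] A mA.
  by rewrite integral_tuple_measure0 big_ord0 mulr1 /= diracE indicE.
rewrite tuple_measureS ge0_integral_density//; last first.
  exact: measurable_tuple_measure_section.
have mprod k : measurable_fun setT (fun x : k.-tuple T => \prod_(i < k) w (tnth x i))%R.
  by apply: measurable_prod => i _; apply: measurableT_comp => //; exact: measurable_tnth.
rewrite ge0_integral_tuple_measureS//; last 2 first.
- by apply/measurable_EFinP; apply: measurable_funM => //; exact: mprod.
- by move=> x; rewrite lee_fin mulr_ge0// ?indicE// prodr_ge0.
apply: eq_integral => x _.
rewrite ih; last exact: measurable_section_tuple.
rewrite -ge0_integralZr//; last 3 first.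
- apply/measurable_EFinP; apply: measurable_funM => //.
    by apply: measurable_indic; exact: measurable_section_tuple.
  exact: mprod.
- by move=> t _; rewrite lee_fin mulr_ge0// ?indicE// prodr_ge0.
- by rewrite lee_fin.
apply: eq_integral => t _.
rewrite -EFinM big_ord_recl -mulrA; congr (_ * _)%:E.
by rewrite mulrC; congr (_ * _)%R; apply: eq_bigr => i _; rewrite tnthS.
Qed.

End density.

(** * The Gaussian distribution function *)

Section gaussian_taylor.
Context {R : realType}.
Implicit Types x y z t v h : R.

(** One integration of a derivative bound by the mean value theorem. The factor 1 / (k + 1) is given
    up, so the constant stays the same when the step is iterated along a Taylor remainder. *)
Let bound_step (r r' : R -> R) (C : R) (k : nat) : 0 <= C ->
  (forall z, is_derive z 1 r (r' z)) -> r 0 = 0 ->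
  (forall z, `|r' z| <= C * `|z| ^+ k) ->
  forall y, `|r y| <= C * `|y| ^+ k.+1.
Proof.
move=> C0 dr r0 hr' y.
have cr : continuous r.
  by move=> z; apply/differentiable_continuous/derivable1_diffP; have [] := dr z.
have [y0|y0] := leP 0 y.
- have [c + E] := MVT_segment y0 (fun x _ => dr x)
    (continuous_subspaceT cr).
  rewrite in_itv/= => /andP[c0 cy].
  rewrite r0 !subr0 in E; rewrite E normrM exprSr mulrA ler_wpM2r//.
  apply: (le_trans (hr' c)); rewrite ler_wpM2l// lerXn2r ?nnegrE//.
  by rewrite !ger0_norm.
- have [c + E] := MVT_segment (ltW y0) (fun x _ => dr x)
    (continuous_subspaceT cr).
  rewrite in_itv/= => /andP[yc c0].
  rewrite r0 !sub0r in E; rewrite -normrN E normrM exprSr mulrA normrN ler_wpM2r//.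
  apply: (le_trans (hr' c)); rewrite ler_wpM2l// lerXn2r ?nnegrE//.
  by rewrite !ler0_norm ?lerN2// ltW.
Qed.

Definition gaussian_cdf x : R := fine (normal_prob 0 1 `]-oo, x]).

Definition gaussian_pdf x : R := normal_peak 1 * expR (- (x ^+ 2 / 2)).

Lemma normal_pdf01 : normal_pdf 0 1 = gaussian_pdf.
Proof.
apply/funext => x; rewrite normal_pdfE ?oner_neq0//.
by rewrite /gaussian_pdf /normal_fun subr0 expr1n mulNr.
Qed.

Lemma is_derive_gaussian_cdf x : is_derive x 1 gaussian_cdf (gaussian_pdf x).
Proof.
have [D E] : derivable gaussian_cdf x 1 /\ gaussian_cdf^`()%classic x = gaussian_pdf x.
  have -> : gaussian_cdf = fun y =>
      (\int[lebesgue_measure]_(t in [set` Interval -oo%O (BRight y)])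
        normal_pdf 0 1 t)%R.
    by apply/funext => y.
  rewrite -normal_pdf01; apply: (@continuous_FTC1 _ _ _ _ (x + 1)) => //.
  - by rewrite ltrDl.
  - apply: (integrableS measurableT) => //; exact: integrable_normal_pdf.
  - exact: ltNyr.
  - exact: (@continuous_normal_pdf R 0 1 (oner_neq0 R) x).
by split; [exact: D|rewrite -derive1E].
Qed.

Lemma is_derive_gaussian_pdf x :
  is_derive x 1 gaussian_pdf (- (x * gaussian_pdf x)).
Proof.
rewrite /gaussian_pdf.
have d1 : is_derive x 1 (fun y : R => - (y ^+ 2 / 2)) (- x).
  apply: is_derive_eq; rewrite /GRing.scale/=; lra.
apply: is_derive_eq; rewrite /GRing.scale/=; ring.
Qed.

Let K : R := 16 * normal_peak 1.

(** This one weight dominates every polynomial factor met in the derivatives below. The 16 is 4 ^ 2: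
    with t = x^2 / 2, the inequality e^(t/2) >= 1 + t/2 gives (1 + 2t) e^(-t/2) <= 4, and both sides
    are squared. *)
Let pdf_bound x : (1 + x ^+ 2) ^+ 2 * gaussian_pdf x <= K.
Proof.
rewrite /gaussian_pdf mulrCA [K]mulrC /K ler_wpM2l ?normal_peak_ge0//.
set t := x ^+ 2 / 2.
have t0 : 0 <= t by rewrite divr_ge0 ?sqr_ge0.
have -> : x ^+ 2 = 2 * t by rewrite /t; lra.
have e : expR (- t) = (expR (- (t / 2))) ^+ 2.
  by rewrite -expRM_natl; congr expR; lra.
rewrite e -exprMn.
have h : (1 + 2 * t) * expR (- (t / 2)) <= 4.
  rewrite expRN ler_pdivrMr ?expR_gt0//.
  have := expR_ge1Dx (t / 2); lra.
have h0 : 0 <= (1 + 2 * t) * expR (- (t / 2)).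
  by rewrite mulr_ge0 ?expR_ge0//; lra.
by rewrite (_ : 16 = 4 ^+ 2) ?lerXn2r ?nnegrE//; lra.
Qed.

Let pdf_ge0 x : 0 <= gaussian_pdf x.
Proof. by rewrite mulr_ge0 ?normal_peak_ge0 ?expR_ge0. Qed.

Let pdf_bound' (a x : R) : `|a| <= (1 + x ^+ 2) ^+ 2 ->
  `|a * gaussian_pdf x| <= K.
Proof.
move=> h; rewrite normrM (ger0_norm (pdf_ge0 x)).
by apply: le_trans (pdf_bound x); rewrite ler_wpM2r.
Qed.

(** Minus the second derivative of [gaussian_cdf]. At z = x / sqrt v it is also -2 times the
    derivative of [gaussian_cdf (x / sqrt v)] with respect to log v, which is the heat equation and
    makes the two expansions below match. *)
Let psi x := x * gaussian_pdf x.

Let dpsi x : is_derive x 1 psi ((1 - x ^+ 2) * gaussian_pdf x).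
Proof.
have := is_derive_gaussian_pdf x => ?.
apply: is_derive_eq; rewrite /GRing.scale/=; ring.
Qed.

Let ge1Dsqr x : 1 <= 1 + x ^+ 2.
Proof. by rewrite lerDl sqr_ge0. Qed.

Let norm_le1Dsqr x : `|x| <= 1 + x ^+ 2.
Proof.
rewrite -[x ^+ 2]real_normK ?num_real//; have := sqr_ge0 (`|x| - 1 / 2); lra.
Qed.

Let norm1Bsqr_le x : `|1 - x ^+ 2| <= 1 + x ^+ 2.
Proof.
by have := sqr_ge0 x; rewrite ler_norml => ?; apply/andP; split; lra.
Qed.

Let le_sqr1D x : 1 + x ^+ 2 <= (1 + x ^+ 2) ^+ 2.
Proof. by rewrite expr2 ler_peMl ?ge1Dsqr//; exact: le_trans (ge1Dsqr x). Qed.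

Let psi_bound x : `|psi x| <= K.
Proof. by apply: pdf_bound'; apply: le_trans (le_sqr1D x). Qed.

Let is_derive_shiftl (f : R -> R) (df z y : R) :
  is_derive (z + y) 1 f df -> is_derive y 1 (fun t => f (z + t)) df.
Proof.
move=> h; have d1 : is_derive y 1 (fun t : R => z + t) 1.
  by apply: is_derive_eq; rewrite add0r mulr1.
have := @is_derive1_comp _ f (fun t => z + t) y df 1 h d1.
by rewrite mulr1.
Qed.

(** [r1] and [r2] are the first two derivatives in y of the remainder [r0], and all three vanish at
    y = 0. The third derivative is bounded by [K] uniformly in z, and three integrations produce the
    cube. *)
Lemma gaussian_cdf_taylor :
  {C : R | 0 <= C & forall z y,
    `|gaussian_cdf (z + y) - gaussian_cdf z - y * gaussian_pdf z
      + y ^+ 2 / 2 * (z * gaussian_pdf z)| <= C * `|y| ^+ 3}.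
Proof.
have K0 : 0 <= K by rewrite mulr_ge0 ?normal_peak_ge0.
exists K => // z.
pose r0 y := gaussian_cdf (z + y) - gaussian_cdf z - y * gaussian_pdf z
      + y ^+ 2 / 2 * (z * gaussian_pdf z).
pose r1 y := gaussian_pdf (z + y) - gaussian_pdf z + y * psi z.
pose r2 y := psi z - psi (z + y).
have b2 : forall y, `|r2 y| <= K * `|y| ^+ 1.
  apply: (bound_step (r' := fun y => - ((1 - (z + y) ^+ 2) * gaussian_pdf (z + y)))) => //.
  - move=> y; have := is_derive_shiftl (dpsi (z + y)) => ?.
    rewrite /r2; apply: is_derive_eq; rewrite /GRing.scale/=; ring.
  - by rewrite /r2 addr0 subrr.
  - move=> y; rewrite expr0 mulr1 normrN; apply: pdf_bound'.
    exact: le_trans (le_sqr1D _).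
have b1 : forall y, `|r1 y| <= K * `|y| ^+ 2.
  apply: (bound_step (r' := r2)) => //.
  - move=> y; have := is_derive_shiftl (is_derive_gaussian_pdf (z + y)) => ?.
    rewrite /r1; apply: is_derive_eq; rewrite /GRing.scale/= /r2 /psi; ring.
  - by rewrite /r1 addr0 subrr mul0r addr0.
apply: (bound_step (r := r0) (r' := r1)) => //.
- move=> y; have := is_derive_shiftl (is_derive_gaussian_cdf (z + y)) => ?.
  rewrite /r0; apply: is_derive_eq; rewrite /GRing.scale/= /r1 /psi; lra.
- by rewrite /r0 addr0 subrr mul0r expr0n/= !mul0r subr0 addr0.
Qed.

(* The second derivative in the logarithmic scale t, z e^{-t}, is bounded
   uniformly in z; no such bound holds in z itself. *)
Let gaussian_cdf_expR z t :
  `|gaussian_cdf (z * expR (- t)) - gaussian_cdf z + t * psi z| <= K * `|t| ^+ 2.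
Proof.
have K0 : 0 <= K by rewrite mulr_ge0 ?normal_peak_ge0.
have dz (u : R) : is_derive u 1 (fun t : R => z * expR (- t)) (- (z * expR (- u))).
  have d1 : is_derive u 1 (fun t : R => - t) (- 1) by apply: is_derive_eq.
  have d2 := @is_derive1_comp _ expR (fun t => - t) u _ _ (is_derive_expR (- u)) d1.
  apply: is_derive_eq; rewrite /GRing.scale/=; ring.
pose s1 u := psi z - psi (z * expR (- u)).
have b1 : forall y, `|s1 y| <= K * `|y| ^+ 1.
  apply: (bound_step (r' := fun u => z * expR (- u) * (1 - (z * expR (- u)) ^+ 2)
     * gaussian_pdf (z * expR (- u)))) => //.
  - move=> u; have := @is_derive1_comp _ _ _ u _ _ (dpsi (z * expR (- u))) (dz u) => ?.
    rewrite /s1.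
    apply: is_derive_eq; rewrite /GRing.scale/=; ring.
  - by rewrite /s1 oppr0 expR0 mulr1 subrr.
  - move=> u; rewrite expr0 mulr1; apply: pdf_bound'.
    set w := z * _; rewrite normrM.
    by rewrite [leRHS]expr2 ler_pM.
apply: (bound_step (r := fun t => gaussian_cdf (z * expR (- t)) - gaussian_cdf z + t * psi z)
   (r' := s1)) => //.
- move=> u; have := @is_derive1_comp _ _ _ u _ _
    (is_derive_gaussian_cdf (z * expR (- u))) (dz u) => ?.
  apply: is_derive_eq; rewrite /GRing.scale/= /s1 /psi; ring.
- by rewrite oppr0 expR0 mulr1 subrr mul0r addr0.
Qed.

(** With t = ln (1 + h/v) / 2 the point x / sqrt (v + h) is z e^(-t), so the estimate in the
    logarithmic scale applies. Replacing t by h / (2v) costs at most (h/v)^2 / 2 times the bound [K]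
    on psi. Hence the error depends on h / v only, uniformly in x. *)
Lemma gaussian_cdf_heat :
  {C : R | 0 <= C & forall x v h, 0 < v -> 0 <= h ->
    `|gaussian_cdf (x / Num.sqrt (v + h)) - gaussian_cdf (x / Num.sqrt v)
      + h / v / 2 * (x / Num.sqrt v * gaussian_pdf (x / Num.sqrt v))|
      <= C * (h / v) ^+ 2}.
Proof.
have K0 : 0 <= K by rewrite mulr_ge0 ?normal_peak_ge0.
exists K => // x v h v0 h0.
set z := x / Num.sqrt v; set th := h / v.
have th0 : 0 <= th by rewrite divr_ge0// ltW.
pose t := ln (1 + th) / 2.
have th1 : 0 < 1 + th by lra.
have -> : x / Num.sqrt (v + h) = z * expR (- t).
  have -> : v + h = v * (1 + th) by rewrite /th mulrDr mulr1 mulrCA divff ?mulr1// gt_eqF.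
  rewrite sqrtrM ?(ltW v0)// invfM mulrA -/z; congr (_ * _).
  rewrite expRN; congr (_^-1); apply/eqP; rewrite -(@eqrXn2 _ 2) ?sqrtr_ge0 ?expR_ge0//.
  rewrite sqr_sqrtr ?(ltW th1)// -expRM_natl /t mulrCA divff ?mulr1//.
  by rewrite lnK// posrE.
have t_le : t <= th / 2.
  by rewrite /t ler_pM2r ?invr_gt0//; apply: le_ln1Dx; lra.
have t_ge : th / 2 - th ^+ 2 / 2 <= t.
  suff : th - th ^+ 2 <= ln (1 + th) by rewrite /t; lra.
  (* The lower bound on ln (1 + th) comes from the upper bound ln (1 + u) <= u applied to the
     inverse 1 / (1 + th) = 1 - th / (1 + th). *)
  have : ln (1 + - (th / (1 + th))) <= - (th / (1 + th)).
    apply: le_ln1Dx; rewrite ltrN2 ltr_pdivrMr//; lra.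
  rewrite (_ : 1 + - _ = (1 + th)^-1); last by field; lra.
  rewrite lnV ?posrE// lerN2; apply: le_trans.
  rewrite ler_pdivlMr//; nra.
have t0 : 0 <= t by rewrite /t divr_ge0// ln_ge0// lerDl.
have := gaussian_cdf_expR z t; have := psi_bound z; rewrite /psi.
set p := z * gaussian_pdf z; set D := gaussian_cdf _ - gaussian_cdf _ => hp hD.
have -> : D + th / 2 * p = (D + t * p) + (th / 2 - t) * p by ring.
apply: le_trans (ler_normD _ _) _; rewrite normrM (ger0_norm (_ : 0 <= th / 2 - t)); last by lra.
rewrite (ger0_norm t0) in hD.
have e1 : t ^+ 2 <= th ^+ 2 / 4 by nra.
have e2 : (th / 2 - t) * `|p| <= th ^+ 2 / 2 * K.
  by apply: ler_pM => //; lra.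
nra.
Qed.

Lemma gaussian_cdf_ge0 x : 0 <= gaussian_cdf x.
Proof. by rewrite fine_ge0. Qed.

Lemma gaussian_cdf_le1 x : gaussian_cdf x <= 1.
Proof.
rewrite -lee_fin fineK ?fin_num_measure//.
exact: (probability_le1 (normal_prob 0 1)).
Qed.

Lemma gaussian_cdf_continuous : continuous gaussian_cdf.
Proof.
move=> x; apply/differentiable_continuous/derivable1_diffP.
by have [] := is_derive_gaussian_cdf x.
Qed.

Lemma gaussian_cdf_nondecreasing : {homo gaussian_cdf : x y / x <= y}.
Proof.
move=> x y xy; apply: fine_le; rewrite ?fin_num_measure//.
by apply: le_measure; rewrite ?inE//; exact: subitvPr.
Qed.

(** The identity as a random variable under the normal law: [gaussian_cdf] is its distribution
    function, so the general limits of [cdf] at both infinities apply. *)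
Let idTR : measurableTypeR R -> R := idfun.
#[local] HB.instance Definition _ :=
  @isMeasurableFun.Build _ _ _ _ idTR (@measurable_id _ _ setT).
Let idRV : {RV (normal_prob (0 : R) 1) >-> R} := idTR.

Lemma gaussian_cdf_cvgy : gaussian_cdf @ +oo%R --> (1 : R).
Proof. exact: (fine_cvg (cvg_cdfy1 idRV)). Qed.

Lemma gaussian_cdf_cvgNy : gaussian_cdf @ -oo%R --> (0 : R).
Proof. exact: (fine_cvg (cvg_cdfNy0 idRV)). Qed.

End gaussian_taylor.

(** * The central limit theorem *)

Section integrable_EFin.
Context d (T : measurableType d) (R : realType).
Variable mu : {measure set T -> \bar R}.
Implicit Types f g : T -> R.

Lemma integrable_funB f g : mu.-integrable setT (EFin \o f) ->
  mu.-integrable setT (EFin \o g) ->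
  mu.-integrable setT (EFin \o (fun x => f x - g x)).
Proof. by move=> If Ig; have := integrableB measurableT If Ig. Qed.

Lemma integrable_funD f g : mu.-integrable setT (EFin \o f) ->
  mu.-integrable setT (EFin \o g) ->
  mu.-integrable setT (EFin \o (fun x => f x + g x)).
Proof. by move=> If Ig; have := integrableD measurableT If Ig. Qed.

Lemma integrable_funZl (c : R) f : mu.-integrable setT (EFin \o f) ->
  mu.-integrable setT (EFin \o (fun x => c * f x)).
Proof. by move=> If; have := integrableZl measurableT c If. Qed.

End integrable_EFin.

Section probability_Rintegral.
Context d (T : measurableType d) (R : realType) (P : probability T R).
Implicit Types f g h : T -> R.

Lemma integrable_le1 f : measurable_fun setT f -> (forall x, 0 <= f x <= 1) ->
  P.-integrable setT (EFin \o f).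
Proof.
move=> mf f01; apply: measurable_bounded_integrable => //.
  by rewrite (le_lt_trans (probability_le1 P _))// ltry.
exists 1; split => // x x1 y _; have /andP[f0 f1] := f01 y.
by rewrite /= ger0_norm//; apply: le_trans f1 (ltW x1).
Qed.

Lemma Rintegral_dist_le f g h :
  P.-integrable setT (EFin \o f) -> P.-integrable setT (EFin \o g) ->
  P.-integrable setT (EFin \o h) -> (forall x, `|f x - g x| <= h x) ->
  `|\int[P]_x f x - \int[P]_x g x| <= \int[P]_x h x.
Proof.
move=> If Ig Ih H; rewrite -RintegralB//.
have Ifg : P.-integrable setT (EFin \o (fun x => f x - g x)).
  exact: integrable_funB.
apply: le_trans (le_normr_Rintegral _ Ifg) _ => //.
by apply: le_Rintegral => //; exact: integrable_norm.
Qed.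

Lemma Rintegral_cst_probability (r : R) : \int[P]_x r = r.
Proof.
rewrite Rintegral_cst//; transitivity (r * fine (P setT)) => //.
by rewrite probability_setT mulr1.
Qed.

(** The form of all later comparisons of events: [A1] is the event compared with, [A2] and [A3] are
    exceptional sets of small probability. *)
Lemma fine_probabilityU3 (A A1 A2 A3 : set T) :
  measurable A -> measurable A1 -> measurable A2 -> measurable A3 ->
  A `<=` A1 `|` (A2 `|` A3) ->
  fine (P A) <= fine (P A1) + (fine (P A2) + fine (P A3)).
Proof.
move=> mA m1 m2 m3 sub.
rewrite -!fineD ?fin_num_measure// ?fin_numD ?fin_num_measure//.
apply: fine_le; rewrite ?fin_numD ?fin_num_measure//.
apply: le_trans (_ : (P (A1 `|` (A2 `|` A3)) <= _)%E).
  by apply: le_measure; rewrite ?inE//; apply: measurableU => //; exact: measurableU.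
apply: le_trans (measureU2 _ _ _) _ => //; first exact: measurableU.
by rewrite leeD2l// measureU2.
Qed.

End probability_Rintegral.

(** Tonelli for one coordinate with real-valued integrals. The range [0, 1] makes everything
    integrable, and the inner integral inherits it. *)
Lemma Rintegral_tuple_measureS d (T : measurableType d) (R : realType)
    (P : probability T R) k (f : k.+1.-tuple T -> R) :
  measurable_fun setT f -> (forall x, 0 <= f x <= 1) ->
  let G y := \int[tuple_measure P k]_t f (tuple_cons (y, t)) in
  [/\ measurable_fun setT G, (forall y, 0 <= G y <= 1) &
    \int[tuple_measure P k.+1]_x f x = \int[P]_y G y].
Proof.
move=> mf f01 G.
have mfc : measurable_fun setT (fun p : T * k.-tuple T => f (tuple_cons p)).
  exact: measurableT_comp (@measurable_tuple_cons _ _ _).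
have mfy y : measurable_fun setT (fun t : k.-tuple T => f (tuple_cons (y, t))).
  exact: (measurableT_comp mfc (@pair1_measurable _ _ _ _ y)).
have If y : (tuple_measure P k).-integrable setT (EFin \o fun t => f (tuple_cons (y, t))).
  exact: integrable_le1.
have GE y : (G y)%:E = (\int[tuple_measure P k]_t (f (tuple_cons (y, t)))%:E)%E.
  rewrite /G /Rintegral fineK//.
  exact: (integrable_fin_num measurableT (If y)).
split.
- apply/measurable_EFinP.
  have := @measurable_fun_fubini_tonelli_F _ _ _ _ _ (tuple_measure P k)
    (EFin \o (fun p : T * k.-tuple T => f (tuple_cons p))).
  rewrite /fubini_F => H.
  rewrite (_ : _ \o _ = (fun x => \int[tuple_measure P k]_y
     (EFin \o (fun p : T * k.-tuple T => f (tuple_cons p))) (x, y))%E).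
    apply: H; first exact/measurable_EFinP.
    by move=> p; rewrite /= lee_fin; case/andP: (f01 (tuple_cons p)).
  by apply/funext => y /=; rewrite GE.
- move=> y; rewrite Rintegral_ge0 /=; last first.
    by move=> t _; case/andP: (f01 (tuple_cons (y, t))).
  rewrite -[leRHS](Rintegral_cst_probability (tuple_measure P k)).
  apply: le_Rintegral => //; first exact: finite_measure_integrable_cst.
  by move=> t _; case/andP: (f01 (tuple_cons (y, t))).
- rewrite /Rintegral ge0_integral_tuple_measureS//.
  + by congr fine; apply: eq_integral => y _; rewrite GE.
  + exact/measurable_EFinP.
  + by move=> x; rewrite lee_fin; case/andP: (f01 x).
Qed.

(** * Replacement of the steps of a random walk by the heat flow *)

Section random_walk.
Context d (T : measurableType d) (R : realType) (P : probability T R).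
Variables (zeta : T -> R) (s2 : R).
Hypotheses (mzeta : measurable_fun setT zeta)
  (I1 : P.-integrable setT (EFin \o zeta)) (E1 : \int[P]_y zeta y = 0)
  (I2 : P.-integrable setT (EFin \o fun y => zeta y ^+ 2))
  (E2 : \int[P]_y zeta y ^+ 2 = s2)
  (I3 : P.-integrable setT (EFin \o fun y => `|zeta y| ^+ 3)).

Let measurable_gaussian_cdf : measurable_fun setT (@gaussian_cdf R).
Proof.
apply: continuous_measurable_fun => x; exact: gaussian_cdf_continuous.
Qed.

Let s2_ge0 : 0 <= s2.
Proof. by rewrite -E2; apply: Rintegral_ge0 => x _; rewrite sqr_ge0. Qed.

Let gaussian_cdf01 (x : R) : 0 <= gaussian_cdf x <= 1.
Proof. by rewrite gaussian_cdf_ge0 gaussian_cdf_le1. Qed.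

(** Put z = x / sqrt v and b = a / sqrt v. Integrating the Taylor polynomial [g] against the centred
    step leaves gaussian_cdf z - b^2 s2 psi / 2, and the heat expansion with h = a^2 s2 has the same
    terms. What survives is the cubic Taylor remainder, with the third absolute moment, and the
    quadratic heat remainder, with b^4 s2^2. *)
Lemma gaussian_smoothing_step :
  {C : R | 0 <= C & forall x v a, 0 < v ->
    `|\int[P]_y gaussian_cdf ((x + a * zeta y) / Num.sqrt v)
      - gaussian_cdf (x / Num.sqrt (v + a ^+ 2 * s2))|
    <= C * (`|a / Num.sqrt v| ^+ 3 + (a / Num.sqrt v) ^+ 4)}.
Proof.
have [C1 C10 H1] := @gaussian_cdf_taylor R.
have [C2 C20 H2] := @gaussian_cdf_heat R.
pose r3 := \int[P]_y `|zeta y| ^+ 3.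
have r30 : 0 <= r3 by apply: Rintegral_ge0 => y _; rewrite exprn_ge0.
have CC : 0 <= C1 * r3 + C2 * s2 ^+ 2 by rewrite addr_ge0// mulr_ge0// sqr_ge0.
exists (C1 * r3 + C2 * s2 ^+ 2) => // x v a v0.
set z := x / Num.sqrt v; set b := a / Num.sqrt v.
have sv0 : 0 < Num.sqrt v by rewrite sqrtr_gt0.
have b2 : b ^+ 2 = a ^+ 2 / v by rewrite /b expr_div_n sqr_sqrtr// ltW.
have := H2 x v (a ^+ 2 * s2) v0 (mulr_ge0 (sqr_ge0 _) s2_ge0).
rewrite -/z (mulrAC (a ^+ 2)) -b2.
set D := gaussian_cdf (x / _); set psi := z * gaussian_pdf z => hh.
under eq_Rintegral do rewrite mulrDl -/z (mulrAC a) -/b.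
pose g y := gaussian_cdf z + (b * gaussian_pdf z) * zeta y
  - (b ^+ 2 / 2 * psi) * zeta y ^+ 2.
have Ic (c : R) : P.-integrable setT (EFin \o fun=> c).
  exact: finite_measure_integrable_cst.
have Ig1 : P.-integrable setT (EFin \o fun y => (b * gaussian_pdf z) * zeta y).
  exact: integrable_funZl.
have Ig2 : P.-integrable setT (EFin \o fun y => (b ^+ 2 / 2 * psi) * zeta y ^+ 2).
  exact: integrable_funZl.
have Ig3 : P.-integrable setT (EFin \o fun y => gaussian_cdf z + (b * gaussian_pdf z) * zeta y).
  by apply: integrable_funD => //; exact: Ic.
have Ig : P.-integrable setT (EFin \o g) by exact: integrable_funB.
have Eg : \int[P]_y g y = gaussian_cdf z - b ^+ 2 / 2 * psi * s2.
  rewrite /g RintegralB// RintegralD//.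
  by rewrite !RintegralZl// E1 E2 mulr0 addr0 Rintegral_cst_probability.
have If : P.-integrable setT (EFin \o fun y => gaussian_cdf (z + b * zeta y)).
  apply: integrable_le1 => //; apply: measurableT_comp => //.
  by apply: measurable_funD => //; exact: measurable_funM.
have Ih : P.-integrable setT (EFin \o fun y => C1 * `|b| ^+ 3 * `|zeta y| ^+ 3).
  exact: integrable_funZl.
have := @Rintegral_dist_le _ _ _ P _ g _ If Ig Ih.
rewrite RintegralZl// -/r3 Eg => /(_ _)/wrap[].
  move=> y; have := H1 z (b * zeta y).
  rewrite (_ : C1 * _ = C1 * `|b| ^+ 3 * `|zeta y| ^+ 3); last first.
    by rewrite normrM exprMn mulrA.
  by congr (`|_| <= _); rewrite /g /psi; ring.
set J := \int[P]_y _ => hJ.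
have -> : J - D = (J - (gaussian_cdf z - b ^+ 2 / 2 * psi * s2))
   - (D - gaussian_cdf z + b ^+ 2 * s2 / 2 * psi) by ring.
apply: le_trans (ler_normB _ _) _.
have b4 : (b ^+ 2 * s2) ^+ 2 = b ^+ 4 * s2 ^+ 2 by rewrite exprMn -exprM.
rewrite b4 in hh.
have b40 : 0 <= b ^+ 4 by rewrite exprn_even_ge0.
have b30 : 0 <= `|b| ^+ 3 by rewrite exprn_ge0.
have s20 := sqr_ge0 s2.
have p1 := mulr_ge0 (mulr_ge0 C10 r30) b40.
have p2 := mulr_ge0 (mulr_ge0 C20 s20) b30.
lra.
Qed.

Definition walk k (x : k.-tuple T) : R := \sum_(i < k) zeta (tnth x i).

Lemma measurable_walk k : measurable_fun setT (@walk k).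
Proof.
apply: measurable_sum => i; apply: measurableT_comp => //.
exact: measurable_tnth.
Qed.

Lemma walk_cons k y (t : k.-tuple T) : walk (tuple_cons (y, t)) = zeta y + walk t.
Proof.
by rewrite /walk big_ord_recl; congr (_ + _); apply: eq_bigr => i _; rewrite tnthS.
Qed.

Let measurable_Fwalk k (x v a : R) : measurable_fun setT
  (fun t : k.-tuple T => gaussian_cdf ((x + a * walk t) / Num.sqrt v)).
Proof.
apply: measurableT_comp => //; apply: measurable_funM => //.
by apply: measurable_funD => //; apply: measurable_funM => //; exact: measurable_walk.
Qed.

(* Trotter's form of Lindeberg's replacement argument: gaussian_cdf (x / sqrt v)
   solves the heat equation in (v, x), so that one step of the walk is traded
   for an increment of the variance v. *)
Lemma gaussian_smoothing_walk :
  {C : R | 0 <= C & forall v a k x, 0 < v ->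
    `|\int[tuple_measure P k]_t gaussian_cdf ((x + a * walk t) / Num.sqrt v)
      - gaussian_cdf (x / Num.sqrt (v + k%:R * (a ^+ 2 * s2)))|
    <= k%:R * (C * (`|a / Num.sqrt v| ^+ 3 + (a / Num.sqrt v) ^+ 4))}.
Proof.
have [C C0 H] := gaussian_smoothing_step; exists C => // v a k x v0.
set e := C * _.
have e0 : 0 <= e.
  rewrite mulr_ge0//; apply: addr_ge0; [exact: exprn_ge0|exact: exprn_even_ge0].
elim: k x => [|k ih] x.
  rewrite /Rintegral integral_tuple_measure0 /walk big_ord0 mulr0 addr0.
  by rewrite !mul0r addr0 subrr normr0.
have [mG G01 ->] := Rintegral_tuple_measureS P (@measurable_Fwalk k.+1 x v a)
  (fun=> gaussian_cdf01 _).
set v' := v + k%:R * (a ^+ 2 * s2).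
have vv' : v <= v' by rewrite lerDl mulr_ge0// mulr_ge0// sqr_ge0.
have v'0 : 0 < v' by exact: lt_le_trans vv'.
have s0 : 0 < Num.sqrt v by rewrite sqrtr_gt0.
have s'0 : 0 < Num.sqrt v' by rewrite sqrtr_gt0.
set G := fun y => _ in mG G01 *.
have IG : P.-integrable setT (EFin \o G) by exact: integrable_le1.
have IP : P.-integrable setT
    (EFin \o fun y => gaussian_cdf ((x + a * zeta y) / Num.sqrt v')).
  apply: integrable_le1 => //; apply: measurableT_comp => //.
  by apply: measurable_funM => //; apply: measurable_funD => //; exact: measurable_funM.
have := Rintegral_dist_le IG IP (finite_measure_integrable_cst P (k%:R * e) measurableT).
rewrite Rintegral_cst_probability => /(_ _)/wrap[].
  move=> y; rewrite /G.
  under eq_Rintegral do rewrite walk_cons mulrDr addrA.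
  exact: ih.
have := H x v' a v'0.
have -> : v' + a ^+ 2 * s2 = v + k.+1%:R * (a ^+ 2 * s2).
  by rewrite /v' -natr1 mulrDl mul1r addrA.
set A := \int[P]_y G y; set B := \int[P]_y _; set D := gaussian_cdf _ => h1 h2.
(* The variance only grows along the replacement, so each step costs at most what it costs at the
   initial variance [v]. *)
have h3 : C * (`|a / Num.sqrt v'| ^+ 3 + (a / Num.sqrt v') ^+ 4) <= e.
  rewrite ler_wpM2l//.
  have n4 (u : R) : u ^+ 4 = `|u| ^+ 4 by rewrite -normrX ger0_norm// exprn_even_ge0.
  have h : `|a / Num.sqrt v'| <= `|a / Num.sqrt v|.
    rewrite !normrM ler_wpM2l// !normfV lef_pV2 ?posrE ?normr_gt0 ?gt_eqF//.
    by rewrite !gtr0_norm// ler_sqrt// ltW.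
  rewrite (n4 (a / Num.sqrt v')) (n4 (a / Num.sqrt v)).
  by apply: lerD; rewrite lerXn2r ?nnegrE.
rewrite (_ : A - D = (A - B) + (B - D)); last by ring.
apply: le_trans (ler_normD _ _) _; rewrite -natr1; lra.
Qed.

(** The shift [x] makes the induction possible: the first increment is absorbed in it, and its cross
    term integrates to 0 because the steps are centred. *)
Lemma walk_second_moment k x :
  (\int[tuple_measure P k]_t ((x + walk t) ^+ 2)%:E =
    (x ^+ 2 + k%:R * s2)%:E)%E.
Proof.
elim: k x => [|k ih] x.
  by rewrite integral_tuple_measure0 /walk big_ord0 mul0r !addr0.
rewrite ge0_integral_tuple_measureS//; last 2 first.
- apply/measurable_EFinP; apply: measurable_funX; apply: measurable_funD => //.
  exact: measurable_walk.
- by move=> t; rewrite lee_fin sqr_ge0.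
under eq_integral => y _.
  under eq_integral do rewrite walk_cons addrA.
  rewrite ih.
  over.
have Ic (c : R) : P.-integrable setT (EFin \o fun=> c).
  exact: finite_measure_integrable_cst.
have J1 : P.-integrable setT (EFin \o fun y => 2 * x * zeta y) by exact: integrable_funZl.
have J2 : P.-integrable setT (EFin \o fun y => (x ^+ 2 + k%:R * s2) + 2 * x * zeta y).
  by apply: integrable_funD => //; exact: Ic.
have J : P.-integrable setT (EFin \o fun y => (x + zeta y) ^+ 2 + k%:R * s2).
  rewrite (_ : (fun _ => _) = (fun y => ((x ^+ 2 + k%:R * s2) + 2 * x * zeta y) + zeta y ^+ 2)).
    exact: integrable_funD.
  by apply/funext => y; ring.
rewrite -[LHS]fineK; last by exact: (integrable_fin_num measurableT J).
congr EFin; rewrite -/(Rintegral _ _ _).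
transitivity (\int[P]_y (((x ^+ 2 + k%:R * s2) + 2 * x * zeta y) + zeta y ^+ 2)).
  by apply: eq_Rintegral => y _; ring.
rewrite RintegralD// RintegralD//.
rewrite RintegralZl// E1 E2 Rintegral_cst_probability -natr1; ring.
Qed.

Lemma walk_chebyshev k (c : R) : 0 < c ->
  (tuple_measure P k [set t | (c <= walk t ^+ 2)%R] <= (k%:R * s2 / c)%:E)%E.
Proof.
move=> c0.
have m2 : measurable_fun setT (fun t : k.-tuple T => (walk t ^+ 2)%R).
  by apply: measurable_funX; exact: measurable_walk.
have mA : measurable [set t : k.-tuple T | (c <= walk t ^+ 2)%R].
  rewrite -[X in measurable X]setTI.
  by have := m2 measurableT _ (measurable_itv `[c, +oo[);
   rewrite /preimage/=; under eq_set do rewrite in_itv/= andbT.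
rewrite mulrC EFinM lee_pdivlMl//.
have := walk_second_moment k 0.
under eq_integral do rewrite add0r.
rewrite expr0n/= add0r => <-.
rewrite -(integral_cst (tuple_measure P k) mA).
have m2A := measurable_funTS (D := [set t | (c <= walk t ^+ 2)%R]) m2.
apply: (@le_trans _ _ (\int[tuple_measure P k]_(t in [set t | (c <= walk t ^+ 2)%R])
   (walk t ^+ 2)%:E)%E).
  apply: ge0_le_integral => //.
  - by move=> t _; rewrite lee_fin ltW.
  - exact/measurable_EFinP.
apply: ge0_subset_integral => //.
- exact/measurable_EFinP.
- by move=> t _; rewrite lee_fin sqr_ge0.
Qed.

End random_walk.

(** * The Gaussian limit with possibly vanishing variance *)

Section gaussian_limit.
Context {R : realType}.
Implicit Types (t u e : R).

(** The distribution function of sqrt s2 times a standard Gaussian. The case s2 = 0 is separate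
    because a quotient by sqrt 0 is 0, which would give the constant [gaussian_cdf 0] in place of
    the unit step. *)
Definition gaussian_lim (s2 : R) u : R :=
  if s2 == 0 then (0 <= u)%R%:R else gaussian_cdf (u / Num.sqrt s2).

Lemma gaussian_cdf_div0 u : u != 0 -> forall e, 0 < e ->
  exists2 d0 : R, 0 < d0 & forall dl, 0 < dl -> dl < d0 ->
  `|gaussian_cdf (u / dl) - (0 <= u)%R%:R| <= e.
Proof.
move=> u0 e e0; have [up|un] := leP 0 u.
- have {u0 up}up : 0 < u by rewrite lt_neqAle eq_sym u0.
  have /cvgrPdist_le/(_ _ e0)[A [_ HA]] := @gaussian_cdf_cvgy R.
  exists (u / (`|A| + 1)); first by rewrite divr_gt0// ltr_wpDl.
  move=> dl dl0; rewrite ltr_pdivlMr ?ltr_wpDl// mulrC -ltr_pdivlMr// => h.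
  rewrite distrC; apply: HA; apply: le_lt_trans h.
  by rewrite (le_trans (ler_norm _))// lerDl.
- have /cvgrPdist_le/(_ _ e0)[A [_ HA]] := @gaussian_cdf_cvgNy R.
  exists (- u / (`|A| + 1)); first by rewrite divr_gt0 ?oppr_gt0// ltr_wpDl.
  move=> dl dl0; rewrite ltr_pdivlMr ?ltr_wpDl// mulrC -ltr_pdivlMr// mulNr ltrNr => h.
  rewrite distrC; apply: HA; apply: lt_le_trans h _.
  rewrite lerNl; apply: le_trans (_ : `|A| <= _); last by rewrite lerDl.
  by rewrite -normrN ler_norm.
Qed.

Lemma gaussian_lim_approx (s2 : R) u : 0 <= s2 -> s2 != 0 \/ u != 0 ->
  forall e, 0 < e -> exists2 d0 : R, 0 < d0 & forall dl, 0 < dl -> dl < d0 ->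
  `|gaussian_cdf (u / Num.sqrt (dl ^+ 2 + s2)) - gaussian_lim s2 u| <= e.
Proof.
move=> s20 H e e0; rewrite /gaussian_lim; case: eqVneq H => [->|s2n _].
  case=> [//|un].
  have [d0 d00 Hd] := gaussian_cdf_div0 un e0; exists d0 => // dl dl0 dld.
  by rewrite addr0 sqrtr_sqr (gtr0_norm dl0); exact: Hd.
have s2p : 0 < s2 by rewrite lt_neqAle eq_sym s2n.
pose f x : R := gaussian_cdf (u / Num.sqrt (x ^+ 2 + s2)).
have cf : f x @[x --> (0:R)] --> f 0.
  apply: (cvg_comp (fun x => u / Num.sqrt (x ^+ 2 + s2)) (@gaussian_cdf R)); last first.
    exact: gaussian_cdf_continuous.
  apply: cvgM; first exact: cvg_cst.
  apply: cvgV; first by rewrite gt_eqF// sqrtr_gt0 expr0n/= add0r.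
  apply: (cvg_comp (fun x : R => x ^+ 2 + s2) (@Num.sqrt R)); last exact: sqrt_continuous.
  by apply: cvgD; [exact: sqr_continuous|exact: cvg_cst].
have /cvgrPdist_le/(_ _ e0)[d0 /= d00 Hd] := cf.
exists d0 => // dl dl0 dld.
have <- : f 0 = gaussian_cdf (u / Num.sqrt s2) by rewrite /f expr0n/= add0r.
rewrite distrC; apply: Hd.
by rewrite /= sub0r normrN gtr0_norm.
Qed.

(** Continuity in the one-sided form used for squeezing. Besides, t + eta and t - eta are again
    admissible points, so that limit statements can be invoked there; when s2 = 0 the choice eta =
    |t| / 2 keeps them on the side of t. *)
Lemma gaussian_lim_continuous (s2 : R) t : 0 <= s2 -> s2 != 0 \/ t != 0 ->
  forall e, 0 < e -> exists2 eta : R, 0 < eta &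
  [/\ s2 != 0 \/ t + eta != 0, s2 != 0 \/ t - eta != 0,
     gaussian_lim s2 (t + eta) <= gaussian_lim s2 t + e &
     gaussian_lim s2 t - e <= gaussian_lim s2 (t - eta)].
Proof.
move=> s20 H e e0; rewrite /gaussian_lim; case: eqVneq H => [_|s2n _].
  case=> [//|tn].
  have t0 : 0 < `|t| by rewrite normr_gt0.
  exists (`|t| / 2); first by rewrite divr_gt0.
  have [tp|tp] := leP 0 t.
  - rewrite (ger0_norm tp) in t0 *.
    have -> : (0 <= t + t / 2) by lra.
    have -> : (0 <= t - t / 2) by lra.
    split; [right|right|lra|lra]; rewrite gt_eqF//; lra.
  - rewrite (ltr0_norm tp) in t0 *.
    have -> : (0 <= t + - t / 2) = false by apply/negbTE; rewrite -ltNge; lra.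
    have -> : (0 <= t - - t / 2) = false by apply/negbTE; rewrite -ltNge; lra.
    split; [right|right|lra|lra]; rewrite lt_eqF//; lra.
have s2p : 0 < s2 by rewrite lt_neqAle eq_sym s2n.
pose f x : R := gaussian_cdf (x / Num.sqrt s2).
have cf : f x @[x --> t] --> f t.
  apply: (cvg_comp (fun x => x / Num.sqrt s2) (@gaussian_cdf R)); last first.
    exact: gaussian_cdf_continuous.
  by apply: cvgM; [exact: cvg_id|exact: cvg_cst].
have /cvgrPdist_le/(_ _ e0)[d0 /= d00 Hd] := cf.
have d2 : `|d0 / 2| < d0 by rewrite gtr0_norm ?divr_gt0//; lra.
exists (d0 / 2); first by rewrite divr_gt0.
have hp : `|f t - f (t + d0 / 2)| <= e.
  by apply: Hd; rewrite /= opprD addrA subrr sub0r normrN.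
have hm : `|f t - f (t - d0 / 2)| <= e.
  by apply: Hd; rewrite /= opprD opprK addrA subrr add0r.
move: hp hm; rewrite !ler_norml => /andP[h1 h2] /andP[h3 h4].
by split; [left|left|rewrite /f in h1; lra|rewrite /f in h4; lra].
Qed.

End gaussian_limit.

Lemma cvg_sqrtnVy {R : realType} : (Num.sqrt m%:R)^-1 @[m --> \oo] --> (0 : R).
Proof.
apply/gtr0_cvgV0.
  by exists 1%N => // m /= m0; rewrite sqrtr_gt0 ltr0n.
apply/cvgryPge => A.
have /cvgryPge/(_ (A ^+ 2)) := @cvgr_idn R.
apply: filterS => m /= h.
by rewrite (le_trans (ler_norm A))// -sqrtr_sqr ler_sqrt.
Qed.

(** Bookkeeping for the central limit theorem: [l], [l1], [l2] are the limits at t, t + eta, t -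
    eta; [g1], [g2] their smoothed versions; [c], [f] the values of [gaussian_cdf] at eta / dl and -
    eta / dl; [eps] is the replacement error and [w] the probability. *)
Lemma smoothing_dist (R : realType) (l l1 l2 g1 g2 c f w eps e : R) :
  g1 - l1 <= e / 4 -> - (e / 4) <= g2 - l2 -> - (e / 4) <= c - 1 -> f - 0 <= e / 4 ->
  eps <= e / 4 -> w <= g1 + eps + (1 - c) -> g2 - eps - f <= w ->
  l1 <= l + e / 4 -> l - e / 4 <= l2 -> `|l - w| <= e.
Proof. by move=> *; rewrite ler_norml; apply/andP; split; lra. Qed.

Section central_limit.
Context d (T : measurableType d) (R : realType) (P : probability T R).
Variables (zeta : T -> R) (s2 : R).
Hypotheses (mzeta : measurable_fun setT zeta)
  (I1 : P.-integrable setT (EFin \o zeta)) (E1 : \int[P]_y zeta y = 0)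
  (I2 : P.-integrable setT (EFin \o fun y => zeta y ^+ 2))
  (E2 : \int[P]_y zeta y ^+ 2 = s2)
  (I3 : P.-integrable setT (EFin \o fun y => `|zeta y| ^+ 3)).

Let walk_le m (t : R) : set (m.-tuple T) :=
  [set x | walk zeta x <= t * Num.sqrt m%:R].

Lemma measurable_walk_le m t : measurable (@walk_le m t).
Proof.
rewrite -[X in measurable X]setTI.
have := @measurable_walk _ _ _ _ mzeta m measurableT _
  (measurable_itv `]-oo, t * Num.sqrt m%:R]).
by rewrite /preimage/=; under eq_set do rewrite in_itv/=.
Qed.

Lemma measurable_gaussian_walk m (x v a : R) : measurable_fun setT
  (fun t : m.-tuple T => gaussian_cdf ((x + a * walk zeta t) / Num.sqrt v)).
Proof.
apply: measurableT_comp.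
  by apply: continuous_measurable_fun => z; exact: gaussian_cdf_continuous.
apply: measurable_funM => //; apply: measurable_funD => //.
by apply: measurable_funM => //; exact: measurable_walk.
Qed.

(** With W = walk / sqrt m, the indicator of W <= t is at most gaussian_cdf ((t + eta - W) / dl) + 1
    - gaussian_cdf (eta / dl), by monotonicity of [gaussian_cdf], and there is a similar lower bound
    with t - eta. The smoothed terms are evaluated by the replacement lemma with initial variance
    dl^2 and a = - 1 / sqrt m, which makes the final variance dl^2 + s2. The error [e] is m times
    the cost of one step. *)
Lemma walk_cdf_bounds : {C : R | 0 <= C & forall (dl eta t : R) m,
  0 < dl -> (0 < m)%N ->
  let F := fine (tuple_measure P m (@walk_le m t)) in
  let e := C * ((dl ^- 3) / Num.sqrt m%:R + (dl ^- 4) / m%:R) in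
  F <= gaussian_cdf ((t + eta) / Num.sqrt (dl ^+ 2 + s2)) + e
       + (1 - gaussian_cdf (eta / dl)) /\
  gaussian_cdf ((t - eta) / Num.sqrt (dl ^+ 2 + s2)) - e
       - gaussian_cdf (- eta / dl) <= F }.
Proof.
have [C C0 H] := gaussian_smoothing_walk mzeta I1 E1 I2 E2 I3.
exists C => // dl eta t m dl0 m0 F e.
pose sm : R := Num.sqrt m%:R.
have sm0 : 0 < sm by rewrite sqrtr_gt0 ltr0n.
have mE : m%:R = sm ^+ 2 by rewrite sqr_sqrtr.
have dlE : Num.sqrt (dl ^+ 2) = dl by rewrite sqrtr_sqr gtr0_norm.
have mA := measurable_walk_le t (m := m).
have IA : (tuple_measure P m).-integrable setT (EFin \o \1_(@walk_le m t)).
  by apply: integrable_le1 => // x; rewrite indicE; case: (_ \in _); rewrite /= ?lexx ler01.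
have FE : F = \int[tuple_measure P m]_x (\1_(@walk_le m t) x).
  by rewrite /Rintegral integral_indic// setIT.
have Ic (c : R) : (tuple_measure P m).-integrable setT (EFin \o fun=> c).
  exact: finite_measure_integrable_cst.
have key x : `|\int[tuple_measure P m]_y
    gaussian_cdf ((x + - sm^-1 * walk zeta y) / dl)
   - gaussian_cdf (x / Num.sqrt (dl ^+ 2 + s2))| <= e.
  have := H (dl ^+ 2) (- sm^-1) m x (exprn_gt0 _ dl0).
  rewrite dlE sqrrN (_ : m%:R * (_ * s2) = s2); last first.
    by rewrite mE; field; rewrite gt_eqF.
  move/le_trans; apply.
  rewrite mulrCA ler_wpM2l// le_eqVlt; apply/orP; left; apply/eqP.
  rewrite mulNr normrN gtr0_norm ?divr_gt0 ?invr_gt0// -/sm mE.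
  by field; rewrite !gt_eqF.
have IG x : (tuple_measure P m).-integrable setT
    (EFin \o fun y => gaussian_cdf ((x + - sm^-1 * walk zeta y) / dl)).
  apply: integrable_le1 => [|y].
    by have := @measurable_gaussian_walk m x (dl ^+ 2) (- sm^-1); rewrite dlE.
  by rewrite gaussian_cdf_ge0 gaussian_cdf_le1.
split.
- have := key (t + eta); rewrite ler_norml => /andP[_ h2].
  suff : F <= \int[tuple_measure P m]_y
      (gaussian_cdf ((t + eta + - sm^-1 * walk zeta y) / dl) + (1 - gaussian_cdf (eta / dl))).
    rewrite RintegralD// Rintegral_cst_probability; lra.
  rewrite FE; apply: le_Rintegral => //; first exact: integrable_funD.
  move=> x _; rewrite indicE; have [|_] := boolP (x \in _); last first.
    by rewrite addr_ge0 ?gaussian_cdf_ge0// subr_ge0 gaussian_cdf_le1.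
  rewrite inE /walk_le/= => h.
  suff : gaussian_cdf (eta / dl) <=
    gaussian_cdf ((t + eta + - sm^-1 * walk zeta x) / dl) by lra.
  apply: gaussian_cdf_nondecreasing; rewrite ler_pM2r ?invr_gt0//.
  suff : sm^-1 * walk zeta x <= t by lra.
  by rewrite mulrC ler_pdivrMr.
- have := key (t - eta); rewrite ler_norml => /andP[h1 _].
  suff : \int[tuple_measure P m]_y
      (gaussian_cdf ((t - eta + - sm^-1 * walk zeta y) / dl) - gaussian_cdf (- eta / dl)) <= F.
    rewrite RintegralB// Rintegral_cst_probability; lra.
  rewrite FE; apply: le_Rintegral => //; first exact: integrable_funB.
  move=> x _; rewrite indicE; have [_|] := boolP (x \in _).
    by rewrite /= lerBlDr (le_trans (gaussian_cdf_le1 _))// lerDl gaussian_cdf_ge0.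
  rewrite notin_setE /walk_le/= => /negP; rewrite -ltNge => h.
  rewrite subr_le0.
  apply: gaussian_cdf_nondecreasing; rewrite ler_pM2r ?invr_gt0//.
  suff : t <= sm^-1 * walk zeta x by lra.
  by rewrite mulrC ler_pdivlMr// ltW.
Qed.

(** The order of choice matters: eta from the continuity of the limit; then dl, so small that
    gaussian_cdf at eta / dl and - eta / dl is close to 1 and 0 and that adding dl^2 to the variance
    is harmless; and m last, because the replacement error grows with negative powers of dl. *)
Theorem central_limit_theorem t : s2 != 0 \/ t != 0 ->
  fine (tuple_measure P m (@walk_le m t)) @[m --> \oo] --> gaussian_lim s2 t.
Proof.
move=> H.
have s20 : 0 <= s2 by rewrite -E2; apply: Rintegral_ge0 => x _; rewrite sqr_ge0.
have [C C0 B] := walk_cdf_bounds.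
apply/cvgrPdist_le => e e0.
have e4 : 0 < e / 4 by rewrite divr_gt0.
have [eta eta0 [Hp Hm hp hm]] := gaussian_lim_continuous s20 H e4.
have [d1 d10 D1] := gaussian_lim_approx s20 Hp e4.
have [d2 d20 D2] := gaussian_lim_approx s20 Hm e4.
have eta_n0 : eta != 0 by rewrite gt_eqF.
have neta_n0 : - eta != 0 by rewrite oppr_eq0.
have [d3 d30 D3] := gaussian_cdf_div0 eta_n0 e4.
have [d4 d40 D4] := gaussian_cdf_div0 neta_n0 e4.
pose dl := Num.min (Num.min d1 d2) (Num.min d3 d4) / 2.
have dl0 : 0 < dl by rewrite divr_gt0// !lt_min d10 d20 d30 d40.
have dlt : dl < Num.min (Num.min d1 d2) (Num.min d3 d4).
  by rewrite /dl ltr_pdivrMr// ltr_pMr ?ltr1n// !lt_min d10 d20 d30 d40.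
move: dlt; rewrite !lt_min => /andP[/andP[l1 l2] /andP[l3 l4]].
have := D1 _ dl0 l1; rewrite ler_norml => /andP[a1 a2].
have := D2 _ dl0 l2; rewrite ler_norml => /andP[b1 b2].
have := D3 _ dl0 l3; rewrite (ltW eta0) ler_norml/= => /andP[c1 c2].
have nneg : (0 <= - eta) = false by rewrite oppr_ge0 leNgt eta0.
have := D4 _ dl0 l4; rewrite nneg ler_norml/= => /andP[f1 f2].
have cv : C * ((dl ^- 3) / Num.sqrt m%:R + (dl ^- 4) / m%:R) @[m --> \oo] --> (0 : R).
  rewrite -(mulr0 C); apply: cvgM; first exact: cvg_cst.
  rewrite -(addr0 0); apply: cvgD.
    rewrite -(mulr0 (dl ^- 3)); apply: cvgM; first exact: cvg_cst.
    exact: cvg_sqrtnVy.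
  rewrite -(mulr0 (dl ^- 4)); apply: cvgM; first exact: cvg_cst.
  rewrite (_ : (fun _ => _) = (fun m : nat => (Num.sqrt (m%:R : R))^-1 * (Num.sqrt m%:R)^-1)).
    by rewrite -(mulr0 0); apply: cvgM; exact: cvg_sqrtnVy.
  by apply/funext => m; rewrite -invfM -expr2 sqr_sqrtr.
have /cvgrPdist_le/(_ _ e4) := cv.
apply: filter_app; near=> m.
have m0 : (0 < m)%N by near: m; exact: nbhs_infty_gt.
rewrite sub0r normrN => /ler_normlP[_ hC].
have [u1 u2] := B dl eta t m dl0 m0.
exact: smoothing_dist a2 b1 c1 f2 hC u1 u2 hp hm.
Unshelve. all: by end_near.
Qed.

End central_limit.

(** * The delta method *)

Section third_moment.
Context d (T : measurableType d) (R : realType) (P : probability T R).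
Implicit Types f g : T -> R.

Lemma integrable_dominated f g : measurable_fun setT f ->
  P.-integrable setT (EFin \o g) -> (forall x, `|f x| <= g x) ->
  P.-integrable setT (EFin \o f).
Proof.
move=> mf Ig fg; apply: (le_integrable measurableT) Ig => //.
  exact/measurable_EFinP.
move=> x _ /=; rewrite lee_fin (ger0_norm (le_trans _ (fg x)))//.
Qed.

Lemma integrable_cube_le f : measurable_fun setT f ->
  P.-integrable setT (EFin \o fun x => `|f x| ^+ 3) ->
  P.-integrable setT (EFin \o f) /\
  P.-integrable setT (EFin \o fun x => f x ^+ 2).
Proof.
move=> mf I3.
have I : P.-integrable setT (EFin \o fun x => 1 + `|f x| ^+ 3).
  by apply: integrable_funD => //; exact: finite_measure_integrable_cst.
have n0 x := normr_ge0 (f x).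
split; apply: integrable_dominated I _ => //.
- move=> x; have := n0 x; set u := `|f x| => u0.
  have [u1|/ltW u1] := leP u 1; first by rewrite ler_wpDr// exprn_ge0.
  by rewrite ler_wpDl// ler_eXnr.
- by apply: measurable_funX.
- move=> x; rewrite normrX; have := n0 x; set u := `|f x| => u0.
  have [u1|/ltW u1] := leP u 1.
    by rewrite ler_wpDr ?exprn_ge0// exprn_ile1.
  by rewrite ler_wpDl// ler_weXn2l.
Qed.

Lemma integrable_cubeB (al be : R) f g :
  measurable_fun setT f -> measurable_fun setT g ->
  P.-integrable setT (EFin \o fun x => `|f x| ^+ 3) ->
  P.-integrable setT (EFin \o fun x => `|g x| ^+ 3) ->
  P.-integrable setT (EFin \o fun x => `|al * f x - be * g x| ^+ 3).
Proof.
move=> mf mg If Ig.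
have I : P.-integrable setT (EFin \o fun x =>
    4 * `|al| ^+ 3 * `|f x| ^+ 3 + 4 * `|be| ^+ 3 * `|g x| ^+ 3).
  by apply: integrable_funD; exact: integrable_funZl.
apply: integrable_dominated I _.
  apply: measurable_funX; apply: measurableT_comp => //.
  by apply: measurable_funB; exact: measurable_funM.
move=> x; rewrite normrX normr_id.
rewrite -(mulrA 4) -(mulrA 4) -!exprMn -!normrM.
apply: le_trans (_ : (`|al * f x| + `|be * g x|) ^+ 3 <= _).
  by rewrite lerXn2r ?nnegrE ?addr_ge0// ler_normB.
have := normr_ge0 (al * f x); have := normr_ge0 (be * g x).
move: `|_| `|_| => u v u0 v0.
(* Three times this expression is 4 u^3 + 4 v^3 - (u + v)^3. *)
have : 0 <= (u + v) * (u - v) ^+ 2 by rewrite mulr_ge0 ?addr_ge0// sqr_ge0.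
lra.
Qed.

End third_moment.

Lemma dist_squeeze (R : realType) (l l1 l2 p w1 w2 b e : R) :
  `|l1 - w1| <= e / 4 -> `|l2 - w2| <= e / 4 -> b <= e / 4 ->
  p <= w1 + b -> w2 <= p + b -> l1 <= l + e / 4 -> l - e / 4 <= l2 -> `|l - p| <= e.
Proof. by rewrite !ler_norml => /andP[? ?] /andP[? ?] *; apply/andP; split; lra. Qed.

(** Here [L] is the logarithm of the ratio, [W] the walk of zeta divided by m, [u] is t / sqrt m,
    [l] is ln (1 + u) and [q] is u^2. The errors [c] of the ratio and [d] of the threshold together
    make up [eps] = eta / sqrt m. *)
Lemma delta_bounds (R : realType) (L W c d q l u eps : R) :
  - c <= L - W -> L - W <= c -> u - 2 * q <= l -> l <= u -> 2 * q <= d ->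
  c + d = eps -> (L <= l -> W <= u + eps) /\ (W <= u - eps -> L <= l).
Proof. by move=> *; split=> ?; lra. Qed.

Section delta_method.
Context d (T : measurableType d) (R : realType) (P : probability T R).
Variables (X1 X2 : T -> R) (al be : R).
Hypotheses (mX1 : measurable_fun setT X1) (mX2 : measurable_fun setT X2)
  (I1 : P.-integrable setT (EFin \o fun x => `|X1 x| ^+ 3))
  (I2 : P.-integrable setT (EFin \o fun x => `|X2 x| ^+ 3))
  (E1 : \int[P]_x X1 x = 0) (E2 : \int[P]_x X2 x = 0).

Let zeta x := al * X1 x - be * X2 x.

Let s2 := \int[P]_x zeta x ^+ 2.

(** When X1 and X2 have the form f / c - 1, with c the mean of f, each factor is a power of an
    empirical mean normalized to expectation 1. The first order term of the logarithm is the average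
    of zeta. *)
Definition ratio m (x : m.-tuple T) : R :=
  (1 + walk X1 x / m%:R) `^ al * (1 + walk X2 x / m%:R) `^ (- be).

Lemma measurable_ratio m : measurable_fun setT (@ratio m).
Proof.
by apply: measurable_funM; apply: (measurableT_comp (measurable_powR _));
  apply: measurable_funD => //; apply: measurable_funM => //; exact: measurable_walk.
Qed.

Let mzeta : measurable_fun setT zeta.
Proof. by apply: measurable_funB; exact: measurable_funM. Qed.

Let stat_le m t : set (m.-tuple T) := [set x | Num.sqrt m%:R * (ratio x - 1) <= t].

Let walk_le m t : set (m.-tuple T) := [set x | walk zeta x <= t * Num.sqrt m%:R].

(** The event (walk / m)^2 >= k / sqrt m. By Chebyshev its probability is O(1 / sqrt m), while off
    it the quadratic error of a logarithm is O(k / sqrt m), which is exactly the scale of a shift of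
    t by a multiple of k. *)
Let bad (X : T -> R) m k : set (m.-tuple T) :=
  [set x | m%:R * Num.sqrt m%:R * k <= walk X x ^+ 2].

Let walk_zeta m (x : m.-tuple T) :
  walk zeta x = al * walk X1 x - be * walk X2 x.
Proof. by rewrite /walk sumrB !mulr_sumr. Qed.

Let measurable_le (f : forall m, m.-tuple T -> R) m t :
  measurable_fun setT (f m) -> measurable [set x | f m x <= t].
Proof.
move=> mf; rewrite -[X in measurable X]setTI.
have := mf measurableT _ (measurable_itv `]-oo, t]).
by rewrite /preimage/=; under eq_set do rewrite in_itv/=.
Qed.

Let measurable_bad X m k : measurable_fun setT X -> measurable (@bad X m k).
Proof.
move=> mX; rewrite -[X in measurable X]setTI.
have m2 : measurable_fun setT (fun t : m.-tuple T => walk X t ^+ 2).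
  by apply: measurable_funX; exact: measurable_walk.
have := m2 measurableT _ (measurable_itv `[m%:R * Num.sqrt m%:R * k, +oo[).
by rewrite /preimage/=; under eq_set do rewrite in_itv/= andbT.
Qed.

(** Total cost in units of k / sqrt m: the two logarithms contribute 2 (|al| + |be|), the logarithm
    in the threshold contributes 1. Hence the choice k = eta / B. *)
Let B := 2 * (`|al| + `|be|) + 1.

Let ln_bounds (u : R) : `|u| <= 2^-1 -> u - 2 * u ^+ 2 <= ln (1 + u) <= u.
Proof.
rewrite ler_norml => /andP[u1 u2].
apply/andP; split; last by apply: le_ln1Dx; lra.
have h : ln (1 + - (u / (1 + u))) <= - (u / (1 + u)).
  by apply: le_ln1Dx; rewrite ltrN2 ltr_pdivrMr; lra.
have E : 1 + - (u / (1 + u)) = (1 + u)^-1 by field; lra.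
rewrite E lnV ?posrE ?lerN2 in h; last by lra.
apply: le_trans h; rewrite ler_pdivlMr; last by lra.
have : 0 <= u ^+ 2 * (1 + 2 * u) by rewrite mulr_ge0 ?sqr_ge0//; lra.
lra.
Qed.

Let ln_ratio m (x : m.-tuple T) k : (0 < m)%N ->
  k / Num.sqrt m%:R <= 4^-1 -> ~ bad X1 k x -> ~ bad X2 k x ->
  0 < ratio x /\
  `|ln (ratio x) - walk zeta x / m%:R| <= 2 * (`|al| + `|be|) * (k / Num.sqrt m%:R).
Proof.
move=> m0 hk; rewrite /bad/= => /negP b1 /negP b2.
rewrite -ltNge in b1; rewrite -ltNge in b2.
rewrite walk_zeta /ratio.
have mp : 0 < m%:R :> R by rewrite ltr0n.
have sp : 0 < Num.sqrt m%:R :> R by rewrite sqrtr_gt0.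
have aux w : w ^+ 2 < m%:R * Num.sqrt m%:R * k -> let u := w / m%:R in
   [/\ u ^+ 2 <= k / Num.sqrt m%:R, 0 < 1 + u & `|ln (1 + u) - u| <= 2 * (k / Num.sqrt m%:R)].
  move=> hw u.
  have u2 : u ^+ 2 <= k / Num.sqrt m%:R.
    rewrite /u expr_div_n ler_pdivrMr ?exprn_gt0// ltW//.
    apply: lt_le_trans hw _; rewrite le_eqVlt; apply/orP; left; apply/eqP.
    have -> : (m%:R : R) = Num.sqrt m%:R ^+ 2 by rewrite sqr_sqrtr.
    by rewrite sqrtr_sqr ger0_norm ?sqrtr_ge0//; field; rewrite gt_eqF.
  have un : `|u| <= 2^-1.
    rewrite -(@ler_pXn2r _ 2%N) ?nnegrE ?invr_ge0// real_normK ?num_real//.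
    by apply: (le_trans u2); apply: (le_trans hk); lra.
  have /andP[l1 l2] := ln_bounds un.
  split=> //; first by move: un; rewrite ler_norml => /andP[? ?]; lra.
  by rewrite ler_norml; apply/andP; split; have := sqr_ge0 u; lra.
have [_ p1 h1] := aux _ b1; have [_ p2 h2] := aux _ b2.
have q1 := powR_gt0 al p1; have q2 := powR_gt0 (- be) p2.
split; first exact: mulr_gt0.
rewrite lnM ?posrE// !ln_powR.
set u := walk X1 x / m%:R; set v := walk X2 x / m%:R.
rewrite -/u -/v in h1 h2.
rewrite (_ : _ - _ = al * (ln (1 + u) - u) - be * (ln (1 + v) - v)); last first.
  by rewrite /u /v; ring.
apply: le_trans (ler_normB _ _) _; rewrite !normrM.
have := ler_wpM2l (normr_ge0 al) h1; have := ler_wpM2l (normr_ge0 be) h2; lra.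
Qed.

(** For a positive ratio, sqrt m (ratio - 1) <= t means ln ratio <= ln (1 + t / sqrt m). Off the bad
    events the left side is the average of zeta and the right side is t / sqrt m, up to eta / sqrt m
    altogether, so the event lies between those of the walk at t - eta and t + eta. *)
Lemma delta_method t : s2 != 0 \/ t != 0 ->
  fine (tuple_measure P m (@stat_le m t)) @[m --> \oo] --> gaussian_lim s2 t.
Proof.
move=> H.
have s20 : 0 <= s2 by apply: Rintegral_ge0 => x _; rewrite sqr_ge0.
have [J1 K1] := integrable_cube_le mX1 I1.
have [J2 K2] := integrable_cube_le mX2 I2.
have I3 := integrable_cubeB al be mX1 mX2 I1 I2.
have [J K] := integrable_cube_le mzeta I3.
have E : \int[P]_x zeta x = 0.
  rewrite /zeta RintegralB//; try exact: integrable_funZl.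
  by rewrite !RintegralZl// E1 E2 !mulr0 subrr.
have clt u := central_limit_theorem mzeta J E K (erefl s2) I3 (t := u).
apply/cvgrPdist_le => e e0.
have e4 : 0 < e / 4 by rewrite divr_gt0.
have [eta eta0 [Hp Hm hp hm]] := gaussian_lim_continuous s20 H e4.
have B0 : 0 < B by rewrite /B ltr_wpDl// mulr_ge0// addr_ge0.
pose k := eta / B.
have k0 : 0 < k by rewrite divr_gt0.
have Bk : 2 * (`|al| + `|be|) * k + k = eta by rewrite /k /B; field; rewrite gt_eqF.
pose v := \int[P]_x X1 x ^+ 2 + \int[P]_x X2 x ^+ 2.
have c1 : \forall m \near \oo, `|v / k * (Num.sqrt m%:R)^-1| <= e / 4.
  have : v / k * (Num.sqrt m%:R)^-1 @[m --> \oo] --> (0 : R).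
    by rewrite -(mulr0 (v / k)); apply: cvgM; [exact: cvg_cst|exact: cvg_sqrtnVy].
  move=> /cvgrPdist_le/(_ _ e4); apply: filterS => m.
  by rewrite sub0r normrN.
have c2 (C r : R) : 0 < r -> \forall m \near \oo, `|C * (Num.sqrt m%:R)^-1| <= r.
  move=> r0; have : C * (Num.sqrt m%:R)^-1 @[m --> \oo] --> (0 : R).
    by rewrite -(mulr0 C); apply: cvgM; [exact: cvg_cst|exact: cvg_sqrtnVy].
  move=> /cvgrPdist_le/(_ _ r0); apply: filterS => m.
  by rewrite sub0r normrN.
have := clt _ Hp => /cvgrPdist_le/(_ _ e4) L1.
have := clt _ Hm => /cvgrPdist_le/(_ _ e4) L2.
near=> m.
have m0 : (0 < m)%N by near: m; exact: nbhs_infty_gt.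
have mp : 0 < m%:R :> R by rewrite ltr0n.
set s : R := Num.sqrt m%:R.
have sp : 0 < s by rewrite sqrtr_gt0.
have mE : m%:R = s ^+ 2 by rewrite sqr_sqrtr.
have V : fine (tuple_measure P m (@bad X1 m k)) + fine (tuple_measure P m (@bad X2 m k)) <= e / 4.
  have cb X : measurable_fun setT X -> P.-integrable setT (EFin \o X) ->
      \int[P]_x X x = 0 -> P.-integrable setT (EFin \o fun x => X x ^+ 2) ->
      fine (tuple_measure P m (@bad X m k)) <= \int[P]_x X x ^+ 2 / k * s^-1.
    move=> mX JX EX KX; rewrite -lee_fin fineK ?fin_num_measure//; last exact: measurable_bad.
    have c0 : 0 < m%:R * s * k := mulr_gt0 (mulr_gt0 mp sp) k0.
    apply: le_trans (walk_chebyshev mX JX EX KX (erefl _) m c0) _.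
    by rewrite lee_fin le_eqVlt; apply/orP; left; apply/eqP; field; rewrite !gt_eqF.
  apply: le_trans (lerD (cb _ mX1 J1 E1 K1) (cb _ mX2 J2 E2 K2)) _.
  rewrite -!mulrDl -/v; apply: le_trans (ler_norm _) _.
  rewrite /s; near: m; exact: c1.
have hk : k / s <= 4^-1.
  by apply: le_trans (ler_norm _) _; rewrite /s; near: m; apply: c2; rewrite invr_gt0.
have ht : `|t / s| <= 2^-1 by rewrite /s; near: m; apply: c2; rewrite invr_gt0.
have ht2 : 2 * (t / s) ^+ 2 <= k / s.
  rewrite (_ : 2 * _ = 2 * t ^+ 2 / s / s); last by field; rewrite gt_eqF.
  rewrite ler_pM2r ?invr_gt0//; apply: le_trans (ler_norm _) _.
  by rewrite /s; near: m; exact: c2.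
have t1p : 0 < 1 + t / s.
  have : - (t / s) <= 2^-1 by rewrite (le_trans (ler_norm _))// normrN.
  by move=> h; rewrite -[t / s]opprK subr_gt0 (le_lt_trans h)// invf_lt1 ?ltr1n.
have /andP[lt1 lt2] := ln_bounds ht.
have kds : 2 * (`|al| + `|be|) * (k / s) + k / s = eta / s by rewrite -Bk; ring.
have mst u : measurable (@stat_le m u).
  apply: (@measurable_le (fun m x => Num.sqrt m%:R * (ratio x - 1)) m u).
  by apply: measurable_funM => //; apply: measurable_funB => //; exact: measurable_ratio.
have mwk u : measurable (@walk_le m u) by apply: measurable_le; exact: measurable_walk.
have mb1 := @measurable_bad X1 m k mX1.
have mb2 := @measurable_bad X2 m k mX2.
have statP (x : m.-tuple T) : 0 < ratio x -> stat_le t x <-> ln (ratio x) <= ln (1 + t / s).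
  move=> r0; rewrite ler_ln ?posrE//.
  suff <- : (s * (ratio x - 1) <= t) = (ratio x <= 1 + t / s).
    by exact: iff_refl.
  by rewrite mulrC -ler_pdivlMr// lerBlDl.
have walkP u (x : m.-tuple T) : walk_le u x <-> walk zeta x / m%:R <= u / s.
  rewrite /walk_le/= -/s ler_pdivrMr// mE (_ : u / s * s ^+ 2 = u * s)//.
  by field; rewrite gt_eqF.
have sub1 : @stat_le m t `<=` @walk_le m (t + eta) `|` (@bad X1 m k `|` @bad X2 m k).
  move=> x hx.
  have [b1|b1] := pselect (bad X1 k x); first by right; left.
  have [b2|b2] := pselect (bad X2 k x); first by right; right.
  left; have [r0] := ln_ratio m0 hk b1 b2; rewrite -/s ler_norml => /andP[l1 l2].
  apply/walkP; rewrite mulrDl.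
  exact: (delta_bounds l1 l2 lt1 lt2 ht2 kds).1 ((statP _ r0).1 hx).
have sub2 : @walk_le m (t - eta) `<=` @stat_le m t `|` (@bad X1 m k `|` @bad X2 m k).
  move=> x hx.
  have [b1|b1] := pselect (bad X1 k x); first by right; left.
  have [b2|b2] := pselect (bad X2 k x); first by right; right.
  left; have [r0] := ln_ratio m0 hk b1 b2; rewrite -/s ler_norml => /andP[l1 l2].
  apply/(statP _ r0); have := (walkP _ _).1 hx; rewrite mulrBl.
  exact: (delta_bounds l1 l2 lt1 lt2 ht2 kds).2.
have L1m : `|gaussian_lim s2 (t + eta) -
    fine (tuple_measure P m (@walk_le m (t + eta)))| <= e / 4.
  by near: m; exact: L1.
have L2m : `|gaussian_lim s2 (t - eta) -
    fine (tuple_measure P m (@walk_le m (t - eta)))| <= e / 4.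
  by near: m; exact: L2.
have f1 := fine_probabilityU3 (tuple_measure P m) (mst _) (mwk _) mb1 mb2 sub1.
have f2 := fine_probabilityU3 (tuple_measure P m) (mwk _) (mst _) mb1 mb2 sub2.
exact: dist_squeeze L1m L2m V f1 f2 hp hm.
Unshelve. all: by end_near.
Qed.

End delta_method.

(** * Homogeneous functions and the Gamma function *)

Section gamma_function.
Context {R : realType}.
Implicit Types b r u v x : R.
Notation mu := (@lebesgue_measure R).

(** Writing indicators as a function of a difference makes joint measurability a composition and
    lets Tonelli read the same factor as a condition on either variable. *)
Definition heaviside r : R := (0 <= r)%R%:R.

Lemma heaviside_ge0 r : 0 <= heaviside r.
Proof. by rewrite /heaviside; case: (0 <= r). Qed.

Lemma measurable_heaviside : measurable_fun setT heaviside.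
Proof.
rewrite (_ : heaviside = \1_(`[0, +oo[%classic)); first exact: measurable_indic.
apply/funext => r; rewrite /heaviside indicE; congr (nat_of_bool _)%:R.
by rewrite mem_setE in_itv/= andbT.
Qed.

(** This writes e^(-v) as a mixture of the indicators of u >= v; both the Gamma recursion and the
    reduction of exponential densities to balls rest on it. *)
Lemma integral_expRN_tail v :
  (\int[mu]_u (heaviside (u - v) * expR (- u))%:E = (expR (- v))%:E)%E.
Proof.
rewrite (_ : (fun u => (heaviside (u - v) * expR (- u))%:E) =
  (fun u => (expR (- u))%:E) \_ `[v, +oo[); last first.
  apply/funext => u; rewrite patchE /heaviside subr_ge0 mem_setE in_itv/= andbT.
  by case: (v <= u); rewrite /= ?(mul1r, mul0r).
rewrite -integral_mkcond (@ge0_continuous_FTC2y _ _ (fun u => - expR (- u)) _ 0)//.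
- by rewrite -EFinB sub0r opprK.
- apply: continuous_subspaceT => x.
  by apply: continuous_comp; [exact: opp_continuous|exact: continuous_expR].
- by rewrite -oppr0; apply: cvgN; exact: cvgr_expR.
- apply: cvgN; apply: cvg_at_right_filter.
  by apply: continuous_comp; [exact: opp_continuous|exact: continuous_expR].
- move=> x _.
  have [_] : is_derive x 1 (fun u : R => - expR (- u)) (expR (- x)).
    by apply: is_derive_eq; rewrite /GRing.scale/=; ring.
  by rewrite derive1E.
Qed.

Lemma integral_powR x b : 0 <= x -> 0 <= b ->
  (\int[mu]_v (heaviside v * heaviside (x - v) * ((b + 1) * v `^ b))%:E
   = (x `^ (b + 1))%:E)%E.
Proof.
move=> x0 b0.
have b10 : b + 1 != 0 by rewrite gt_eqF// ltr_wpDl.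
rewrite (_ : (fun v => (heaviside v * _ * _)%:E) =
  (fun v => ((b + 1) * v `^ b)%:E) \_ `[0, x]); last first.
  apply/funext => u; rewrite patchE /heaviside subr_ge0 mem_setE in_itv/=.
  by case: (0 <= u); case: (u <= x); rewrite /= ?(mul1r, mul0r).
rewrite -integral_mkcond.
move: x0; rewrite le_eqVlt => /predU1P[<-|x0].
  by rewrite set_itv1 integral_set1 powR0.
have dp (u : R) : 0 < u -> is_derive u 1 (fun v => v `^ (b + 1)) ((b + 1) * u `^ b).
  move=> u0; have := is_derive1_powR (b + 1) u0.
  by rewrite addrK.
have cpow (c u : R) : 0 < u -> {for u, continuous (fun v => v `^ c)}.
  move=> u0; have [+ _] := is_derive1_powR c u0.
  by move=> /derivable1_diffP/differentiable_continuous.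
rewrite (@continuous_FTC2 _ _ (fun v => v `^ (b + 1)))//.
- by rewrite powR0// sube0.
- apply/continuous_within_itvP => //; split.
  + move=> u; rewrite in_itv/= => /andP[u0 _].
    by apply: cvgM; [exact: cvg_cst|exact: cpow].
  + apply: cvgM; first exact: cvg_cst.
    move: b0; rewrite le_eqVlt => /predU1P[<-|b0].
      rewrite powRr0; under eq_fun do rewrite powRr0; exact: cvg_cst.
    by rewrite powR0 ?gt_eqF//; exact: powR_cvg0.
  + apply: cvgM; first exact: cvg_cst.
    by apply: cvg_at_left_filter; exact: cpow.
- split.
  + by move=> u; rewrite in_itv/= => /andP[u0 _]; have [] := dp u u0.
  + by rewrite powR0//; apply: powR_cvg0; rewrite ltr_wpDl.
  + by apply: cvg_at_left_filter; exact: cpow.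
- move=> u; rewrite in_itv/= => /andP[u0 _].
  by have [_] := dp u u0; rewrite derive1E.
Qed.

(** Gamma (b + 1) before its finiteness is known. The shift of the argument keeps the exponent
    nonnegative for b >= 0, so there is no singularity at 0. *)
Definition eGamma b : \bar R :=
  (\int[mu]_u (heaviside u * u `^ b * expR (- u))%:E)%E.

Let measurable_gamma_integrand b :
  measurable_fun setT (fun u => heaviside u * u `^ b * expR (- u)).
Proof.
apply: measurable_funM; first apply: measurable_funM.
- exact: measurable_heaviside.
- exact: measurable_powR.
- by apply: measurableT_comp => //; exact: measurable_expR.
Qed.

Lemma eGammaE b : eGamma b =
  (\int[mu]_(t in `]0%R, +oo[) (t `^ b * expR (- t))%:E)%E.
Proof.
rewrite integral_itv_obnd_cbnd; last first.
  apply/measurable_EFinP/measurable_funTS; apply: measurable_funM.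
    exact: measurable_powR.
  by apply: measurableT_comp => //; exact: measurable_expR.
rewrite integral_mkcond; apply: eq_integral => u _.
rewrite patchE mem_setE in_itv/= andbT /heaviside.
by case: (0 <= u); rewrite /= ?(mul1r, mul0r).
Qed.

Lemma eGamma0 : eGamma 0 = 1%E.
Proof.
have := integral_expRN_tail 0; rewrite oppr0 expR0 => <-.
by apply: eq_integral => u _; rewrite powRr0 mulr1 addr0.
Qed.

(** Tonelli for (b + 1) v^b e^(-u) on the region 0 <= v <= u, in place of an integration by parts:
    integrating in v first gives u^(b+1) e^(-u), in u first (b + 1) v^b e^(-v). *)
Lemma eGammaS b : 0 <= b -> eGamma (b + 1) = ((b + 1)%:E * eGamma b)%E.
Proof.
move=> b0.
pose f (z : R * R) : \bar R := (heaviside z.1 * heaviside z.2 * heaviside (z.1 - z.2)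
   * ((b + 1) * z.2 `^ b) * expR (- z.1))%:E.
have b1 : 0 <= b + 1 by rewrite addr_ge0.
have f0 z : (0 <= f z)%E.
  by rewrite lee_fin !mulr_ge0 ?heaviside_ge0 ?powR_ge0 ?expR_ge0.
have mf : measurable_fun setT f.
  apply/measurable_EFinP.
  have mh g : measurable_fun setT g -> measurable_fun setT (fun z : R * R => heaviside (g z)).
    by move=> mg; apply: measurableT_comp => //; exact: measurable_heaviside.
  repeat apply: measurable_funM => //; try apply: mh => //.
  - exact: measurable_funB.
  - exact: (measurableT_comp (measurable_powR b) measurable_snd).
  - by apply: (measurableT_comp (@measurable_expR R)); exact: measurableT_comp.
have := fubini_tonelli (m1 := mu) (m2 := mu) f mf f0.
under eq_integral => u _.
  have -> : (\int[mu]_y f (u, y))%E =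
      (\int[mu]_y ((heaviside u * expR (- u))%:E *
        (heaviside y * heaviside (u - y) * ((b + 1) * y `^ b))%:E))%E.
    by apply: eq_integral => v _; rewrite /f -EFinM /=; congr EFin; ring.
  rewrite ge0_integralZl_EFin//; last 3 first.
  - by move=> v _; rewrite lee_fin !mulr_ge0 ?heaviside_ge0 ?powR_ge0.
  - apply/measurable_EFinP; apply: measurable_funM; first apply: measurable_funM.
    + exact: measurable_heaviside.
    + by apply: measurableT_comp => //; [exact: measurable_heaviside|exact: measurable_funB].
    + by apply: measurable_funM => //; exact: measurable_powR.
  - by rewrite mulr_ge0 ?heaviside_ge0 ?expR_ge0.
  have -> : ((heaviside u * expR (- u))%:E *
      \int[mu]_y (heaviside y * heaviside (u - y) * ((b + 1) * y `^ b))%:E)%E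
     = (heaviside u * u `^ (b + 1) * expR (- u))%:E.
    rewrite /heaviside; case: (leP 0 u) => u0.
      rewrite [X in (_ * X)%E](integral_powR u0 b0) -EFinM; congr EFin; ring.
    by rewrite !mul0r mul0e.
  over.
rewrite -/(eGamma _) => ->.
rewrite -ge0_integralZl//; last 2 first.
- by apply/measurable_EFinP; exact: measurable_gamma_integrand.
- by move=> u _; rewrite lee_fin !mulr_ge0 ?heaviside_ge0 ?powR_ge0 ?expR_ge0.
apply: eq_integral => v _.
transitivity (\int[mu]_u ((heaviside v * ((b + 1) * v `^ b))%:E *
   (heaviside (u - v) * expR (- u))%:E))%E.
  apply: eq_integral => u _; rewrite /f -EFinM /=; congr EFin.
  have -> : heaviside u * heaviside v * heaviside (u - v) = heaviside v * heaviside (u - v).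
    rewrite /heaviside; case: (leP 0 v) => v0; last by rewrite /= mulr0 !mul0r.
    case: (leP 0 (u - v)) => uv; last by rewrite !mulr0.
    by rewrite (_ : 0 <= u)// /= ?mul1r//; lra.
  ring.
rewrite ge0_integralZl_EFin//; last 3 first.
- by move=> u _; rewrite lee_fin mulr_ge0 ?heaviside_ge0 ?expR_ge0.
- apply/measurable_EFinP; apply: measurable_funM.
    by apply: measurableT_comp => //; [exact: measurable_heaviside|exact: measurable_funB].
  by apply: measurableT_comp => //; exact: measurable_expR.
- by rewrite !mulr_ge0 ?heaviside_ge0 ?powR_ge0.
rewrite integral_expRN_tail -!EFinM; congr EFin; ring.
Qed.

(** The recursion settles integer exponents, and u^b <= 1 + u^n for an integer n >= b settles the
    others. *)
Lemma eGamma_fin b : 0 <= b -> eGamma b \is a fin_num.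
Proof.
move=> b0.
have fn (n : nat) : (eGamma n%:R < +oo)%E.
  elim: n => [|n ih]; first by rewrite eGamma0 ltry.
  by rewrite -natr1 eGammaS ?lte_mul_pinfty ?lee_fin ?addr_ge0.
have g0 c : (0 <= eGamma c)%E.
  by apply: integral_ge0 => u _; rewrite lee_fin !mulr_ge0 ?heaviside_ge0 ?powR_ge0 ?expR_ge0.
rewrite ge0_fin_numE//.
pose n := (Num.truncn b).+1.
have bn : b <= n%:R by rewrite ltW// truncnS_gt.
apply: le_lt_trans (_ : (eGamma 0 + eGamma n%:R < +oo)%E); last first.
  by apply: lte_add_pinfty; [rewrite eGamma0 ltry|exact: fn].
pose g c u : \bar R := (heaviside u * u `^ c * expR (- u))%:E.
have gp c u : [set: R] u -> (0 <= g c u)%E.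
  by move=> _; rewrite lee_fin !mulr_ge0 ?heaviside_ge0 ?powR_ge0 ?expR_ge0.
have mg c : measurable_fun setT (g c).
  by apply/measurable_EFinP; exact: measurable_gamma_integrand.
have D := ge0_integralD mu measurableT (gp 0) (mg 0) (gp n%:R) (mg n%:R).
rewrite /eGamma -D.
apply: ge0_le_integral => //.
- by move=> u _; rewrite lee_fin !mulr_ge0 ?heaviside_ge0 ?powR_ge0 ?expR_ge0.
- by apply/measurable_EFinP; exact: measurable_gamma_integrand.
- by apply/measurable_EFinP; apply: measurable_funD; exact: measurable_gamma_integrand.
move=> u _; rewrite -EFinD lee_fin -mulrDl ler_wpM2r ?expR_ge0//.
rewrite -mulrDr /heaviside; case: (leP 0 u) => u0; last by rewrite !mul0r.
rewrite !mul1r powRr0; have [u1|u1] := leP 1 u.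
  by rewrite ler_wpDl// ler_powR.
rewrite ler_wpDr ?powR_ge0//.
have -> : 1 = 1 `^ b :> R by rewrite powR1.
by apply: ge0_ler_powR; rewrite ?nnegrE// ltW.
Qed.

Lemma eGamma_gt0 b : 0 <= b -> (0 < eGamma b)%E.
Proof.
move=> b0; apply: lt_le_trans (_ : (expR (- 1))%:E <= _)%E.
  by rewrite lte_fin expR_gt0.
rewrite -integral_expRN_tail; apply: ge0_le_integral => //.
- by move=> u _; rewrite lee_fin mulr_ge0 ?heaviside_ge0 ?expR_ge0.
- apply/measurable_EFinP; apply: measurable_funM.
    by apply: measurableT_comp; [exact: measurable_heaviside|exact: measurable_funB].
  by apply: measurableT_comp => //; exact: measurable_expR.
- by apply/measurable_EFinP; exact: measurable_gamma_integrand.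
move=> u _; rewrite lee_fin ler_wpM2r ?expR_ge0// /heaviside subr_ge0.
case: (leP 1 u) => u1; last by rewrite mulr_ge0 ?powR_ge0//; case: (0 <= u).
by rewrite (le_trans ler01 u1) mul1r -(powRr0 u) ler_powR.
Qed.

Lemma Gamma_eGamma b : 0 <= b -> (Gamma (b + 1))%:E = eGamma b.
Proof.
move=> b0; rewrite /Gamma /Rintegral addrK -eGammaE fineK//; exact: eGamma_fin.
Qed.

Lemma Gamma_gt0 b : 0 <= b -> 0 < Gamma (b + 1).
Proof. by move=> b0; rewrite -lte_fin Gamma_eGamma// eGamma_gt0. Qed.

Lemma GammaS b : 0 <= b -> Gamma (b + 1 + 1) = (b + 1) * Gamma (b + 1).
Proof.
move=> b0; apply: EFin_inj.
by rewrite EFinM !Gamma_eGamma ?addr_ge0// eGammaS.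
Qed.

Lemma lebesgue_measure_scale (c : R) (A : set (measurableTypeR R)) : 0 < c -> measurable A ->
  (mu ((fun x => c * x)%R @^-1` A) = c^-1%:E * mu A)%E.
Proof.
move=> c0 mA.
have mf : measurable_fun setT ((fun x => c * x) : measurableTypeR R -> measurableTypeR R).
  by apply: measurable_funM.
pose m0 := measure_function_pushforward__canonical__measure_function_Measure mu mf.
pose m : {measure set (measurableTypeR R) -> \bar R} := mscale (NngNum (ltW c0)) m0.
have : mu A = m A.
  apply: lebesgue_measure_unique => // _ [[a b] _ <-].
  have E : (fun x : R => c * x) @^-1` `]a, b]%classic = `]a / c, b / c]%classic.
    apply/seteqP; split => x /=; rewrite !in_itv/= => /andP[h1 h2]; apply/andP; split.
    - by rewrite ltr_pdivrMr// mulrC.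
    - by rewrite ler_pdivlMr// mulrC.
    - by rewrite mulrC -ltr_pdivrMr.
    - by rewrite mulrC -ler_pdivlMr.
  pose I := `]a / c, b / c]%classic.
  transitivity (c%:E * mu I)%E; last by rewrite /I -E.
  rewrite /I.
  rewrite !lebesgue_measure_itv/= !lte_fin ltr_pM2r ?invr_gt0//.
  case: ifP => _; last by rewrite mule0.
  rewrite -!EFinB -EFinM; congr EFin.
  by field; rewrite gt_eqF.
move=> ->; by rewrite /m /mscale/= muleA -EFinM mulVf ?mul1e// gt_eqF.
Qed.

End gamma_function.

(** * Integration of homogeneous functions over balls *)

Section layer_cake.
Local Open Scope ereal_scope.
Context d (T : measurableType d) (R : realType).
Variables (mu : {sigma_finite_measure set T -> \bar R}) (s : R -> T -> T)
  (D : nat) (rho : T -> R).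
Hypotheses (ms : forall c, (0 < c)%R -> measurable_fun setT (s c))
  (hmu : forall c A, (0 < c)%R -> measurable A ->
     mu (s c @^-1` A) = (c^-1 ^+ D)%:E * mu A)
  (mrho : measurable_fun setT rho) (rho0 : forall x, (0 <= rho x)%R)
  (hrho : forall c x, (0 < c)%R -> rho (s c x) = (c * rho x)%R).
Notation leb := (@lebesgue_measure R).

(** The section knows only dilations [s c] under which [mu] scales with dimension [D] and the gauge
    [rho] is homogeneous of degree one. It serves both the rows, with [volume] and D = n, and the
    whole matrix, with [mixed_volume] and D = n m. *)
Definition ball_integral (F : T -> R) (r : R) : \bar R :=
  \int[mu]_x (heaviside (r - rho x) * F x)%:E.

Let measurable_heav_comp d' (T' : measurableType d') (g : T' -> R) :
  measurable_fun setT g -> measurable_fun setT (fun z => heaviside (g z)).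
Proof. by move=> mg; apply: measurableT_comp => //; exact: measurable_heaviside. Qed.

Lemma heaviside_powR (u v q : R) : (0 <= u)%R -> (0 <= v)%R -> (0 < q)%R ->
  heaviside (u - v `^ q) = heaviside (u `^ q^-1 - v).
Proof.
move=> u0 v0 q0; rewrite /heaviside !subr_ge0; congr (nat_of_bool _)%:R.
apply/idP/idP => h.
- rewrite -[leLHS](_ : (v `^ q) `^ q^-1 = v)%R; last first.
    by rewrite -powRrM mulfV ?gt_eqF// powRr1.
  by apply: ge0_ler_powR; rewrite ?nnegrE ?powR_ge0 ?invr_ge0// ltW.
- rewrite -[leRHS](_ : (u `^ q^-1) `^ q = u)%R; last first.
    by rewrite -powRrM mulVf ?gt_eqF// powRr1.
  by apply: ge0_ler_powR; rewrite ?nnegrE ?powR_ge0// ltW.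
Qed.

Section homogeneous.
Variables (F : T -> R) (a : R).
Hypotheses (mF : measurable_fun setT F) (F0 : forall x, (0 <= F x)%R)
  (hF : forall c x, (0 < c)%R -> F (s c x) = (c `^ a * F x)%R).

Let bi_ge0 r : 0 <= ball_integral F r.
Proof.
by apply: integral_ge0 => x _; rewrite lee_fin mulr_ge0// heaviside_ge0.
Qed.

Let mbi r : measurable_fun setT (fun x => heaviside (r - rho x) * F x)%R.
Proof.
apply: measurable_funM => //; apply: measurable_heav_comp.
exact: measurable_funB.
Qed.

(** The integral of G (s r x) is computed twice, once from the scaling of the measure and once from
    the homogeneity of [F] and [rho]. *)
Lemma ball_integral_scale r : (0 < r)%R ->
  ball_integral F r = (r `^ (D%:R + a))%:E * ball_integral F 1.
Proof.
move=> r0.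
pose G x := (heaviside (r - rho x) * F x)%:E.
have mG : measurable_fun setT G by exact/measurable_EFinP.
have G0 x : 0 <= G x by rewrite lee_fin mulr_ge0// heaviside_ge0.
have rD0 : (0 <= r^-1 ^+ D)%R by rewrite exprn_ge0// invr_ge0 ltW.
have E1 : \int[mu]_x G (s r x) = (r^-1 ^+ D)%:E * ball_integral F r.
  transitivity (\int[pushforward mu (s r)]_y G y).
    by rewrite (ge0_integral_pushforward (ms r0))// => y _; exact: G0.
  transitivity (\int[mscale (NngNum rD0) mu]_y G y).
    apply: eq_measure_integral => [|mf A mA _]; [exact: ms|exact: hmu].
  by rewrite ge0_integral_mscale.
have E2 : \int[mu]_x G (s r x) = (r `^ a)%:E * ball_integral F 1.
  rewrite -ge0_integralZl//; last 3 first.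
  - exact/measurable_EFinP.
  - by move=> x _; rewrite lee_fin mulr_ge0// heaviside_ge0.
  - by rewrite lee_fin powR_ge0.
  apply: eq_integral => x _; rewrite /G hF// hrho// -EFinM; congr EFin.
  rewrite (_ : heaviside (r - r * rho x) = heaviside (1 - rho x)); first ring.
  by rewrite /heaviside -{1}(mulr1 r) -mulrBr pmulr_rge0.
have rn : r != 0%R by rewrite gt_eqF.
have -> : ball_integral F r = (r ^+ D)%:E * ((r^-1 ^+ D)%:E * ball_integral F r).
  by rewrite muleA -EFinM exprVn mulfV ?mul1e// expf_neq0.
rewrite -E1 E2 muleA -EFinM; congr (_%:E * _).
by rewrite powRD ?rn ?implybT// powR_mulrn// ltW.
Qed.

(** After exchanging the integrals, the inner one at level u runs over the ball of radius u^(1/q),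
    and homogeneity reduces it to the unit ball at the price of u^((D + a)/q). The kernel [k] is
    e^(-u) for exponential densities and the indicator of u <= 1 for radial moments on the ball. *)
Lemma layer_cake (k : R -> R) (q : R) :
  measurable_fun setT k -> (forall u, (0 <= k u)%R) -> (0 < q)%R ->
  \int[mu]_x ((F x)%:E * \int[leb]_u (heaviside (u - rho x `^ q) * k u)%:E) =
  \int[leb]_u (heaviside u * u `^ ((D%:R + a) / q) * k u)%:E * ball_integral F 1.
Proof.
move=> mk k0 q0.
pose f (z : T * R) : \bar R := (F z.1 * (heaviside (z.2 - rho z.1 `^ q) * k z.2))%:E.
have mrq : measurable_fun setT (fun x => rho x `^ q)%R.
  by apply: (measurableT_comp (measurable_powR q)).
have mf : measurable_fun setT f.
  apply/measurable_EFinP; apply: measurable_funM; first exact: measurableT_comp.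
  apply: measurable_funM; last exact: measurableT_comp.
  apply: measurable_heav_comp; apply: measurable_funB => //.
  exact: measurableT_comp mrq measurable_fst.
have f0 z : 0 <= f z by rewrite lee_fin !mulr_ge0// heaviside_ge0.
transitivity (\int[mu]_x \int[leb]_u f (x, u)).
  apply: eq_integral => x _; rewrite -ge0_integralZl//.
  - apply/measurable_EFinP; apply: measurable_funM => //.
    by apply: measurable_heav_comp; exact: measurable_funB.
  - by move=> u _; rewrite lee_fin mulr_ge0// heaviside_ge0.
  - by rewrite lee_fin.
rewrite (fubini_tonelli (m1 := mu) (m2 := leb) f)//.
have mw : measurable_fun setT (fun u : R => heaviside u * u `^ ((D%:R + a) / q) * k u)%R.
  apply: measurable_funM => //; apply: measurable_funM; last exact: measurable_powR.
  exact: measurable_heaviside.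
have w0 u : (0 <= heaviside u * u `^ ((D%:R + a) / q) * k u)%R.
  by rewrite !mulr_ge0 ?heaviside_ge0 ?powR_ge0.
rewrite -ge0_integralZr//; last 2 first.
- exact/measurable_EFinP.
- by move=> u _; rewrite lee_fin.
apply: ge0_ae_eq_integral => //.
- exact: (measurable_fun_fubini_tonelli_G (m1 := mu) f).
- by apply: emeasurable_funM => //; exact/measurable_EFinP.
- by move=> u _; exact: integral_ge0.
- by move=> u _; rewrite mule_ge0// lee_fin.
exists [set 0%R]; split => //; first exact: lebesgue_measure_set1.
move=> u /= /not_implyP[_ ne]; apply: contra_notP ne => /eqP un.
have [u0|u0] := ltP u 0%R.
  rewrite /heaviside leNgt u0/= !mul0r mul0e; apply: integral0_eq => x _.
  rewrite /f/= /heaviside subr_ge0 leNgt.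
  by rewrite (lt_le_trans u0 (powR_ge0 _ _))/= mul0r mulr0.
have up : (0 < u)%R by rewrite lt_neqAle eq_sym un.
transitivity ((k u)%:E * ball_integral F (u `^ q^-1)%R).
  rewrite -ge0_integralZl//; last 3 first.
  - exact/measurable_EFinP.
  - by move=> x _; rewrite lee_fin mulr_ge0// heaviside_ge0.
  - by rewrite lee_fin.
  apply: eq_integral => x _; rewrite /f/= heaviside_powR// -EFinM; congr EFin; ring.
rewrite ball_integral_scale ?powR_gt0// muleA -EFinM; congr (_%:E * _).
by rewrite /heaviside u0 mul1r mulrC -powRrM (mulrC q^-1%R).
Qed.

Lemma integral_homogeneous_expRN (p : R) : (0 < p)%R ->
  \int[mu]_x (F x * expR (- (rho x `^ p)))%:E =
  eGamma ((D%:R + a) / p) * ball_integral F 1.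
Proof.
move=> p0.
have := @layer_cake (fun u => expR (- u)) p _ _ p0 => <-; last 2 first.
- by apply: (measurableT_comp (@measurable_expR R)).
- by move=> u; exact: expR_ge0.
by apply: eq_integral => x _; rewrite integral_expRN_tail EFinM.
Qed.

End homogeneous.

(** The radius has density proportional to r^(D-1), independently of the direction. Concretely, the
    layer cake formula with the indicator of u <= 1 gives a / (D + a) for the integral of (1 -
    rho^a) F relative to that of F; subtracting, which is where finiteness enters, leaves D / (D +
    a). *)
Lemma ball_integral_radial (F : T -> R) (a : R) :
  measurable_fun setT F -> (forall x, (0 <= F x)%R) -> (0 < a)%R ->
  (forall c x, (0 < c)%R -> F (s c x) = F x) -> ball_integral F 1 < +oo ->
  ball_integral (fun x => rho x `^ a * F x)%R 1 =
  (D%:R / (D%:R + a))%:E * ball_integral F 1.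
Proof.
move=> mF F0 a0 hF fin.
have hF0 c x : (0 < c)%R -> F (s c x) = (c `^ 0 * F x)%R.
  by move=> c0; rewrite powRr0 mul1r hF.
have mh1 : measurable_fun setT (fun u : R => heaviside (1 - u)).
  by apply: measurable_heav_comp; exact: measurable_funB.
have := @layer_cake F 0 mF F0 hF0 (fun u => heaviside (1 - u)) a mh1
  (fun=> heaviside_ge0 _) a0.
rewrite addr0.
have Da : (0 <= D%:R / a)%R by rewrite divr_ge0// ltW.
have -> : \int[leb]_u (heaviside u * u `^ (D%:R / a) * heaviside (1 - u))%:E
    = (a / (D%:R + a))%:E.
  have := integral_powR ler01 Da; rewrite powR1 => h.
  have Da1 : (D%:R / a + 1 != 0)%R by rewrite gt_eqF// ltr_wpDl.
  have -> : (a / (D%:R + a))%:E = ((D%:R / a + 1)^-1)%:E * 1 :> \bar R.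
    rewrite mule1; congr EFin; field; rewrite gt_eqF//= gt_eqF//.
    by rewrite ltr_wpDl.
  rewrite -h -ge0_integralZl//; last 3 first.
  - apply/measurable_EFinP; apply: measurable_funM.
      by apply: measurable_funM => //; exact: measurable_heaviside.
    by apply: measurable_funM => //; exact: measurable_powR.
  - move=> u _; rewrite lee_fin !mulr_ge0 ?heaviside_ge0 ?powR_ge0//.
    by rewrite addr_ge0.
  - by rewrite lee_fin invr_ge0 addr_ge0.
  apply: eq_integral => u _; rewrite -EFinM; congr EFin.
  by move: (D%:R / a + 1)%R Da1 => c c0; field.
have tailE v : (0 <= v)%R -> \int[leb]_u (heaviside (u - v) * heaviside (1 - u))%:E
    = (heaviside (1 - v) * (1 - v))%:E.
  move=> v0.
  rewrite (_ : (fun u => (heaviside (u - v) * _)%:E) = (fun=> 1) \_ `[v, 1%R]); last first.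
    apply/funext => u; rewrite patchE /heaviside !subr_ge0 mem_setE in_itv/=.
    by case: (v <= u)%R; case: (u <= 1)%R; rewrite /= ?(mulr1, mul0r, mulr0).
  rewrite -integral_mkcond integral_cst//= mul1e lebesgue_measure_itv/= lte_fin.
  rewrite /heaviside subr_ge0.
  by case: (ltgtP v 1%R) => [v1|v1|->]; rewrite /= ?mul1r ?mul0r ?subrr.
under eq_integral => x _.
  rewrite tailE ?powR_ge0// (heaviside_powR ler01 (rho0 x) a0) powR1.
  over.
have mrq : measurable_fun setT (fun x => rho x `^ a)%R.
  by apply: (measurableT_comp (measurable_powR a)).
have mhr : measurable_fun setT (fun x => heaviside (1 - rho x)).
  by apply: measurable_heav_comp; exact: measurable_funB.
set A := \int[mu]_x _ => hA.
set B := ball_integral _ 1.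
have AB : ball_integral F 1 = A + B.
  rewrite /A /B /ball_integral -ge0_integralD//.
  - apply: eq_integral => x _; rewrite -EFinM -EFinD; congr EFin; ring.
  - move=> x _; rewrite mule_ge0 ?lee_fin//.
    rewrite /heaviside subr_ge0; case: (leP (rho x) 1%R) => h; last by rewrite mul0r.
    rewrite mul1r subr_ge0; have -> : 1%R = (1 `^ a)%R :> R by rewrite powR1.
    by apply: ge0_ler_powR; rewrite ?nnegrE// ltW.
  - by apply: emeasurable_funM; apply/measurable_EFinP => //;
      apply: measurable_funM => //; exact: measurable_funB.
  - by move=> x _; rewrite lee_fin !mulr_ge0 ?heaviside_ge0 ?powR_ge0.
  - by apply/measurable_EFinP; apply: measurable_funM => //; exact: measurable_funM.
have J0 : 0 <= ball_integral F 1.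
  by apply: integral_ge0 => x _; rewrite lee_fin mulr_ge0 ?heaviside_ge0.
have Jfin : ball_integral F 1 \is a fin_num by rewrite ge0_fin_numE.
have Da0 : (D%:R + a != 0)%R by rewrite gt_eqF// ltr_wpDl.
have -> : B = ball_integral F 1 - A.
  by rewrite AB addeC addeK// hA fin_numM.
rewrite hA -{1}(fineK Jfin) -[in X in _ - X](fineK Jfin) -[in RHS](fineK Jfin).
by rewrite -!EFinM -EFinB; congr EFin; field.
Qed.

End layer_cake.

(** * Volumes, norms and the cone measure *)

Section density_probability.
Local Open Scope ereal_scope.
Context d (T : measurableType d) (R : realType).
Variables (mu : {sigma_finite_measure set T -> \bar R}) (w : T -> R).

Lemma density_probability : measurable_fun setT w -> (forall x, (0 <= w x)%R) ->
  \int[mu]_x (w x)%:E = 1 ->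
  exists P : probability T R, forall A, measurable A ->
    P A = \int[mu]_x (\1_A x * w x)%:E.
Proof.
move=> mw w0 w1.
pose m0 (A : set T) := \int[mu]_(x in A) (w x)%:E.
have m0E A : measurable A -> m0 A = \int[mu]_x (\1_A x * w x)%:E.
  move=> mA; rewrite /m0 integral_mkcond; apply: eq_integral => x _.
  by rewrite patchE indicE; case: (x \in A); rewrite /= ?(mul1r, mul0r).
have z : m0 set0 = 0 by rewrite /m0 integral_set0.
have p A : 0 <= m0 A by apply: integral_ge0 => x _; rewrite lee_fin.
have sa : semi_sigma_additive m0.
  move=> F mF tF mUF; rewrite /m0; apply: cvg_toP.
    apply: ereal_nondecreasing_is_cvgn => m n mn.
    apply: lee_sum_nneg_natr => // k _ _; apply: integral_ge0 => /= x Fkx.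
    by rewrite lee_fin.
  rewrite ge0_integral_bigcup//=.
  - by apply/measurable_EFinP/measurable_funTS.
  - by move=> x _; rewrite lee_fin.
pose H := isMeasure.Build _ _ _ m0 z p sa.
pose m : {measure set T -> \bar R} := HB.pack m0 H.
have m1 : m setT = 1 by rewrite /= m0E//; under eq_integral do rewrite indicT mul1r.
pose H' := Measure_isProbability.Build _ _ _ m m1.
pose P : probability T R := HB.pack (m : set T -> \bar R) (Measure.on m) H'.
by exists P => A mA; rewrite /= -m0E.
Qed.

End density_probability.

Lemma tuple_measure_cube d (T : measurableType d) (R : realType)
    (mu : {sigma_finite_measure set T -> \bar R}) n (A : set T) (a : R) :
  measurable A -> (0 <= a)%R -> mu A = a%:E ->
  measurable [set x : n.-tuple T | forall i, A (tnth x i)] /\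
  tuple_measure mu n [set x : n.-tuple T | forall i, A (tnth x i)] = (a ^+ n)%:E.
Proof.
move=> mA a0 muA; split.
  rewrite (_ : mkset _ = \bigcap_(i in [set: 'I_n]) ((@tnth n T) ^~ i @^-1` A)).
    apply: fin_bigcap_measurable => //.
    by move=> i _; rewrite -[X in measurable X]setTI; exact: measurable_tnth.
  by apply/seteqP; split => [x h i _|x h i]; exact: h.
elim: n => [|n ih].
  by rewrite expr0 /= diracE mem_set// => -[].
rewrite tuple_measureS.
transitivity (\int[mu]_x ((\1_A x)%:E * (a ^+ n)%:E))%E.
  apply: eq_integral => x _; rewrite indicE; have [xA|xA] := boolP (x \in A).
    rewrite mul1e -ih; congr (tuple_measure mu n _); apply/seteqP; split => t /= h i.
      by have := h (lift ord0 i); rewrite tnthS.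
    have [j ->|->] := unliftP ord0 i; first by rewrite tnthS; exact: h.
    by move: xA; rewrite inE.
  rewrite mul0e (_ : mkset _ = set0) ?measure0//.
  apply/seteqP; split => // t /= h; move: xA; rewrite notin_setE.
  by have := h ord0.
rewrite ge0_integralZr//; last 2 first.
- exact/measurable_EFinP/measurable_indic.
- by rewrite lee_fin exprn_ge0.
rewrite exprS EFinM; congr (_ * _)%E.
by rewrite integral_indic// setIT; exact: muA.
Qed.

(* volume is a product over measurableTypeR R, whose measurable sets are
   convertible to those of R, but whose display differs. *)
Section volume_measure.
Context {R : realType}.
Variable n : nat.

Let vol : {sigma_finite_measure set (n.-tuple (measurableTypeR R)) -> \bar R} :=
  tuple_measure lebesgue_measure n.

Let vol0 : volume n set0 = 0%E :> \bar R.
Proof. exact: (measure0 vol). Qed.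

Let vol_ge0 (A : set (n.-tuple R)) : (0 <= volume n A)%E.
Proof. exact: (measure_ge0 vol). Qed.

Let vol_sigma : semi_sigma_additive (@volume R n : set (n.-tuple R) -> \bar R).
Proof. exact: (@measure_semi_sigma_additive _ _ _ vol). Qed.

HB.instance Definition _ := isMeasure.Build _ (n.-tuple R) _ (@volume R n)
  vol0 vol_ge0 vol_sigma.

Let vol_sigma_finite : sigma_finite setT (@volume R n : set (n.-tuple R) -> \bar R).
Proof. exact: (sigma_finiteT vol). Qed.

HB.instance Definition _ := Measure_isSigmaFinite.Build _ (n.-tuple R) _
  (@volume R n) vol_sigma_finite.

End volume_measure.

HB.instance Definition _ (R : realType) m n :=
  SigmaFiniteMeasure.copy (@mixed_volume R m n) (tuple_measure (@volume R n) m).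

Section lpnorm_theory.
Context {R : realType}.
Implicit Types (p q : \bar R) (c : R).

Definition tscale n c (x : n.-tuple R) : n.-tuple R := map_tuple ( *%R c) x.

Lemma lpnorm_ge0 n p (x : n.-tuple R) : 0 <= lpnorm p x.
Proof.
case: p => [r||] //=; first exact: powR_ge0.
by elim/big_ind : _ => // a b a0 b0; rewrite le_max a0.
Qed.

Lemma lpnorm_tscale n p c (x : n.-tuple R) : (0 < p)%E -> 0 <= c ->
  lpnorm p (tscale c x) = c * lpnorm p x.
Proof.
case: p => [r||] //= p0 c0.
- under eq_bigr do rewrite tnth_map normrM (ger0_norm c0) powRM//.
  have S0 : 0 <= \sum_(i < n) `|tnth x i| `^ r.
    by apply: sumr_ge0 => i _; exact: powR_ge0.
  rewrite -mulr_sumr powRM ?powR_ge0//.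
  by rewrite -powRrM mulfV ?powRr1// gt_eqF.
- under eq_bigr do rewrite tnth_map normrM (ger0_norm c0).
  apply: esym; apply: (big_morph (fun x => c * x)); last by rewrite mulr0.
  by move=> a b; rewrite maxr_pMr.
Qed.

Lemma normr_le_lpnorm n p (x : n.-tuple R) i : (0 < p)%E ->
  `|tnth x i| <= lpnorm p x.
Proof.
case: p => [r||] //= p0.
- rewrite lte_fin in p0.
  have -> : `|tnth x i| = (`|tnth x i| `^ r) `^ r^-1.
    by rewrite -powRrM mulfV ?gt_eqF// powRr1.
  apply: ge0_ler_powR; rewrite ?nnegrE ?powR_ge0 ?invr_ge0 ?(ltW p0)//.
    by apply: sumr_ge0 => j _; exact: powR_ge0.
  rewrite (bigD1 i)//= lerDl; apply: sumr_ge0 => j _; exact: powR_ge0.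
- exact: (le_bigmax_cond _ (fun i => `|tnth x i|)).
Qed.

Lemma lpnorm_le n p : (0 < p)%E -> {C : R | 0 < C &
  forall (x : n.-tuple R) r, (forall i, `|tnth x i| <= r) -> 0 <= r -> lpnorm p x <= C * r}.
Proof.
case: p => [q||] //= p0.
(* The use of n + 1 keeps the constant positive when n = 0. *)
- rewrite lte_fin in p0; exists (n.+1%:R `^ q^-1); first by rewrite powR_gt0.
  move=> x r hr r0.
  have -> : n.+1%:R `^ q^-1 * r = (n.+1%:R * r `^ q) `^ q^-1.
    by rewrite powRM ?powR_ge0// -(powRrM r) mulfV ?gt_eqF// powRr1.
  apply: ge0_ler_powR; rewrite ?nnegrE ?mulr_ge0 ?powR_ge0 ?invr_ge0 ?(ltW p0)//.
    by apply: sumr_ge0 => j _; exact: powR_ge0.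
  apply: (@le_trans _ _ (\sum_(i < n) r `^ q)).
    apply: ler_sum => i _; apply: ge0_ler_powR; rewrite ?nnegrE ?(ltW p0)//.
  rewrite sumr_const card_ord -[leLHS]mulr_natl ler_wpM2r ?powR_ge0//.
  by rewrite ler_nat.
- exists 1 => // x r hr r0; rewrite mul1r.
  by apply/bigmax_leP; split=> // i _; exact: hr.
Qed.

Lemma lpnorm0 n p : (0 < p)%E -> lpnorm p [tuple (0 : R) | i < n] = 0.
Proof.
move=> p0; apply/eqP; rewrite eq_le lpnorm_ge0 andbT.
have [C C0 h] := lpnorm_le n p0.
have := h [tuple (0 : R) | i < n] 0; rewrite mulr0; apply=> // i.
by rewrite tnth_mktuple normr0.
Qed.

Lemma lpnorm_eq0 n p (x : n.-tuple R) : (0 < p)%E ->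
  lpnorm p x = 0 <-> forall i, tnth x i = 0.
Proof.
move=> p0; split=> [h i|h].
  by apply/eqP; rewrite -normr_le0 -h; exact: normr_le_lpnorm.
rewrite -(lpnorm0 n p0); congr lpnorm; apply: eq_from_tnth => i.
by rewrite h tnth_mktuple.
Qed.

Lemma measurable_tscale n c : measurable_fun setT (@tscale n c).
Proof.
apply/measurable_fun_tnthP => i.
rewrite (_ : _ \o _ = fun x => c * tnth x i); last first.
  by apply/funext => x /=; rewrite tnth_map.
by apply: measurable_funM => //; exact: measurable_tnth.
Qed.

Lemma volume_scale n c (A : set (n.-tuple R)) : 0 < c -> measurable A ->
  (volume n (tscale c @^-1` A) = (c^-1 ^+ n)%:E * volume n A)%E.
Proof.
move=> c0 mA; apply: tuple_measure_scale => //.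
- by rewrite invr_ge0 ltW.
- by move=> B mB; exact: lebesgue_measure_scale.
Qed.

Definition mtscale m n c (x : m.-tuple (n.-tuple R)) : m.-tuple (n.-tuple R) :=
  map_tuple (tscale c) x.

Lemma measurable_mtscale m n c : measurable_fun setT (@mtscale m n c).
Proof.
apply/measurable_fun_tnthP => i.
rewrite (_ : _ \o _ = fun x => tscale c (tnth x i)); last first.
  by apply/funext => x /=; rewrite tnth_map.
by apply: (measurableT_comp (@measurable_tscale n c)); exact: measurable_tnth.
Qed.

Lemma mixed_volume_scale m n c (A : set (m.-tuple (n.-tuple R))) : 0 < c -> measurable A ->
  (mixed_volume m n (mtscale c @^-1` A) = (c^-1 ^+ (n * m))%:E * mixed_volume m n A)%E.
Proof.
move=> c0 mA.
have k0 : 0 <= c^-1 ^+ n by rewrite exprn_ge0// invr_ge0 ltW.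
have hB (B : set (n.-tuple R)) : measurable B ->
    (volume n (tscale c @^-1` B) = (c^-1 ^+ n)%:E * volume n B)%E.
  exact: volume_scale.
have := tuple_measure_scale (@measurable_tscale n c) k0 hB mA.
by rewrite -exprM.
Qed.

Lemma mixed_norm_ge0 m n p q (x : m.-tuple (n.-tuple R)) : 0 <= mixed_norm p q x.
Proof. exact: lpnorm_ge0. Qed.

Lemma mixed_norm_mtscale m n p q c (x : m.-tuple (n.-tuple R)) :
  (0 < p)%E -> (0 < q)%E -> 0 <= c ->
  mixed_norm p q (mtscale c x) = c * mixed_norm p q x.
Proof.
move=> p0 q0 c0; rewrite /mixed_norm -lpnorm_tscale//; congr lpnorm.
apply: eq_from_tnth => i.
by rewrite tnth_mktuple [RHS]tnth_map tnth_mktuple tnth_map lpnorm_tscale.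
Qed.

End lpnorm_theory.

(** * Unit balls, radial projection and the cone measure *)

Section lp_ball.
Context {R : realType} (n : nat) (q : \bar R).
Hypotheses (hn : (0 < n)%N) (hq : (0 < q)%E).
Notation rho := (@lpnorm R n q).
Notation vol := (@volume R n).
Notation BI := (ball_integral vol rho).
Implicit Types (x y : n.-tuple R) (F psi f : n.-tuple R -> R).

Let mrho : measurable_fun setT rho := @measurable_lpnorm R n q.

Let ms c : 0 < c -> measurable_fun setT (@tscale R n c).
Proof. by move=> _; exact: measurable_tscale. Qed.

Let hmu c (A : set (n.-tuple R)) : 0 < c -> measurable A ->
  vol (tscale c @^-1` A) = ((c^-1 ^+ n)%:E * vol A)%E.
Proof. by move=> c0 mA; exact: volume_scale. Qed.

Let hrho c x : 0 < c -> rho (tscale c x) = c * rho x.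
Proof. by move=> c0; rewrite lpnorm_tscale// ltW. Qed.

Let mheav : measurable_fun setT (fun x => heaviside (1 - rho x)).
Proof.
apply: measurableT_comp; first exact: measurable_heaviside.
exact: measurable_funB.
Qed.

Lemma heaviside_indic r x : heaviside (r - rho x) = \1_[set x | rho x <= r] x.
Proof. by rewrite /heaviside subr_ge0 indicE mem_setE. Qed.

Lemma measurable_lpnorm_le r : measurable [set x | rho x <= r].
Proof.
rewrite -[X in measurable X]setTI.
have := mrho measurableT (measurable_itv `]-oo, r]).
by rewrite /preimage/=; under eq_set do rewrite in_itv/=.
Qed.

Lemma ball_integral1 r : BI (cst 1) r = vol [set x | rho x <= r].
Proof.
rewrite /ball_integral; under eq_integral do rewrite mulr1 heaviside_indic.
by rewrite integral_indic ?setIT//; exact: measurable_lpnorm_le.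
Qed.

Let cube_measure (a : R) : 0 < a ->
  measurable [set x : n.-tuple R | forall i, tnth x i \in `[- a, a]%R] /\
  vol [set x : n.-tuple R | forall i, tnth x i \in `[- a, a]%R] = ((2 * a) ^+ n)%:E.
Proof.
move=> a0.
have muI : lebesgue_measure (`[- a, a]%classic : set (measurableTypeR R)) = (2 * a)%:E.
  rewrite lebesgue_measure_itv/= lte_fin ifT; last by lra.
  by rewrite -EFinB; congr EFin; lra.
have a20 : 0 <= 2 * a by rewrite mulr_ge0// ltW.
have mI : measurable (`[- a, a]%classic : set (measurableTypeR R)) by exact: measurable_itv.
have [m1 m2] := @tuple_measure_cube _ (measurableTypeR R) R lebesgue_measure n _ _ mI a20 muI.
by split; [exact: m1|exact: m2].
Qed.

(** The unit ball is contained in the cube [-1, 1]^n. Conversely some ball of radius C contains that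
    cube, and its volume is a multiple of that of the unit ball. *)
Lemma lpball_volume_bounds : (0 < vol (lpball q) < +oo)%E.
Proof.
have mB := measurable_lpnorm_le 1.
apply/andP; split.
- have [C C0 hC] := @lpnorm_le R n q hq.
  have [mQ vQ] := cube_measure ltr01.
  have mC := measurable_lpnorm_le C.
  have sub : [set x : n.-tuple R | forall i, tnth x i \in `[- 1, 1]%R] `<=` [set x | rho x <= C].
    move=> x /= h; rewrite -(mulr1 C); apply: hC => // i.
    by rewrite ler_norml; have := h i; rewrite in_itv.
  have : (0 < vol [set x | (rho x <= C)%R])%E.
    apply: lt_le_trans (_ : vol [set x : n.-tuple R | forall i, tnth x i \in `[- 1, 1]%R] <= _)%E.
      by rewrite vQ lte_fin exprn_gt0// mulr1.
    by apply: le_measure; rewrite ?inE.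
  rewrite -ball_integral1 (@ball_integral_scale _ _ _ vol (@tscale R n) n rho ms hmu mrho hrho
    (cst 1) 0 _ _ _ C)//; last by move=> c x c0; rewrite powRr0 mulr1.
  rewrite ball_integral1 /lpball; set V := vol _ => h.
  have : (0 <= V)%E by exact: measure_ge0.
  by rewrite le_eqVlt => /predU1P[E|//]; move: h; rewrite -E mule0 ltxx.
- have [mQ vQ] := cube_measure ltr01.
  apply: le_lt_trans (_ : vol
    [set x : n.-tuple R | forall i, tnth x i \in `[- 1, 1]%R] < +oo)%E; last first.
    by rewrite vQ ltry.
  apply: le_measure; rewrite ?inE// => x /= h i; rewrite in_itv/= -ler_norml.
  exact: le_trans (normr_le_lpnorm _ _ hq) h.
Qed.

Let v := fine (vol (lpball q)).

Lemma lpball_volumeE : vol (lpball q) = v%:E /\ 0 < v.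
Proof.
have /andP[h1 h2] := lpball_volume_bounds; split.
  by rewrite fineK// ge0_fin_numE// ltW.
by apply: fine_gt0; rewrite h1.
Qed.

Lemma lpnorm_null : vol [set x | rho x <= 0] = 0%E.
Proof.
rewrite (_ : mkset _ = [set x : n.-tuple R | forall i, [set 0] (tnth x i)]); last first.
  apply/seteqP; split => x /= h.
    by apply/(lpnorm_eq0 x hq)/eqP; rewrite eq_le h lpnorm_ge0.
  by rewrite (lpnorm_eq0 x hq).2.
have [_ E] := @tuple_measure_cube _ (measurableTypeR R) _ lebesgue_measure n [set 0] 0
  (measurable_set1 _) (lexx 0) (lebesgue_measure_set1 _).
transitivity (((0 : R) ^+ n)%:E); first exact: E.
by rewrite expr0n gtn_eqF.
Qed.

(** Radial projection to the sphere; since the inverse of 0 is 0, the origin is sent to itself. *)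
Definition lpproj y : n.-tuple R := tscale (rho y)^-1 y.

Lemma measurable_lpproj : measurable_fun setT lpproj.
Proof.
apply/measurable_fun_tnthP => i.
rewrite (_ : _ \o _ = fun x => rho x `^ (-1) * tnth x i); last first.
  by apply/funext => x /=; rewrite tnth_map powR_inv1 ?lpnorm_ge0.
apply: measurable_funM; last exact: measurable_tnth.
exact: (measurableT_comp (measurable_powR _)).
Qed.

Lemma lpproj_tscale c y : 0 < c -> lpproj (tscale c y) = lpproj y.
Proof.
move=> c0; apply: eq_from_tnth => i; rewrite !tnth_map hrho// invfM mulrACA.
by rewrite mulVf ?mul1r// gt_eqF.
Qed.

(** The points s a with s > 0 are the nonzero points of the ball that project into A, so the two
    sets differ at most by the origin, which is null. If A misses the sphere, the cone is empty,
    without even the apex, and the other set lies in the origin. *)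
Lemma volume_cone (A : set (n.-tuple R)) : measurable A ->
  vol (cone (A `&` lpsphere q)) = vol (lpproj @^-1` A `&` lpball q).
Proof.
move=> mA.
have mB := measurable_lpnorm_le 1.
have mZ := measurable_lpnorm_le 0.
have mM : measurable (lpproj @^-1` A `&` lpball q).
  by apply: measurableI => //; rewrite -[X in measurable X]setTI; exact: measurable_lpproj.
have [[a [Aa Sa]]|H] := pselect (exists a, A a /\ rho a = 1).
- rewrite (_ : cone _ = (lpproj @^-1` A `&` lpball q) `|` [set x | rho x <= 0]).
    by rewrite measureU0//; exact: lpnorm_null.
  apply/seteqP; split => y.
  + move=> [s]; rewrite /= in_itv/= => /andP[s0 s1] [b [Ab Sb]] <-.
    have -> : [tuple s * tnth b i | i < n] = tscale s b.
      by apply: eq_from_tnth => i; rewrite tnth_mktuple tnth_map.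
    move: s0; rewrite le_eqVlt => /predU1P[<-|s0].
      by right; rewrite /= lpnorm_tscale// mul0r.
    left; split; last by rewrite /lpball/= hrho// Sb mulr1.
    rewrite /= lpproj_tscale// /lpproj Sb invr1 (_ : tscale 1 b = b)//.
    by apply: eq_from_tnth => i; rewrite tnth_map mul1r.
  + have [y0|y0] := pselect (rho y <= 0).
      have y00 : rho y = 0 by apply/eqP; rewrite eq_le y0 lpnorm_ge0.
      move=> _; exists 0; first by rewrite /= in_itv/= lexx ler01.
      exists a => //; apply: eq_from_tnth => i; rewrite tnth_mktuple mul0r.
      by rewrite (lpnorm_eq0 y hq).1.
    move=> [[Ay By]|//]; have yp : 0 < rho y by rewrite ltNge; apply/negP.
    exists (rho y); first by rewrite /= in_itv/= lpnorm_ge0.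
    exists (lpproj y).
      by split => //; rewrite /lpsphere/= /lpproj hrho ?invr_gt0// mulVf// gt_eqF.
    apply: eq_from_tnth => i; rewrite tnth_mktuple tnth_map mulrA mulfV ?mul1r//.
    by rewrite gt_eqF.
- rewrite (_ : cone _ = set0); last first.
    by apply/seteqP; split => // y [s _ [b [Ab Sb]] _]; apply: H; exists b.
  rewrite measure0; apply/esym/(subset_measure0 mM mZ); last exact: lpnorm_null.
  move=> y [Ay By]; rewrite /= leNgt; apply/negP => yp; apply: H; exists (lpproj y); split => //.
  by rewrite /lpproj hrho ?invr_gt0// mulVf// gt_eqF.
Qed.

(** The cone measure is the image of the uniform law [U] of the ball under radial projection, by the
    volume of cones. Thus expectations of Theta become integrals over the ball. *)
Lemma cone_distributed_integral d (S : measurableType d) (Q : probability S R)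
    (Theta : {RV Q >-> n.-tuple R}) f : cone_distributed q Theta ->
  measurable_fun setT f -> (forall y, 0 <= f y) ->
  BI (f \o lpproj) 1 = (v%:E * \int[Q]_w (f (Theta w))%:E)%E.
Proof.
move=> hT mf f0.
have [vE v0] := lpball_volumeE.
pose w y := heaviside (1 - rho y) / v.
have mw : measurable_fun setT w by exact: measurable_funM.
have w0 y : 0 <= w y by rewrite mulr_ge0 ?heaviside_ge0// invr_ge0 ltW.
have w1 : (\int[vol]_y (w y)%:E = 1)%E.
  under eq_integral do rewrite /w mulrC EFinM.
  rewrite ge0_integralZl//; last 3 first.
  - exact/measurable_EFinP.
  - by move=> y _; rewrite lee_fin heaviside_ge0.
  - by rewrite lee_fin invr_ge0 ltW.
  under eq_integral do rewrite heaviside_indic.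
  rewrite integral_indic//; last exact: measurable_lpnorm_le.
  by rewrite setIT [X in (_ * X)%E]vE -EFinM mulVf// gt_eqF.
have [U hU] := density_probability mw w0 w1.
have mfp : measurable_fun setT (fun y => (f (lpproj y))%:E).
  by apply/measurable_EFinP; apply: (measurableT_comp mf); exact: measurable_lpproj.
have -> : (\int[Q]_w (f (Theta w))%:E = \int[U]_y (f (lpproj y))%:E)%E.
  have mfE : measurable_fun setT (EFin \o f) by exact/measurable_EFinP.
  have fE0 y : (0 <= (f y)%:E)%E by rewrite lee_fin.
  rewrite -(ge0_integral_distribution Theta mfE fE0).
  have := ge0_integral_pushforward measurable_lpproj U measurableT mfE (fun y _ => fE0 y).
  rewrite preimage_setT => <-.
  apply: eq_measure_integral => [|? A mA _]; first exact: measurable_lpproj.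
  have mpA : measurable (lpproj @^-1` A).
    by rewrite -[X in measurable X]setTI; exact: measurable_lpproj.
  have mB := measurable_lpnorm_le 1.
  transitivity (cone_measure q (A `&` lpsphere q)); first exact: hT.
  transitivity (U (lpproj @^-1` A)); last by [].
  rewrite hU// /cone_measure volume_cone// vE inver gt_eqF// muleC.
  have mM := measurableI _ _ mpA mB.
  have -> : vol (lpproj @^-1` A `&` lpball q) =
      (\int[vol]_y (\1_(lpproj @^-1` A `&` lpball q) y)%:E)%E.
    by rewrite integral_indic// setIT.
  rewrite -ge0_integralZl//.
  + apply: eq_integral => y _; rewrite -EFinM; congr EFin.
    by rewrite /w heaviside_indic indicI /=; field; rewrite gt_eqF.
  + exact/measurable_EFinP/measurable_indic.
  + by rewrite lee_fin invr_ge0 ltW.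
rewrite (ge0_integral_density mw w0 hU)//; last by move=> y; rewrite lee_fin.
rewrite -ge0_integralZl//; last 3 first.
- by apply: emeasurable_funM => //; exact/measurable_EFinP.
- by move=> y _; rewrite mule_ge0// lee_fin.
- by rewrite lee_fin ltW.
apply: eq_integral => y _; rewrite -!EFinM; congr EFin.
by rewrite /w /=; field; rewrite gt_eqF.
Qed.

(** The normalizing constant is the integral of exp (- rho^r), namely Gamma (n/r + 1) times the
    volume of the unit ball. *)
Definition row_weight (p : \bar R) y : R :=
  if p is r%:E then expR (- (rho y `^ r)) / (Gamma (n%:R / r + 1) * v)
  else heaviside (1 - rho y) / v.

(** The moment of order c of the norm of a row. For finite p it equals Gamma ((n + c) / r) / Gamma
    (n / r), written with arguments at least 1. *)
Definition row_moment (p : \bar R) (c : R) : R :=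
  n%:R / (n%:R + c) *
  (if p is r%:E then Gamma ((n%:R + c) / r + 1) / Gamma (n%:R / r + 1) else 1).

Lemma measurable_row_weight p : measurable_fun setT (row_weight p).
Proof.
have mH : measurable_fun setT (fun y => heaviside (1 - rho y) / v).
  exact: measurable_funM.
case: p => [r||] //=; apply: measurable_funM => //.
apply: (measurableT_comp (@measurable_expR R)).
by apply: measurableT_comp => //; exact: (measurableT_comp (measurable_powR _)).
Qed.

Lemma row_weight_ge0 p y : (0 < p)%E -> 0 <= row_weight p y.
Proof.
have [_ v0] := lpball_volumeE.
case: p => [r||] //= r0; last by rewrite mulr_ge0 ?heaviside_ge0// invr_ge0 ltW.
have g0 : 0 < Gamma (n%:R / r + 1).
  by apply: Gamma_gt0; rewrite divr_ge0// ltW.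
by rewrite divr_ge0 ?expR_ge0// mulr_ge0// ltW.
Qed.

(** Independence of norm and direction: [psi] depends on the direction only and [e] is its mean over
    the ball. The exponent c = 0 is treated apart because the radial formula requires a positive
    exponent. *)
Lemma integral_row_weight p (c e : R) psi : (0 < p)%E -> 0 <= c ->
  measurable_fun setT psi -> (forall y, 0 <= psi y) ->
  (forall b y, 0 < b -> psi (tscale b y) = psi y) ->
  BI psi 1 = (v * e)%:E ->
  (\int[vol]_y (rho y `^ c * psi y * row_weight p y)%:E = (row_moment p c * e)%:E)%E.
Proof.
move=> p0 c0 mpsi psi0 hpsi hBI.
have [vE v0] := lpball_volumeE.
have n0 : 0 < n%:R :> R by rewrite ltr0n.
pose F y := rho y `^ c * psi y.
have mF : measurable_fun setT F.
  apply: measurable_funM => //; exact: (measurableT_comp (measurable_powR _)).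
have F0 y : 0 <= F y by rewrite mulr_ge0 ?powR_ge0.
have hF b y : 0 < b -> F (tscale b y) = b `^ c * F y.
  by move=> b0; rewrite /F hrho// hpsi// powRM ?lpnorm_ge0 ?(ltW b0)// mulrA.
have BIF : BI F 1 = (n%:R / (n%:R + c) * (v * e))%:E.
  move: c0; rewrite le_eqVlt => /predU1P[c0|c0].
    rewrite -c0 addr0 divff ?mul1r ?gt_eqF// -hBI; apply: eq_integral => y _.
    by rewrite /F -c0 powRr0 mul1r.
  rewrite /F (ball_integral_radial ms hmu mrho (@lpnorm_ge0 R n q) hrho mpsi psi0 c0 hpsi).
    by rewrite hBI.
  by rewrite hBI ltry.
case: p p0 => [r||] //= p0; rewrite /row_weight /row_moment.
- rewrite lte_fin in p0.
  have g0 : 0 < Gamma (n%:R / r + 1).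
    by apply: Gamma_gt0; rewrite divr_ge0// ltW.
  have nc0 : 0 <= (n%:R + c) / r by rewrite divr_ge0 ?addr_ge0// ltW.
  have := integral_homogeneous_expRN ms hmu mrho (@lpnorm_ge0 R n q) hrho mF F0 hF p0.
  rewrite BIF -Gamma_eGamma// => h.
  under eq_integral do rewrite mulrA mulrC EFinM.
  rewrite ge0_integralZl//; last 3 first.
  + apply/measurable_EFinP; apply: measurable_funM => //.
    apply: (measurableT_comp (@measurable_expR R)).
    by apply: measurableT_comp => //; exact: (measurableT_comp (measurable_powR _)).
  + by move=> y _; rewrite lee_fin; apply: mulr_ge0; [exact: F0|exact: expR_ge0].
  + by rewrite lee_fin invr_ge0 mulr_ge0// ltW.
  rewrite h -!EFinM; congr EFin.
  move: (Gamma ((n%:R + c) / r + 1)) (Gamma (n%:R / r + 1)) g0 => x y y0; field.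
  by rewrite !gt_eqF//= ltr_wpDr.
- transitivity (\int[vol]_y ((v^-1)%:E * (heaviside (1 - rho y) * F y)%:E))%E.
    by apply: eq_integral => y _; rewrite -EFinM /F; congr EFin; ring.
  rewrite ge0_integralZl//; last 3 first.
  + by apply/measurable_EFinP; exact: measurable_funM.
  + by move=> y _; rewrite lee_fin mulr_ge0 ?heaviside_ge0.
  + by rewrite lee_fin invr_ge0 ltW.
  rewrite [X in (_ * X)%E]BIF -EFinM; congr EFin; field.
  by rewrite !gt_eqF//= ltr_wpDr.
Qed.

End lp_ball.

(** * The law of a row *)

Section row_law.
Context {R : realType} (n : nat) (p1 q1 q2 : \bar R) (p2 : R).
Hypotheses (hn : (0 < n)%N) (hp1 : (0 < p1)%E) (hq1 : (0 < q1)%E)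
  (hq2 : (0 < q2)%E) (hp2 : 0 < p2).
Context d (S : measurableType d) (Q : probability S R)
  (Theta : {RV Q >-> n.-tuple R}) (hTheta : cone_distributed q1 Theta).
Implicit Types (y : n.-tuple R).

Definition cone_moment (a : R) : R :=
  fine 'E_Q[fun w => lpnorm q2 (Theta w) `^ a].

Let psi a y := lpnorm q2 (lpproj q1 y) `^ a.

Let psi_ge0 a y : 0 <= psi a y. Proof. exact: powR_ge0. Qed.

Let mlp a : measurable_fun setT (fun y => lpnorm q2 y `^ a).
Proof. exact: (measurableT_comp (measurable_powR _) (@measurable_lpnorm R n q2)). Qed.

Let mpsi a : measurable_fun setT (psi a).
Proof. exact: (measurableT_comp (mlp a) (@measurable_lpproj R n q1)). Qed.

Let psi_scale a b y : 0 < b -> psi a (tscale b y) = psi a y.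
Proof. by move=> b0; rewrite /psi lpproj_tscale. Qed.

Let v := fine (volume n (lpball q1)).

Let v_gt0 : 0 < v. Proof. by have [] := @lpball_volumeE R n q1 hq1. Qed.

Let ball1 : ball_integral (@volume R n) (lpnorm q1) (cst 1) 1 = (v * 1)%:E.
Proof. by rewrite ball_integral1 mulr1; have [] := @lpball_volumeE R n q1 hq1. Qed.

Let radial y : lpnorm q2 y = lpnorm q1 y * lpnorm q2 (lpproj q1 y).
Proof.
have [y0|y0] := eqVneq (lpnorm q1 y) 0.
  by rewrite y0 mul0r; apply/(lpnorm_eq0 y hq2)/(lpnorm_eq0 y hq1).
rewrite /lpproj lpnorm_tscale ?invr_ge0 ?lpnorm_ge0// mulrA mulfV ?mul1r//.
Qed.

Lemma lpnorm_powR_radial a y : lpnorm q2 y `^ a = lpnorm q1 y `^ a * psi a y.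
Proof. by rewrite radial powRM ?lpnorm_ge0. Qed.

Let lpnorm_proj_le1 y : lpnorm q1 (lpproj q1 y) <= 1.
Proof.
rewrite /lpproj lpnorm_tscale ?invr_ge0 ?lpnorm_ge0//.
have [->|y0] := eqVneq (lpnorm q1 y) 0; first by rewrite mulr0 ler01.
by rewrite mulVf.
Qed.

(** Equivalence of the norms on both sides: the q2-norm is bounded on the q1-ball, whence
    finiteness, and bounded below on the q1-sphere, whence positivity. *)
Lemma cone_moment_spec a : 0 < a -> 0 < cone_moment a /\
  ball_integral (@volume R n) (lpnorm q1) (psi a) 1 = (v * cone_moment a)%:E.
Proof.
move=> a0.
have E := cone_distributed_integral hn hq1 hTheta (mlp a) (fun y => powR_ge0 _ a).
rewrite -[(fun y => _) \o _]/(psi a) -/v in E.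
set J := (\int[Q]_w _)%E in E.
have JE : cone_moment a = fine J by rewrite /cone_moment unlock.
have J0 : (0 <= J)%E by apply: integral_ge0 => w _; rewrite lee_fin powR_ge0.
have [C C0 hC] := @lpnorm_le R n q2 hq2.
have mb F : measurable_fun setT F -> measurable_fun setT
    (fun y => (heaviside (1 - lpnorm q1 y) * F y)%:E).
  move=> mF; apply/measurable_EFinP; apply: measurable_funM => //.
  apply: measurableT_comp; first exact: measurable_heaviside.
  by apply: measurable_funB => //; exact: measurable_lpnorm.
have up : (ball_integral (@volume R n) (lpnorm q1) (psi a) 1 <= (C `^ a * v)%:E)%E.
  rewrite EFinM -[v]mulr1 -ball1 -ge0_integralZl//; last 3 first.
  - by apply: mb; exact: measurable_cst.
  - by move=> y _; rewrite lee_fin mulr_ge0 ?heaviside_ge0.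
  - by rewrite lee_fin powR_ge0.
  apply: ge0_le_integral => //.
  - by move=> y _; rewrite lee_fin mulr_ge0 ?heaviside_ge0.
  - exact: mb.
  - apply: emeasurable_funM => //; by apply: mb; exact: measurable_cst.
  move=> y _; rewrite -EFinM lee_fin mulr1 mulrC ler_wpM2r ?heaviside_ge0//.
  apply: ge0_ler_powR; rewrite ?nnegrE ?lpnorm_ge0 ?(ltW a0) ?(ltW C0)//.
  rewrite -[C]mulr1; apply: hC => // i.
  exact: le_trans (normr_le_lpnorm _ _ hq1) (lpnorm_proj_le1 y).
have Jfin : J \is a fin_num.
  rewrite ge0_fin_numE//; move: up; rewrite E -lee_pdivlMl// -EFinM => h.
  exact: le_lt_trans h (ltry _).
have EJ : ball_integral (@volume R n) (lpnorm q1) (psi a) 1 = (v * cone_moment a)%:E.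
  rewrite E JE EFinM (fineK Jfin).
split=> //.
have [K K0 hK] := @lpnorm_le R n q1 hq1.
have low : (v%:E <= (K `^ a)%:E * ball_integral (@volume R n) (lpnorm q1) (psi a) 1)%E.
  have -> : v%:E = ball_integral (@volume R n) (lpnorm q1) (cst 1) 1.
    by rewrite ball1 mulr1.
  pose Z : set (n.-tuple R) := [set y | lpnorm q1 y <= 0].
  have mZ : measurable Z by exact: measurable_lpnorm_le.
  have Z0 : (\int[@volume R n]_y (\1_Z y)%:E = 0)%E.
    by rewrite integral_indic// setIT; exact: lpnorm_null.
  (* The lower bound on [psi] fails at the origin; adding the null indicator of [Z] makes the
     inequality hold at every point. *)
  rewrite -[leRHS]adde0 -Z0 -ge0_integralZl//; last 3 first.
  - exact: mb.
  - by move=> y _; rewrite lee_fin mulr_ge0 ?heaviside_ge0.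
  - by rewrite lee_fin powR_ge0.
  rewrite -ge0_integralD//; last 3 first.
  - by move=> y _; rewrite -EFinM lee_fin !mulr_ge0 ?powR_ge0 ?heaviside_ge0.
  - by apply: emeasurable_funM => //; exact: mb.
  - exact/measurable_EFinP/measurable_indic.
  apply: ge0_le_integral => //.
  - by move=> y _; rewrite lee_fin mulr_ge0 ?heaviside_ge0.
  - by apply: mb; exact: measurable_cst.
  - by apply: emeasurable_funD; [apply: emeasurable_funM => //; exact: mb|
      exact/measurable_EFinP/measurable_indic].
  move=> y _; rewrite -EFinM -EFinD lee_fin mulr1 indicE.
  have [yZ|yZ] := boolP (y \in Z).
    rewrite -[leLHS]add0r lerD ?mulr_ge0 ?powR_ge0 ?heaviside_ge0//.
    by rewrite /heaviside; case: (0 <= _).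
  rewrite addr0 mulrCA ler_peMr ?heaviside_ge0//.
  move: yZ; rewrite notin_setE /Z/= => /negP; rewrite -ltNge => y0.
  have y1 : lpnorm q1 (lpproj q1 y) = 1.
    by rewrite /lpproj lpnorm_tscale ?invr_ge0 ?lpnorm_ge0// mulVf// gt_eqF.
  rewrite -powRM ?lpnorm_ge0 ?(ltW K0)//.
  have {1}-> : 1 = 1 `^ a :> R by rewrite powR1.
  apply: ge0_ler_powR; rewrite ?nnegrE ?mulr_ge0 ?lpnorm_ge0 ?(ltW a0) ?(ltW K0)//.
  rewrite -y1; apply: hK; last exact: lpnorm_ge0.
  by move=> i; exact: normr_le_lpnorm.
move: low; rewrite EJ -EFinM lee_fin => low.
have := lt_le_trans v_gt0 low.
by rewrite pmulr_rgt0 ?powR_gt0// pmulr_rgt0.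
Qed.

Lemma row_moment_gt0 c : 0 <= c -> 0 < row_moment n p1 c.
Proof.
move=> c0; have n0 : 0 < n%:R :> R by rewrite ltr0n.
apply: mulr_gt0; first by rewrite divr_gt0// ltr_wpDr.
case: p1 hp1 => [r||]// r0; rewrite lte_fin in r0.
by rewrite divr_gt0 ?Gamma_gt0// divr_ge0 ?addr_ge0// ltW.
Qed.

Lemma row_moment0 : row_moment n p1 0 = 1.
Proof.
have n0 : 0 < n%:R :> R by rewrite ltr0n.
rewrite /row_moment addr0 divff ?gt_eqF// mul1r.
case: p1 hp1 => [r||]// r0; rewrite lte_fin in r0.
by rewrite divff// gt_eqF// Gamma_gt0// divr_ge0// ltW.
Qed.

Lemma row_law_exists : exists nu : probability (n.-tuple R) R,
  forall A, measurable A ->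
    nu A = (\int[@volume R n]_y (\1_A y * row_weight q1 p1 y)%:E)%E.
Proof.
apply: density_probability.
- exact: measurable_row_weight.
- by move=> y; exact: row_weight_ge0.
have := integral_row_weight hn hq1 hp1 (lexx 0) (measurable_cst (1:R)) (fun=> ler01)
  (fun _ _ _ => erefl _) ball1.
rewrite row_moment0 mulr1 => <-; apply: eq_integral => y _.
by rewrite powRr0 !mul1r.
Qed.

Section moments.
Variable nu : probability (n.-tuple R) R.
Hypothesis hnu : forall A, measurable A ->
    nu A = (\int[@volume R n]_y (\1_A y * row_weight q1 p1 y)%:E)%E.

Let moment c e (phi f : n.-tuple R -> R) : 0 <= c -> measurable_fun setT phi ->
  (forall y, 0 <= phi y) -> (forall b y, 0 < b -> phi (tscale b y) = phi y) ->
  ball_integral (@volume R n) (lpnorm q1) phi 1 = (v * e)%:E ->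
  (forall y, f y = lpnorm q1 y `^ c * phi y) ->
  nu.-integrable setT (EFin \o f) /\ \int[nu]_y f y = row_moment n p1 c * e.
Proof.
move=> c0 mphi phi0 hphi hBI fE.
have E := integral_row_weight hn hq1 hp1 c0 mphi phi0 hphi hBI.
have mf : measurable_fun setT f.
  rewrite (funext fE); apply: measurable_funM => //.
  exact: (measurableT_comp (measurable_powR _) (@measurable_lpnorm R n q1)).
have f0 y : 0 <= f y by rewrite fE mulr_ge0 ?powR_ge0.
have E' : (\int[nu]_y (f y)%:E = (row_moment n p1 c * e)%:E)%E.
  have mfE : measurable_fun setT (EFin \o f) by exact/measurable_EFinP.
  have fE0 y : (0 <= (EFin \o f) y)%E by rewrite lee_fin.
  have w0 y := row_weight_ge0 hq1 y hp1.
  have := ge0_integral_density (@measurable_row_weight R n q1 p1) w0 hnu mfE fE0.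
  by rewrite -E => ->; apply: eq_integral => y _; rewrite /= fE.
split; last by rewrite /Rintegral E'.
apply/integrableP; split; first exact/measurable_EFinP.
by under eq_integral do rewrite /= ger0_norm//; rewrite E' ltry.
Qed.

Let h y := lpnorm q2 y `^ p2.

Definition row_mean := row_moment n p1 p2 * cone_moment p2.

Lemma row_mean_gt0 : 0 < row_mean.
Proof.
by have [e0 _] := cone_moment_spec hp2; rewrite mulr_gt0// row_moment_gt0// ltW.
Qed.

Let lpmoment a f : 0 < a -> (forall y, f y = lpnorm q2 y `^ a) ->
  nu.-integrable setT (EFin \o f) /\
  \int[nu]_y f y = row_moment n p1 a * cone_moment a.
Proof.
move=> a0 fE; have [_ B] := cone_moment_spec a0.
apply: (moment (phi := psi a)) => //; first exact: ltW.
- by move=> b y; exact: psi_scale.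
- by move=> y; rewrite fE lpnorm_powR_radial.
Qed.

Let pow_nat a k (y : R) : 0 <= y -> (y `^ a) ^+ k = y `^ (k%:R * a).
Proof. by move=> y0; rewrite mulrC powRrM powR_mulrn// powR_ge0. Qed.

Let h1 := lpmoment hp2 (f := h) (fun=> erefl).

Let h2 : nu.-integrable setT (EFin \o fun y => h y ^+ 2) /\
  \int[nu]_y h y ^+ 2 = row_moment n p1 (2 * p2) * cone_moment (2 * p2).
Proof.
apply: lpmoment; first by rewrite mulr_gt0.
by move=> y; rewrite pow_nat// lpnorm_ge0.
Qed.

Let h3 : nu.-integrable setT (EFin \o fun y => `|h y| ^+ 3).
Proof.
have [] := @lpmoment (3%:R * p2) (fun y => `|h y| ^+ 3) => //; first by rewrite mulr_gt0.
by move=> y; rewrite ger0_norm ?powR_ge0// pow_nat// lpnorm_ge0.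
Qed.

Definition row_h y : R := h y / row_mean - 1.

Let mh : measurable_fun setT h := mlp p2.

Lemma measurable_row_h : measurable_fun setT row_h.
Proof. by apply: measurable_funB => //; exact: measurable_funM. Qed.

Let Ic (c : R) : nu.-integrable setT (EFin \o fun=> c).
Proof. exact: finite_measure_integrable_cst. Qed.

Let cubeB1 (c : R) (f : n.-tuple R -> R) : measurable_fun setT f ->
  nu.-integrable setT (EFin \o fun y => `|f y| ^+ 3) ->
  nu.-integrable setT (EFin \o fun y => `|f y / c - 1| ^+ 3).
Proof.
move=> mf If.
have := integrable_cubeB c^-1 1 mf (measurable_cst (1 : R)) If (Ic (`|1| ^+ 3)).
apply: eq_integrable => // y _ /=; congr (`|_| ^+ 3)%:E.
by rewrite mulr1 mulrC.
Qed.

Let centerB1 (c : R) f : c != 0 -> nu.-integrable setT (EFin \o f) ->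
  \int[nu]_y f y = c -> \int[nu]_y (f y / c - 1) = 0.
Proof.
move=> c0 If Ef.
have I : nu.-integrable setT (EFin \o fun y => f y / c).
  by have := integrable_funZl c^-1 If; apply: eq_integrable => // y _ /=; rewrite mulrC.
rewrite RintegralB// Rintegral_cst_probability RintegralZr// Ef divff// subrr//.
Qed.

Lemma row_h_moments : nu.-integrable setT (EFin \o fun y => `|row_h y| ^+ 3) /\
  \int[nu]_y row_h y = 0.
Proof.
split; first exact: cubeB1.
by apply: centerB1; [rewrite gt_eqF// row_mean_gt0|exact: h1.1|exact: h1.2].
Qed.

(** Integrability and value are kept together, so that the mean of a polynomial expression is
    assembled term by term. *)
Let mean f a := nu.-integrable setT (EFin \o f) /\ \int[nu]_y f y = a.

Let meanD f g a c : mean f a -> mean g c -> mean (fun y => f y + g y) (a + c).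
Proof.
by move=> [I1 <-] [I2 <-]; split; [exact: integrable_funD|rewrite RintegralD].
Qed.

Let meanZ k f a : mean f a -> mean (fun y => k * f y) (k * a).
Proof.
by move=> [I1 <-]; split; [exact: integrable_funZl|rewrite RintegralZl].
Qed.

Let mean_cst c : mean (fun=> c) c.
Proof. by split; [exact: Ic|rewrite Rintegral_cst_probability]. Qed.

(** The integrand is the linearization of the delta method with second variable and second exponent
    equal to 0, in the syntactic form in which [delta_method] produces it. *)
Lemma row_variance_infty :
  \int[nu]_y (1 / p2 * row_h y - 0 * 0) ^+ 2 =
  (row_moment n p1 (2 * p2) * cone_moment (2 * p2) / row_mean ^+ 2 - 1) / p2 ^+ 2.
Proof.
have b0 := row_mean_gt0.
transitivity (\int[nu]_y ((p2 * row_mean) ^- 2 * h y ^+ 2 +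
   (- (2 / (p2 ^+ 2 * row_mean)) * h y + (p2 ^- 2)))).
  apply: eq_Rintegral => y _; rewrite /row_h; field.
  by rewrite !gt_eqF.
have hm : mean h row_mean := h1.
rewrite (meanD (meanZ _ h2) (meanD (meanZ _ hm) (mean_cst _))).2.
move: (row_moment n p1 (2 * p2)) (cone_moment (2 * p2)) row_mean b0 => x y z z0.
by field; rewrite !gt_eqF.
Qed.

Section finite_exponent.
Variable r : R.
Hypothesis p1E : p1 = r%:E.

Let r0 : 0 < r. Proof. by move: hp1; rewrite p1E. Qed.

Let g y := lpnorm q1 y `^ r.

Let mg : measurable_fun setT g.
Proof. exact: (measurableT_comp (measurable_powR _) (@measurable_lpnorm R n q1)). Qed.

Let gmoment a f : 0 < a -> (forall y, f y = lpnorm q1 y `^ a) ->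
  nu.-integrable setT (EFin \o f) /\ \int[nu]_y f y = row_moment n p1 a.
Proof.
move=> a0 fE; rewrite -[row_moment _ _ _]mulr1.
apply: (moment (phi := cst 1)) => //; first exact: ltW.
by move=> y; rewrite fE mulr1.
Qed.

Let n0 : 0 < n%:R :> R. Proof. by rewrite ltr0n. Qed.

Let nr0 : 0 <= n%:R / r. Proof. by rewrite divr_ge0// ltW. Qed.

(** The power r of the row norm has a Gamma law of shape n / r, hence mean n / r and, in the next
    lemma, second moment (n/r)(n/r + 1). *)
Lemma row_moment_r : row_moment n p1 r = n%:R / r.
Proof.
rewrite /row_moment p1E (_ : (n%:R + r) / r = n%:R / r + 1); last first.
  by field; rewrite gt_eqF.
rewrite GammaS//; field.
by rewrite !gt_eqF//= ?Gamma_gt0// addr_gt0.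
Qed.

Let row_moment_2r : row_moment n p1 (2%:R * r) = n%:R / r * (n%:R / r + 1).
Proof.
rewrite /row_moment p1E (_ : (n%:R + 2%:R * r) / r = n%:R / r + 1 + 1); last first.
  by field; rewrite gt_eqF.
rewrite GammaS ?addr_ge0// GammaS//; field.
by rewrite !gt_eqF//= ?Gamma_gt0// addr_gt0// mulr_gt0.
Qed.

Let g1 := gmoment r0 (f := g) (fun=> erefl).

Let g2 : nu.-integrable setT (EFin \o fun y => g y ^+ 2) /\
  \int[nu]_y g y ^+ 2 = row_moment n p1 (2%:R * r).
Proof.
apply: gmoment; first by rewrite mulr_gt0.
by move=> y; rewrite pow_nat// lpnorm_ge0.
Qed.

Let g3 : nu.-integrable setT (EFin \o fun y => `|g y| ^+ 3).
Proof.
have [] := @gmoment (3%:R * r) (fun y => `|g y| ^+ 3) => //; first by rewrite mulr_gt0.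
by move=> y; rewrite ger0_norm ?powR_ge0// pow_nat// lpnorm_ge0.
Qed.

Let gh : nu.-integrable setT (EFin \o fun y => g y * h y) /\
  \int[nu]_y (g y * h y) = row_moment n p1 (r + p2) * cone_moment p2.
Proof.
have [_ B] := cone_moment_spec hp2.
apply: (moment (phi := psi p2)) => //; first by rewrite addr_ge0// ltW.
- by move=> b y; exact: psi_scale.
move=> y; rewrite /h lpnorm_powR_radial powRD ?mulrA//.
by rewrite gt_eqF ?addr_gt0.
Qed.

Definition row_g y : R := g y / (n%:R / r) - 1.

Lemma measurable_row_g : measurable_fun setT row_g.
Proof. by apply: measurable_funB => //; exact: measurable_funM. Qed.

Lemma row_g_moments : nu.-integrable setT (EFin \o fun y => `|row_g y| ^+ 3) /\
  \int[nu]_y row_g y = 0.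
Proof.
split; first exact: cubeB1.
apply: centerB1; [by rewrite gt_eqF// divr_gt0|exact: g1.1|].
by rewrite g1.2 row_moment_r.
Qed.

Lemma row_variance :
  \int[nu]_y (1 / p2 * row_h y - 1 / r * row_g y) ^+ 2 =
  (row_moment n p1 (2 * p2) * cone_moment (2 * p2) / row_mean ^+ 2 - 1) / p2 ^+ 2
  + 1 / (n%:R * r) - 2 / (p2 * r) *
    (r / n%:R * row_moment n p1 (r + p2) / row_moment n p1 p2 - 1).
Proof.
have b0 := row_mean_gt0.
have m0 : 0 < row_moment n p1 p2 by rewrite row_moment_gt0// ltW.
(* The linearization is h / (p2 row_mean) - g / n - u; [c1], [c2], [c3] are the coefficients of h, g
   and g h in its square. *)
pose u := 1 / p2 - 1 / r.
pose c1 := - (2 * u / (p2 * row_mean)).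
pose c2 := 2 * u / n%:R.
pose c3 := - (2 / (p2 * row_mean * n%:R)).
transitivity (\int[nu]_y ((p2 * row_mean) ^- 2 * h y ^+ 2 +
   (c1 * h y + (c2 * g y + (n%:R ^- 2 * g y ^+ 2 + (c3 * (g y * h y) + u ^+ 2)))))).
  apply: eq_Rintegral => y _; rewrite /row_h /row_g /c1 /c2 /c3 /u; field.
  by rewrite !gt_eqF.
have hm : mean h row_mean := h1.
have g1' : mean g (n%:R / r) by rewrite -row_moment_r; exact: g1.
have g2' : mean (fun y => g y ^+ 2) (n%:R / r * (n%:R / r + 1)).
  by rewrite -row_moment_2r; exact: g2.
have gh' : mean (fun y => g y * h y)
    (row_moment n p1 (r + p2) / row_moment n p1 p2 * row_mean).
  by rewrite /row_mean mulrA divfK; [exact: gh|exact: lt0r_neq0].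
rewrite (meanD (meanZ _ h2) (meanD (meanZ _ hm) (meanD (meanZ _ g1')
  (meanD (meanZ _ g2') (meanD (meanZ _ gh') (mean_cst _)))))).2 /c1 /c2 /c3 /u.
move: (row_moment n p1 (r + p2)) (row_moment n p1 (2 * p2)) (cone_moment (2 * p2))
  (row_moment n p1 p2) m0 row_mean b0 => x y z k k0 w w0.
by field; rewrite !gt_eqF.
Qed.

End finite_exponent.
End moments.
End row_law.

(** * The law of the normalized statistic *)

Lemma powRV {R : realType} (x c : R) : 0 <= x -> (x^-1) `^ c = (x `^ c)^-1.
Proof. by move=> x0; rewrite -powR_inv1// -powRrM mulN1r powRN. Qed.

Section constants.
Context {R : realType} (n : nat) (p1 : \bar R).
Hypotheses (hn : (0 < n)%N) (hp1 : (0 < p1)%E).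

(* The rescaling between the density exp (- rho ^ p1) used for the rows and the
   density exp (- |z| ^ p / p), p = p1 / n, behind Mconst. *)
Definition row_scale : R := if p1 is r%:E then (r / n%:R) `^ r^-1 else 1.

Lemma row_scale_gt0 : 0 < row_scale.
Proof.
rewrite /row_scale; case: p1 hp1 => [r||]//; rewrite lte_fin => r0.
by rewrite powR_gt0// divr_gt0// ltr0n.
Qed.

(** Let Z have density proportional to exp (- |z|^p / p) with p = p1 / n. Then |Z|^p / p and the
    power p1 of the row norm have the same Gamma law, so |Z|^(1/n) is distributed as [row_scale]
    times the row norm. For p1 = +oo both |Z| and the n-th power of the row norm are uniform on
    [0, 1]. *)
Lemma Mconst_row (c : R) : 0 <= c ->
  Mconst (p1 / n%:R%:E)%E (c / n%:R) = row_scale `^ c * row_moment n p1 c.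
Proof.
move=> c0; have n0 : 0 < n%:R :> R by rewrite ltr0n.
have nn : n%:R != 0 :> R by rewrite gt_eqF.
have cn : n%:R + c != 0 by rewrite gt_eqF// ltr_wpDr.
have E : c / n%:R + 1 = (n%:R + c) / n%:R by field.
rewrite /Mconst /row_scale /row_moment E inver (negbTE nn).
case: p1 hp1 => [r||]//= r0.
- rewrite lte_fin in r0; have rn : r != 0 by rewrite gt_eqF.
  have rnn : r * n%:R^-1 != 0 by rewrite mulf_neq0// invr_eq0.
  rewrite -powRrM /divy inver (negbTE rnn) /=.
  rewrite (_ : c / n%:R / (r / n%:R) = r^-1 * c); last by field; rewrite rn.
  rewrite (_ : (n%:R + c) / n%:R / (r / n%:R) = (n%:R + c) / r); last by field; rewrite rn.
  rewrite (_ : 1 / (r / n%:R) = n%:R / r); last by field; rewrite rn.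
  rewrite -mulrA; congr (_ * _); rewrite invf_div.
  by congr (_ * _).
- rewrite gt0_mulye ?lte_fin ?invr_gt0//.
  have d0 (a : R) : divy a +oo%E = 0 by rewrite /divy invey mule0.
  rewrite !d0 /= powR1 mul1r add0r.
  have := Gamma_gt0 (lexx (0:R)); rewrite add0r => h.
  by rewrite divff ?gt_eqF// !mulr1 ?mul1r invf_div.
Qed.

(** The moment of order p of the density proportional to exp (- |z|^p / p) is 1; this removes one
    factor from the product in [Cconst]. *)
Lemma Mconst_rowr (r : R) : p1 = r%:E -> Mconst (p1 / n%:R%:E)%E (r / n%:R) = 1.
Proof.
move=> p1E; have r0 : 0 < r by move: hp1; rewrite p1E.
rewrite Mconst_row ?(ltW r0)// /row_scale (row_moment_r hn hp1 p1E) p1E.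
rewrite -powRrM mulVf ?gt_eqF// powRr1; last by rewrite divr_ge0// ltW.
by field; rewrite !gt_eqF//= ltr0n.
Qed.

End constants.

Section statistic_ratio.
Context {R : realType} (m n : nat) (p1 q1 q2 : \bar R) (p2 b : R).
Hypotheses (hm : (0 < m)%N) (hn : (0 < n)%N) (hp1 : (0 < p1)%E) (hq1 : (0 < q1)%E)
  (hq2 : (0 < q2)%E) (hp2 : 0 < p2) (b0 : 0 < b).
Implicit Types (x : m.-tuple (n.-tuple R)).

Let h (y : n.-tuple R) := lpnorm q2 y `^ p2.
Let X1 (y : n.-tuple R) := h y / b - 1.

Let m0 : 0 < m%:R :> R. Proof. by rewrite ltr0n. Qed.

Lemma mixed_norm_fin (p : R) q x :
  mixed_norm p%:E q x = (\sum_(i < m) lpnorm q (tnth x i) `^ p) `^ p^-1.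
Proof.
rewrite /mixed_norm /=; congr (_ `^ _); apply: eq_bigr => i _.
by rewrite tnth_mktuple ger0_norm// lpnorm_ge0.
Qed.

Lemma walk_center (f : n.-tuple R -> R) (c : R) x : c != 0 ->
  1 + walk (fun y => f y / c - 1) x / m%:R = (\sum_(i < m) f (tnth x i)) / (m%:R * c).
Proof.
move=> c0; rewrite /walk sumrB -mulr_suml sumr_const card_ord.
by rewrite -mulr_natr mul1r; field; rewrite c0 gt_eqF.
Qed.

Lemma ratio_infty x : row_scale n p1 = 1 -> divy 1 p1 = 0 ->
  clt_statistic p1 p2 q2 b x =
  Num.sqrt m%:R * (ratio X1 (cst 0) (1 / p2) 0 x - 1).
Proof.
move=> k1 d0; rewrite /clt_statistic d0 /ratio; congr (_ * (_ - 1)).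
rewrite walk_center ?gt_eqF// oppr0 powRr0 mulr1 mixed_norm_fin -/h.
have S0 : 0 <= \sum_(i < m) h (tnth x i) by apply: sumr_ge0 => i _; exact: powR_ge0.
have mb0 : 0 <= m%:R * b by rewrite mulr_ge0 ?(ltW m0) ?(ltW b0).
rewrite -[\sum_(i < m) _ `^ p2]/(\sum_(i < m) h (tnth x i)).
set A := \sum_(i < m) _ in S0 *.
rewrite !div1r sub0r powRN (powRM _ S0) ?invr_ge0// powRV//.
rewrite (powRM _ (ltW m0) (ltW b0)).
have u2 : 0 < m%:R `^ p2^-1 by exact: powR_gt0.
have u3 : 0 < b `^ p2^-1 by exact: powR_gt0.
by field; rewrite !gt_eqF.
Qed.

(** Divide and multiply by the mixed norm. The mean n / r of the denominator terms leaves
    (n/r)^(1/r), the inverse of [row_scale], which is why the normalization carries [row_scale] to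
    the power p2. *)
Lemma ratio_fin (r : R) x : p1 = r%:E ->
  clt_statistic p1 p2 q2 (row_scale n p1 `^ p2 * b) x =
  Num.sqrt m%:R * (mixed_norm p1 q1 x *
    ratio X1 (row_g q1 r) (1 / p2) (1 / r) x - 1).
Proof.
move=> p1E; have r0 : 0 < r by move: hp1; rewrite p1E.
have n0 : 0 < n%:R :> R by rewrite ltr0n.
rewrite /clt_statistic; congr (_ * (_ - 1)).
(* If the norm vanishes, so do all entries, and both sides are 0; otherwise one may divide by it. *)
have [N0|N0] := eqVneq (mixed_norm p1 q1 x) 0.
  rewrite N0 mul0r (_ : mixed_norm _ _ _ = 0) ?mulr0//.
  apply/lpnorm_eq0 => // i; rewrite tnth_mktuple.
  apply/(lpnorm_eq0 _ hq2)/(lpnorm_eq0 _ hq1).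
  by have := (lpnorm_eq0 _ hp1).1 N0 i; rewrite tnth_mktuple.
have a0 : 0 < n%:R / r by rewrite divr_gt0.
rewrite /ratio !walk_center ?gt_eqF// mixed_norm_fin -/h.
have S0 : 0 <= \sum_(i < m) h (tnth x i) by apply: sumr_ge0 => i _; exact: powR_ge0.
rewrite -[\sum_(i < m) _ `^ p2]/(\sum_(i < m) h (tnth x i)).
set A := \sum_(i < m) h _ in S0 *.
set N := mixed_norm p1 q1 x in N0 *.
have N_ge0 : 0 <= N by exact: mixed_norm_ge0.
have GN : (\sum_(i < m) lpnorm q1 (tnth x i) `^ r) `^ (1 / r) = N.
  by rewrite /N p1E mixed_norm_fin div1r.
have G0 : 0 <= \sum_(i < m) lpnorm q1 (tnth x i) `^ r.
  by apply: sumr_ge0 => i _; exact: powR_ge0.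
rewrite !(div1r p2).
have ma0 : 0 <= m%:R * (n%:R / r) by rewrite mulr_ge0 ?(ltW m0) ?(ltW a0).
have mb0 : 0 <= m%:R * b by rewrite mulr_ge0 ?(ltW m0) ?(ltW b0).
rewrite (powRM _ S0) ?invr_ge0// powRV// (powRM _ (ltW m0) (ltW b0)).
rewrite powRN (powRM _ G0) ?invr_ge0// GN powRV// (powRM _ (ltW m0) (ltW a0)).
have k0 := row_scale_gt0 hn hp1.
rewrite (powRM _ (powR_ge0 _ _) (ltW b0)) -powRrM mulrC.
have -> : p2 * p2^-1 = 1 by field; rewrite gt_eqF.
rewrite (powRr1 (ltW k0)).
have kE : (n%:R / r) `^ (1 / r) = (row_scale n p1)^-1.
  by rewrite /row_scale p1E div1r -powRV ?invf_div// divr_ge0// ltW.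
have dE : divy 1 p1 = 1 / r by rewrite p1E /divy inver gt_eqF.
rewrite kE dE powRB; last by rewrite (gt_eqF m0) implybT.
have u1 : 0 < m%:R `^ (1 / r) by exact: powR_gt0.
have u2 : 0 < m%:R `^ p2^-1 by exact: powR_gt0.
have u3 : 0 < b `^ p2^-1 by exact: powR_gt0.
by field; rewrite N0 !gt_eqF.
Qed.

End statistic_ratio.

(** * The uniform law on the ball compared with independent rows *)

Section uniform_law.
Context {R : realType} (m n : nat) (p1 q1 : \bar R).
Hypotheses (hn : (0 < n)%N) (hp1 : (0 < p1)%E) (hq1 : (0 < q1)%E).
Variable nu : probability (n.-tuple R) R.
Hypothesis hnu : forall A, measurable A ->
  nu A = (\int[@volume R n]_y (\1_A y * row_weight q1 p1 y)%:E)%E.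
Notation vol := (@mixed_volume R m n).
Notation rho := (@mixed_norm R m n p1 q1).
Notation ball := (@mixed_ball R m n p1 q1).
Implicit Types (x : m.-tuple (n.-tuple R)) (A : set (m.-tuple (n.-tuple R))).

Definition conical A := forall c x, 0 < c -> A (mtscale c x) <-> A x.

Let ms c : 0 < c -> measurable_fun setT (@mtscale R m n c).
Proof. by move=> _; exact: measurable_mtscale. Qed.

Let hrho c x : 0 < c -> rho (mtscale c x) = c * rho x.
Proof. by move=> c0; rewrite mixed_norm_mtscale// ltW. Qed.

Let measurable_rho_le r : measurable [set x | rho x <= r].
Proof.
rewrite -[X in measurable X]setTI.
have := @measurable_mixed_norm R m n p1 q1 measurableT _ (measurable_itv `]-oo, r]).
by rewrite /preimage/=; under eq_set do rewrite in_itv/=.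
Qed.

Let ball_integral_indic A r : measurable A ->
  ball_integral vol rho \1_A r = vol (A `&` [set x | rho x <= r]).
Proof.
move=> mA; rewrite /ball_integral -[_ `&` _ in RHS]setIT -integral_indic//; last first.
  exact: measurableI.
apply: eq_integral => x _; congr EFin.
rewrite indicI /= mulrC; congr (_ * _).
by rewrite /heaviside subr_ge0 indicE mem_setE.
Qed.

(* Both sides are proportional on conical events: integrating in the radial
   direction turns exp (- N ^ p1) into a constant multiple of the indicator of
   the unit ball. *)
Lemma tuple_row_law : exists2 k : R, 0 <= k &
  forall A, measurable A -> p1 = +oo%E \/ conical A ->
    tuple_measure nu m A = (k%:E * vol (A `&` ball))%E.
Proof.
have [_ v0] := @lpball_volumeE R n q1 hq1.
set v := fine _ in v0.
have mw := @measurable_row_weight R n q1 p1.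
have w0 y := @row_weight_ge0 R n q1 hq1 p1 y hp1.
have E A (mA : measurable A) := tuple_measure_density mw w0 hnu mA.
case p1E : p1 hp1 => [r||]// r0; last first.
  exists (v^-1 ^+ m); first by rewrite exprn_ge0// invr_ge0 ltW.
  move=> A mA _; rewrite E//.
  rewrite -[_ `&` _](_ : A `&` [set x | rho x <= 1] = _)//; last by rewrite p1E.
  rewrite -ball_integral_indic// /ball_integral -ge0_integralZl//; last 3 first.
  - apply/measurable_EFinP; apply: measurable_funM; last exact: measurable_indic.
    apply: measurableT_comp; first exact: measurable_heaviside.
    by apply: measurable_funB => //; exact: measurable_mixed_norm.
  - by move=> x _; rewrite lee_fin mulr_ge0 ?heaviside_ge0.
  - by rewrite lee_fin exprn_ge0// invr_ge0 ltW.
  apply: eq_integral => x _; rewrite -EFinM; congr EFin.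
  rewrite mulrA mulrC; congr (_ * _).
  rewrite p1E /= big_split /= prodr_const card_ord mulrC; congr (_ * _).
  rewrite /mixed_norm /=; have [h|] := boolP [forall i, lpnorm q1 (tnth x i) <= 1].
    move/forallP in h; rewrite big1 => [|i _]; last by rewrite /heaviside subr_ge0 h.
    rewrite /heaviside subr_ge0 bigmax_le// => i _.
    by rewrite tnth_mktuple ger0_norm// lpnorm_ge0.
  rewrite negb_forall => /existsP[i hi]; rewrite (bigD1 i)//=.
  have -> : heaviside (1 - lpnorm q1 (tnth x i)) = 0.
    by rewrite /heaviside subr_ge0 (negbTE hi).
  rewrite mul0r /heaviside subr_ge0 leNgt.
  rewrite -ltNge in hi; rewrite (lt_le_trans hi)//.
  apply: (@le_trans _ _ `|tnth [tuple lpnorm q1 (tnth x i) | i < m] i|).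
    by rewrite tnth_mktuple ler_norm.
  exact: (le_bigmax _ (fun i => `|tnth [tuple lpnorm q1 (tnth x i) | i < m] i|) i).
rewrite lte_fin in r0.
have g0 : 0 < Gamma (n%:R / r + 1) by apply: Gamma_gt0; rewrite divr_ge0// ltW.
pose K := (Gamma (n%:R / r + 1) * v)^-1 ^+ m.
have K0 : 0 <= K by rewrite exprn_ge0// invr_ge0 mulr_ge0// ltW.
have b0 : 0 <= (n * m)%:R / r by rewrite divr_ge0// ltW.
have gb := Gamma_gt0 b0.
exists (K * Gamma ((n * m)%:R / r + 1)); first exact: mulr_ge0 K0 (ltW gb).
move=> A mA [//|coneA]; rewrite E//.
(* The indicator of a conical set is homogeneous of degree 0. *)
have hF c x : 0 < c -> \1_A (mtscale c x) = c `^ 0 * \1_A x :> R.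
  move=> c0; rewrite powRr0 mul1r !indicE; congr (nat_of_bool _)%:R.
  by apply/idP/idP; rewrite !inE => /coneA; apply.
have I0 x : 0 <= \1_A x :> R by rewrite indicE.
have mI : measurable_fun setT (\1_A : _ -> R) by exact: measurable_indic.
have := integral_homogeneous_expRN ms (@mixed_volume_scale R m n)
  (@measurable_mixed_norm R m n p1 q1) (@mixed_norm_ge0 R m n p1 q1) hrho mI
  I0 hF r0.
rewrite addr0 -Gamma_eGamma// ball_integral_indic// => H.
rewrite EFinM -muleA.
rewrite -[_ `&` mixed_ball _ _](_ : A `&` [set x | rho x <= 1] = _)//; last by rewrite p1E.
rewrite -H -ge0_integralZl//; last first.
  apply/measurable_EFinP; apply: measurable_funM => //.
  apply: measurableT_comp => //; apply: measurableT_comp => //.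
  apply: (measurableT_comp (measurable_powR _)); exact: measurable_mixed_norm.
apply: eq_integral => x _; rewrite -EFinM; congr EFin.
rewrite mulrCA; congr (_ * _).
rewrite p1E mixed_norm_fin /= big_split /= prodr_const card_ord mulrC; congr (_ * _).
rewrite -expR_sum -powRrM mulVf ?gt_eqF// powRr1 ?sumrN//.
by apply: sumr_ge0 => i _; exact: powR_ge0.
Qed.

Context d (T : measurableType d) (P : probability T R)
  (X : {RV P >-> m.-tuple (n.-tuple R)}).
Hypothesis hX : uniform_on_mixed_ball p1 q1 X.

(** The whole space is conical and has probability 1; applying the proportionality to it shows at
    once that the volume of the ball is finite and positive and that the constant is its inverse. *)
Let mixed_ball_volume : exists2 k : R, 0 < k & vol ball = k%:E /\
  forall A, measurable A -> p1 = +oo%E \/ conical A ->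
    tuple_measure nu m A = (k^-1%:E * vol (A `&` ball))%E.
Proof.
have [k k0 hk] := tuple_row_law.
have := hk setT measurableT (or_intror (fun c x _ => iff_refl _)).
rewrite probability_setT setTI => /esym h.
have {}k0 : 0 < k.
  rewrite lt_neqAle k0 andbT; apply/eqP => k00.
  by move: h; rewrite -k00 mul0e => -[] /eqP; rewrite eq_sym oner_eq0.
exists k^-1; rewrite ?invr_gt0//; split; last by rewrite invrK.
case V: (vol ball) h => [a||].
- by rewrite -EFinM => -[ka]; congr EFin; rewrite -[RHS]mulr1 -ka mulKf// gt_eqF.
- by rewrite gt0_muley// lte_fin.
- by rewrite gt0_muleNy// lte_fin.
Qed.

Lemma uniform_law A : measurable A -> p1 = +oo%E \/ conical A ->
  distribution P X A = tuple_measure nu m A.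
Proof.
move=> mA cA; have [k k0 [V hk]] := mixed_ball_volume.
by rewrite hX// hk// V inver gt_eqF// muleC.
Qed.

Lemma mixed_ball_full : distribution P X (~` ball) = 0%E.
Proof.
by rewrite hX ?setICl ?measure0 ?mul0e//; apply: measurableC; exact: measurable_rho_le.
Qed.

Lemma mixed_norm_law (s : R) : 0 < s -> s <= 1 ->
  distribution P X [set x | rho x <= s] = (s ^+ (n * m))%:E.
Proof.
move=> s0 s1; have [k k0 [V hk]] := mixed_ball_volume.
rewrite hX; last exact: measurable_rho_le.
rewrite (_ : _ `&` _ = setT `&` [set x | rho x <= s]); last first.
  rewrite setTI; apply/seteqP; split => x //= [] //.
  move=> h; split=> //; exact: le_trans s1.
rewrite -ball_integral_indic//.
have hF c x : 0 < c ->
    \1_setT (mtscale c x) = c `^ 0 * \1_(setT : set (m.-tuple (n.-tuple R))) x :> R.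
  by move=> c0; rewrite powRr0 mul1r !indicT.
have mI : measurable_fun setT (\1_(setT : set (m.-tuple (n.-tuple R))) : _ -> R).
  exact: measurable_indic.
have I0 x : 0 <= \1_(setT : set (m.-tuple (n.-tuple R))) x :> R by rewrite indicE.
rewrite (ball_integral_scale ms (@mixed_volume_scale R m n)
  (@measurable_mixed_norm R m n p1 q1) hrho mI I0 hF)//.
rewrite addr0 powR_mulrn ?(ltW s0)// ball_integral_indic// setTI.
by rewrite -[vol _]/(vol ball) V inver gt_eqF// -!EFinM mulfK// gt_eqF.
Qed.

End uniform_law.

Lemma sandwich_dist (R : realType) (l l' p w w' b e : R) :
  `|l - w| <= e / 3 -> `|l' - w'| <= e / 3 -> b <= e / 3 ->
  w <= p -> p <= w' + b -> l' <= l + e / 3 -> `|l - p| <= e.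
Proof. by rewrite !ler_norml => /andP[? ?] /andP[? ?] *; apply/andP; split; lra. Qed.

(** * Limit of the distribution functions of the statistic *)

Section limit_law.
Context {R : realType} (n : nat) (p1 q1 q2 : \bar R) (p2 : R).
Hypotheses (hn : (0 < n)%N) (hp1 : (0 < p1)%E) (hq1 : (0 < q1)%E)
  (hq2 : (0 < q2)%E) (hp2 : 0 < p2).
Context dS (S : measurableType dS) (Q : probability S R)
  (Theta : {RV Q >-> n.-tuple R}) (hTheta : cone_distributed q1 Theta).
Context (d : nat -> measure_display) (T : forall m, measurableType (d m))
  (P : forall m, probability (T m) R)
  (X : forall m, {RV (P m) >-> m.-tuple (n.-tuple R)}).
Hypothesis hX : forall m, (0 < m)%N -> uniform_on_mixed_ball p1 q1 (X m).
Variable nu : probability (n.-tuple R) R.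
Hypothesis hnu : forall A, measurable A ->
  nu A = (\int[@volume R n]_y (\1_A y * row_weight q1 p1 y)%:E)%E.
Implicit Types (m : nat) (t : R).

Let b := row_mean p1 q2 p2 Theta.
Let X1 := row_h p1 q2 p2 Theta.
Let mX1 : measurable_fun setT X1 := measurable_row_h p1 q2 p2 Theta.

Let b0 : 0 < b. Proof. exact: (row_mean_gt0 hn hp1 hq1 hq2 hp2 hTheta). Qed.

Let law m (A : set (m.-tuple (n.-tuple R))) : R := fine (distribution (P m) (X m) A).

Let ratio_le (X2 : n.-tuple R -> R) be t m : set (m.-tuple (n.-tuple R)) :=
  [set x | Num.sqrt m%:R * (ratio X1 X2 (1 / p2) be x - 1) <= t].

Let statistic_le t m : set (m.-tuple (n.-tuple R)) :=
  [set x | clt_statistic p1 p2 q2 (row_scale n p1 `^ p2 * b) x <= t].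

Let measurable_le m (f : m.-tuple (n.-tuple R) -> R) t :
  measurable_fun setT f -> measurable [set x | f x <= t].
Proof.
move=> mf; rewrite -[X in measurable X]setTI.
have := mf measurableT _ (measurable_itv `]-oo, t]).
by rewrite /preimage/=; under eq_set do rewrite in_itv/=.
Qed.

Let measurable_ratio_le X2 be t m : measurable_fun setT X2 ->
  measurable (@ratio_le X2 be t m).
Proof.
move=> mX2; apply: measurable_le; apply: measurable_funM => //.
by apply: measurable_funB => //; exact: measurable_ratio.
Qed.

Let measurable_statistic_le t m : measurable (@statistic_le t m).
Proof. by apply: measurable_le; exact: measurable_clt_statistic. Qed.

Let law_leU3 m (A A1 A2 A3 : set (m.-tuple (n.-tuple R))) :
  measurable A -> measurable A1 -> measurable A2 -> measurable A3 ->
  A `<=` A1 `|` (A2 `|` A3) -> law A <= law A1 + (law A2 + law A3).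
Proof. exact: (@fine_probabilityU3 _ _ _ (distribution (P m) (X m))). Qed.

Lemma limit_law_infty t : p1 = +oo%E ->
  let s2 := (row_moment n p1 (2 * p2) * cone_moment q2 Theta (2 * p2) / b ^+ 2 - 1)
    / p2 ^+ 2 in
  s2 != 0 \/ t != 0 ->
  law (@statistic_le t m) @[m --> \oo] --> gaussian_lim s2 t.
Proof.
move=> p1E s2; rewrite /s2 -(row_variance_infty hn hp1 hq1 hq2 hp2 hTheta hnu) => H.
have [I1 E1] := row_h_moments hn hp1 hq1 hq2 hp2 hTheta hnu.
have I2 : nu.-integrable setT (EFin \o fun y : n.-tuple R => `|cst 0 y : R| ^+ 3).
  exact: (finite_measure_integrable_cst nu (`|0| ^+ 3)%R).
have E2 : \int[nu]_y (cst 0 : n.-tuple R -> R) y = 0 by rewrite Rintegral_cst_probability.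
have m2 : measurable_fun setT (cst 0 : n.-tuple R -> R) by exact: measurable_cst.
have := delta_method mX1 m2 I1 I2 E1 E2 H.
apply: cvg_trans; apply: near_eq_cvg; near=> m.
have m0 : (0 < m)%N by near: m; exact: nbhs_infty_gt.
rewrite /law -(uniform_law hp1 hq1 hnu (hX m0)); last 2 first.
- by apply: measurable_ratio_le; exact: measurable_cst.
- by left.
congr (fine (_ _)); apply/seteqP; split => x /=;
  by rewrite /statistic_le /ratio_le /= (ratio_infty _ _ m0)// p1E /row_scale
    ?powR1 ?mul1r// /divy invey mule0.
Unshelve. all: end_near. Qed.

Lemma limit_law_fin r t : p1 = r%:E ->
  let s2 := (row_moment n p1 (2 * p2) * cone_moment q2 Theta (2 * p2) / b ^+ 2 - 1)
    / p2 ^+ 2 + 1 / (n%:R * r) - 2 / (p2 * r) *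
    (r / n%:R * row_moment n p1 (r + p2) / row_moment n p1 p2 - 1) in
  s2 != 0 \/ t != 0 ->
  law (@statistic_le t m) @[m --> \oo] --> gaussian_lim s2 t.
Proof.
move=> p1E s2; rewrite /s2 -(row_variance hn hp1 hq1 hq2 hp2 hTheta hnu p1E).
set s := Rintegral _ _ _ => H.
have s0 : 0 <= s by apply: Rintegral_ge0 => y _; exact: sqr_ge0.
have r0 : 0 < r by move: hp1; rewrite p1E.
have n0 : 0 < n%:R :> R by rewrite ltr0n.
have [I1 E1] := row_h_moments hn hp1 hq1 hq2 hp2 hTheta hnu.
have [I2 E2] := row_g_moments hn hp1 hq1 hnu p1E.
have mX2 := @measurable_row_g R n q1 r.
pose A u m := @ratio_le (@row_g R n q1 r) (1 / r) u m.
have mA u m : measurable (A u m) by exact: measurable_ratio_le.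
have ratio_ge0 m (x : m.-tuple (n.-tuple R)) :
    0 <= ratio X1 (row_g q1 r) (1 / p2) (1 / r) x.
  by rewrite mulr_ge0// powR_ge0.
have scale m (x : m.-tuple (n.-tuple R)) q (a e c : R) :
    (0 < m)%N -> 0 < c -> (0 < q)%E -> e != 0 ->
    let f y := lpnorm q y `^ a / e - 1 in
    1 + walk f (mtscale c x) / m%:R = c `^ a * (1 + walk f x / m%:R).
  move=> m0 c0 q0 en0 f; rewrite !(walk_center m0)// mulrA; congr (_ / _).
  rewrite mulr_sumr; apply: eq_bigr => i _.
  by rewrite tnth_map lpnorm_tscale ?(ltW c0)// powRM ?lpnorm_ge0// ltW.
(* A dilation by c multiplies the two empirical means by c^p2 and c^r, hence the two factors of the
   ratio by c and 1 / c. *)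
have conA u m : (0 < m)%N -> conical (A u m).
  move=> m0 c x c0; rewrite /A /ratio_le /=.
  suff -> : ratio X1 (row_g q1 r) (1 / p2) (1 / r) (mtscale c x) =
            ratio X1 (row_g q1 r) (1 / p2) (1 / r) x by [].
  have w0 f (q : \bar R) (a e : R) : 0 < e ->
      f =1 (fun y => lpnorm q y `^ a / e - 1) -> 0 <= 1 + walk f x / m%:R.
    move=> e0 fE; rewrite (_ : f = fun y => lpnorm q y `^ a / e - 1); last exact/funext.
    rewrite (walk_center m0) ?gt_eqF// divr_ge0// ?mulr_ge0 ?(ltW e0)//.
    by apply: sumr_ge0 => i _; exact: powR_ge0.
  have nr0 : 0 < n%:R / r by rewrite divr_gt0.
  have S1 : 1 + walk X1 (mtscale c x) / m%:R = c `^ p2 * (1 + walk X1 x / m%:R).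
    by apply: scale => //; rewrite gt_eqF.
  have S2 : 1 + walk (row_g q1 r) (mtscale c x) / m%:R =
      c `^ r * (1 + walk (row_g q1 r) x / m%:R).
    by apply: scale => //; rewrite gt_eqF.
  have W1 : 0 <= 1 + walk X1 x / m%:R by apply: (w0 _ q2 p2 b).
  have W2 : 0 <= 1 + walk (row_g q1 r) x / m%:R by apply: (w0 _ q1 r (n%:R / r)).
  rewrite /ratio S1 S2; move: W1 W2; move: (1 + _ / _) (1 + _ / _) => y z u0 v0.
  have cr : c `^ r `^ r^-1 = c by rewrite -powRrM mulfV ?gt_eqF// powRr1// ltW.
  have cp : c `^ p2 `^ p2^-1 = c by rewrite -powRrM mulfV ?gt_eqF// powRr1// ltW.
  rewrite !div1r (powRM _ (powR_ge0 _ _) u0) (powRM _ (powR_ge0 _ _) v0) cp.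
  rewrite (powRN (c `^ r)) cr.
  by field; rewrite gt_eqF.
have law_A u m : (0 < m)%N -> law (A u m) = fine (tuple_measure nu m (A u m)).
  by move=> m0; rewrite /law (uniform_law hp1 hq1 hnu (hX m0))//; right; exact: conA.
have lim_A u : s != 0 \/ u != 0 -> law (A u m) @[m --> \oo] --> gaussian_lim s u.
  move=> /(delta_method mX1 mX2 I1 I2 E1 E2); apply: cvg_trans; apply: near_eq_cvg.
  near=> m; apply/esym/law_A; near: m; exact: nbhs_infty_gt.
pose rho m := @mixed_norm R m n p1 q1.
pose out m : set (m.-tuple (n.-tuple R)) := ~` mixed_ball p1 q1.
have mout m : measurable (out m).
  by apply: measurableC; apply: measurable_le; exact: measurable_mixed_norm.
have law_out m : (0 < m)%N -> law (out m) = 0.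
  by move=> m0; rewrite /law (mixed_ball_full (hX m0)).
have stat_ratio m (x : m.-tuple (n.-tuple R)) : (0 < m)%N ->
    clt_statistic p1 p2 q2 (row_scale n p1 `^ p2 * b) x =
    Num.sqrt m%:R * (rho m x * ratio X1 (row_g q1 r) (1 / p2) (1 / r) x - 1).
  by move=> m0; rewrite (ratio_fin m0 hn hp1 hq1 hq2 hp2 b0 _ p1E).
(* The mixed norm lies in [1 - dl, 1] outside a rare event, so the event
   statistic <= t is squeezed between the conical events A t and A (t + eta). *)
have lower m : (0 < m)%N -> law (A t m) <= law (@statistic_le t m).
  move=> m0; have -> : law (@statistic_le t m) =
      law (@statistic_le t m) + (law (out m) + law (set0 : set (m.-tuple (n.-tuple R)))).
    by rewrite law_out// /law measure0 !addr0.
  apply: (law_leU3 (mA t m) (@measurable_statistic_le t m) (mout m) measurable0) => x Ax.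
  have [x1|x1] := leP (rho m x) 1; last by right; left; apply/negP; rewrite -ltNge.
  left; rewrite /statistic_le /= stat_ratio//.
  apply: le_trans Ax; rewrite ler_wpM2l// lerD2r.
  by rewrite ler_piMl.
have upper m eta : 0 < eta -> `|t| + eta + 1 <= Num.sqrt m%:R ->
    law (@statistic_le t m) <= law (A (t + eta) m) + 2 / eta / Num.sqrt m%:R.
  move=> eta0 hm; set q := Num.sqrt _ in hm *.
  have q0 : 0 < q by apply: lt_le_trans hm; rewrite ltr_wpDl// addr_ge0// ltW.
  have m0 : (0 < m)%N by rewrite -(@ltr0n R) -sqrtr_gt0.
  (* A norm above 1 - dl lowers the threshold t + eta by dl q = eta / 2 and by the cross term (eta /
     2)(t + eta) / q, which is at most eta / 2 because t + eta <= q; so at least t is left. *)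
  pose dl := eta / (2 * q).
  have dlq : dl * q = eta / 2 by rewrite /dl; field; rewrite gt_eqF.
  have dl0 : 0 < dl by rewrite divr_gt0// mulr_gt0.
  have tq : - q + 1 <= t + eta <= q - 1.
    have := ler_norm t; have := ler_norm (- t); rewrite normrN => h1 h2.
    by apply/andP; split; lra.
  have dl1 : dl < 1.
    rewrite /dl ltr_pdivrMr ?mulr_gt0// mul1r.
    have := normr_ge0 t; lra.
  (* The probability is (1 - dl)^(n m) <= e^(- dl m) = e^(- eta q / 2), and e^y >= 1 + y turns this
     into 2 / (eta q). *)
  have ex : law ([set x | rho m x <= 1 - dl]) <= 2 / eta / q.
    rewrite /law (mixed_norm_law hp1 hq1 hnu (hX m0)) ?subr_gt0//; last first.
      by rewrite lerBlDr lerDl ltW.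
    rewrite /= mulnC exprM.
    apply: (@le_trans _ _ ((1 - dl) ^+ m)).
      rewrite -[leRHS]expr1; apply: ler_wiXn2l; rewrite ?exprn_ge0 ?subr_ge0 ?(ltW dl1)//.
      by rewrite exprn_ile1// ?subr_ge0 ?(ltW dl1)// lerBlDr lerDl ltW.
    apply: (@le_trans _ _ (expR (- dl) ^+ m)).
      rewrite lerXn2r ?nnegrE ?subr_ge0 ?(ltW dl1) ?expR_ge0//.
      exact: expR_ge1Dx.
    rewrite -expRM_natl mulrN -[X in X * dl](sqr_sqrtr (ler0n R m)) -/q.
    rewrite (_ : q ^+ 2 * dl = q * (eta / 2)); last by rewrite -dlq; ring.
    rewrite expRN -[leRHS]invrK lef_pV2 ?posrE ?expR_gt0//; last first.
      by rewrite invr_gt0 !divr_gt0.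
    apply: le_trans (expR_ge1Dx _); rewrite !invf_div mulrA.
    by rewrite lerDr.
  apply: le_trans (_ : law (A (t + eta) m) +
    (law ([set x | rho m x <= 1 - dl]) + law (out m)) <= _); last first.
    by rewrite law_out// addr0 lerD2l.
  have mN : measurable [set x : m.-tuple (n.-tuple R) | rho m x <= 1 - dl].
    by apply: measurable_le; exact: measurable_mixed_norm.
  apply: (law_leU3 (@measurable_statistic_le t m) (mA (t + eta) m) mN (mout m)) => x.
  rewrite /statistic_le /= stat_ratio// => Sx.
  have [x1|x1] := leP (rho m x) (1 - dl); first by right; left.
  left; rewrite /A /ratio_le /= leNgt; apply/negP => h.
  set V := ratio _ _ _ _ _ in Sx h.
  have V1 : 1 + (t + eta) / q < V.
    by rewrite addrC -ltrBrDr ltr_pdivrMr// mulrC.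
  have w0 : 0 <= 1 + (t + eta) / q.
    rewrite -(pmulr_rge0 _ q0) mulrDr mulr1 mulrCA divff ?gt_eqF// mulr1; lra.
  have : (1 - dl) * (1 + (t + eta) / q) < rho m x * V.
    by apply: ltr_pM => //; rewrite subr_ge0 ltW.
  rewrite -(ltr_pM2l q0) => h1.
  have : q * (rho m x * V) <= t + q by rewrite mulrBr mulr1 lerBlDr in Sx.
  rewrite leNgt => /negP; apply; apply: le_lt_trans h1.
  have -> : q * ((1 - dl) * (1 + (t + eta) / q)) =
      q + (t + eta) - dl * q - dl * q * ((t + eta) / q).
    by field; rewrite gt_eqF.
  rewrite dlq.
  have : (t + eta) / q <= 1 by rewrite ler_pdivrMr// mul1r; lra.
  move=> h2; have := ler_wpM2l (ltW (divr_gt0 eta0 (ltr0n R 2))) h2; lra.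
apply/cvgrPdist_le => e e0.
have e3 : 0 < e / 3 by rewrite divr_gt0.
have [eta eta0 [H1 _ G1 _]] := gaussian_lim_continuous s0 H e3.
have C0 : (2 / eta / Num.sqrt (m%:R : R)) @[m --> \oo] --> 0.
  by rewrite -[0](mulr0 (2 / eta)); apply: cvgMr; exact: cvg_sqrtnVy.
have /cvgrPdist_le/(_ _ e3) B1 := lim_A _ H.
have /cvgrPdist_le/(_ _ e3) B2 := lim_A _ H1.
move/cvgrPdist_le/(_ _ e3) : C0 => B3.
near=> m.
have m0 : (0 < m)%N by near: m; exact: nbhs_infty_gt.
have hq : `|t| + eta + 1 <= Num.sqrt m%:R.
  rewrite -[leLHS]ger0_norm ?addr_ge0 ?(ltW eta0)// -sqrtr_sqr ler_sqrt//.
  by near: m; exact: nbhs_infty_ger.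
have L1 := lower m m0; have U1 := upper m eta eta0 hq.
have a1 : `|gaussian_lim s t - law (A t m)| <= e / 3.
  by near: m; exact: B1.
have a2 : `|gaussian_lim s (t + eta) - law (A (t + eta) m)| <= e / 3.
  by near: m; exact: B2.
have a3 : `|0 - 2 / eta / Num.sqrt (m%:R : R)| <= e / 3.
  by near: m; exact: B3.
rewrite sub0r normrN in a3.
exact: sandwich_dist a1 a2 (le_trans (ler_norm _) a3) L1 U1 G1.
Unshelve. all: end_near. Qed.

End limit_law.

(** * The limiting distribution function and its continuity points *)

Section scaled_gaussian.
Context d (U : measurableType d) (R : realType) (G : probability U R)
  (N : {RV G >-> R}) (hN : standard_gaussian N).
Variable s2 : R.
Hypothesis s20 : 0 <= s2.

Lemma cdf_scaled_gaussian t :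
  cdf (scale_mfun (Num.sqrt s2) N : {RV G >-> R}) t = (gaussian_lim s2 t)%:E.
Proof.
rewrite /gaussian_lim; have [->|s2n] := eqVneq s2 0.
  have [t0|t0] := leP 0 t.
    rewrite -[RHS]/(1%E) -(probability_setT G); congr (G _).
    by apply/seteqP; split=> // w _ /=; rewrite in_itv/= sqrtr0 mulr0.
  rewrite -[RHS]/(0%E) -(measure0 G); congr (G _).
  apply/seteqP; split=> // w /=; rewrite in_itv/= sqrtr0 mulr0.
  by rewrite leNgt t0.
have k0 : 0 < Num.sqrt s2 by rewrite sqrtr_gt0 lt_neqAle eq_sym s2n.
transitivity (distribution G N `]-oo, t / Num.sqrt s2]).
  congr (G _); apply/seteqP; split=> w /=; rewrite !in_itv/= ler_pdivlMr//.
by rewrite hN// /gaussian_cdf fineK// fin_num_measure.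
Qed.

(** For s2 = 0 the limit variable is constantly 0 and its distribution function jumps from 0 to 1 at
    t = 0, so the continuity points are those at which the limit is available. *)
Lemma continuous_cdf_scaled_gaussian t :
  {for t, continuous (cdf (scale_mfun (Num.sqrt s2) N : {RV G >-> R}))} ->
  s2 != 0 \/ t != 0.
Proof.
have [s2E|] := eqVneq s2 0; last by left.
have [->|] := eqVneq t 0; last by right.
have -> : cdf (scale_mfun (Num.sqrt s2) N : {RV G >-> R}) = EFin \o gaussian_lim s2.
  by apply/funext => u; exact: cdf_scaled_gaussian.
move=> h; exfalso.
have {}h : gaussian_lim s2 u @[u --> (0 : R)] --> gaussian_lim s2 0.
  exact: (fine_cvg h).
move/cvgrPdist_lt/(_ _ ltr01) : h.
rewrite /gaussian_lim s2E eqxx lexx => -[e /= e0 he].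
have e2 : 0 < e / 2 by rewrite divr_gt0.
have : `|0 - - (e / 2)| < e by rewrite sub0r opprK gtr0_norm//; lra.
move/he; rewrite oppr_ge0 leNgt e2 /= subr0 normr1; by rewrite ltxx.
Qed.

End scaled_gaussian.

(** * The variance in terms of the constants M and C *)

Section variance.
Context {R : realType} (n : nat) (p1 q1 q2 : \bar R) (p2 : R).
Hypotheses (hn : (0 < n)%N) (hp1 : (0 < p1)%E) (hp2 : 0 < p2).

Let M := @Mconst R (p1 / n%:R%:E)%E.
Let k := row_scale n p1.
Let rm := row_moment n p1.

Let n0 : 0 < n%:R :> R. Proof. by rewrite ltr0n. Qed.
Let k0 : 0 < k. Proof. exact: row_scale_gt0. Qed.
Let kp0 : 0 < k `^ p2. Proof. exact: powR_gt0. Qed.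
Let rm0 : 0 < rm p2. Proof. by have := row_moment_gt0 hn hp1 (ltW hp2). Qed.

(** Numerator and squared denominator both carry [row_scale] to the power 2 p2, which cancels. *)
Let moment_ratio (e2 e : R) : 0 < e ->
  M (2 * p2 / n%:R) * e2 / (p2 * M (p2 / n%:R) * e) ^+ 2 =
  rm (2 * p2) * e2 / (rm p2 * e) ^+ 2 / p2 ^+ 2.
Proof.
move=> e0; rewrite /M !Mconst_row ?mulr_ge0 ?(ltW hp2)//.
rewrite -/k -/rm (_ : 2 * p2 = p2 * 2%:R); last by rewrite mulrC.
rewrite (powRrM k) powR_mulrn ?(ltW kp0)//.
move: (k `^ p2) kp0 (rm p2) rm0 (rm (p2 * 2)) => K K0 A A0 B.
by field; rewrite !gt_eqF.
Qed.

Lemma sigma2_infty (e2 e : R) : p1 = +oo%E -> 0 < e ->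
  divy 1 (n%:R%:E * p1)%E - 1 / p2 ^+ 2
    - divy (2 * Cconst (p1 / n%:R%:E)%E (p1 / n%:R%:E)%E (p2 / n%:R))
        (p1 * p2%:E * (M (p2 / n%:R))%:E)%E
    + M (2 * p2 / n%:R) * e2 / (p2 * M (p2 / n%:R) * e) ^+ 2 =
  (rm (2 * p2) * e2 / (rm p2 * e) ^+ 2 - 1) / p2 ^+ 2.
Proof.
move=> p1E e0; rewrite moment_ratio//.
have M0 : 0 < M (p2 / n%:R) by rewrite /M Mconst_row ?(ltW hp2)// mulr_gt0.
have d0 (a : R) : divy a +oo%E = 0 by rewrite /divy invey mule0.
have -> : (n%:R%:E * p1)%E = +oo%E by rewrite p1E gt0_muley ?lte_fin.
have -> : (p1 * p2%:E * (M (p2 / n%:R))%:E)%E = +oo%E.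
  by rewrite p1E !gt0_mulye ?lte_fin.
rewrite !d0; move: (_ / (rm p2 * e) ^+ 2) => x.
by field; rewrite gt_eqF.
Qed.

(** Since M at r / n is 1 and [row_scale] to the power r is r / n, the quotient C / M is (r/n) rm (r
    + p2) / rm p2 - 1, the covariance of the two normalized row powers in [row_variance]. *)
Lemma sigma2_fin (r e2 e : R) : p1 = r%:E -> 0 < e ->
  divy 1 (n%:R%:E * p1)%E - 1 / p2 ^+ 2
    - divy (2 * Cconst (p1 / n%:R%:E)%E (p1 / n%:R%:E)%E (p2 / n%:R))
        (p1 * p2%:E * (M (p2 / n%:R))%:E)%E
    + M (2 * p2 / n%:R) * e2 / (p2 * M (p2 / n%:R) * e) ^+ 2 =
  (rm (2 * p2) * e2 / (rm p2 * e) ^+ 2 - 1) / p2 ^+ 2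
    + 1 / (n%:R * r) - 2 / (p2 * r) * (r / n%:R * rm (r + p2) / rm p2 - 1).
Proof.
move=> p1E e0; rewrite moment_ratio//.
have r0 : 0 < r by move: hp1; rewrite p1E.
have ME : M (p2 / n%:R) = k `^ p2 * rm p2 by rewrite /M Mconst_row ?(ltW hp2).
have M0 : 0 < M (p2 / n%:R) by rewrite ME mulr_gt0.
have dE (a c : R) : c != 0 -> divy a c%:E = a / c by move=> c0; rewrite /divy inver (negbTE c0).
have pn : (p1 / n%:R%:E)%E = (r / n%:R)%:E by rewrite p1E inver gt_eqF.
have CE : Cconst (p1 / n%:R%:E)%E (p1 / n%:R%:E)%E (p2 / n%:R) =
    r / n%:R * k `^ p2 * rm (r + p2) - k `^ p2 * rm p2.
  rewrite /Cconst [X in if X is _%:E then _ else _]pn -mulrDl.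
  rewrite Mconst_row ?addr_ge0 ?(ltW r0) ?(ltW hp2)// (Mconst_rowr hn hp1 p1E) mul1r.
  rewrite -/(M _) ME; congr (_ - _); rewrite -/k -/rm.
  rewrite powRD; last by rewrite (gt_eqF k0) implybT.
  congr (_ * _ * _).
  rewrite /k /row_scale p1E -powRrM mulVf ?gt_eqF// powRr1//.
  by rewrite divr_ge0// ltW.
have nr : n%:R * r != 0 by exact: lt0r_neq0 (mulr_gt0 n0 r0).
have D0 : r * p2 * (k `^ p2 * rm p2) != 0.
  exact: lt0r_neq0 (mulr_gt0 (mulr_gt0 r0 hp2) (mulr_gt0 kp0 rm0)).
rewrite CE ME p1E -!EFinM (dE _ _ nr) (dE _ _ D0).
move: (k `^ p2) kp0 (rm p2) rm0 (rm (r + p2)) (rm (2 * p2)) => K K0 A A0 B C.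
by field; rewrite !gt_eqF.
Qed.

End variance.

Theorem theorem3 (R : realType) (p1 q1 q2 : \bar R) (p2 : R) (n : nat)
    (hp1 : (0 < p1)%E) (hq1 : (0 < q1)%E) (hq2 : (0 < q2)%E) (hp2 : 0 < p2)
    (hpq : (p1, q1) <> (p2%:E, q2)) (hn : (0 < n)%N)
    (d : nat -> measure_display) (T : forall m, measurableType (d m))
    (P : forall m, probability (T m) R)
    (X : forall m, {RV (P m) >-> m.-tuple (n.-tuple R)})
    (hX : forall m, (0 < m)%N -> uniform_on_mixed_ball p1 q1 (X m))
    (dT : measure_display) (S : measurableType dT) (Q : probability S R)
    (Theta1 : {RV Q >-> n.-tuple R}) (hTheta1 : cone_distributed q1 Theta1)
    (dN : measure_display) (U : measurableType dN) (G : probability U R)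
    (N : {RV G >-> R}) (hN : standard_gaussian N) :
  let p1n := (p1 / n%:R%:E)%E in
  let M := Mconst p1n in
  let C := Cconst p1n in
  let E a : R := fine 'E_Q[fun w => lpnorm q2 (Theta1 w) `^ a] in
  let sigma2 := divy 1 (n%:R%:E * p1)%E - 1 / p2 ^+ 2
    - divy (2 * C p1n (p2 / n%:R)) (p1 * p2%:E * (M (p2 / n%:R))%:E)%E
    + M (2 * p2 / n%:R) * E (2 * p2) / (p2 * M (p2 / n%:R) * E p2) ^+ 2 in
  0 <= sigma2 /\
  cvg_in_distribution
    P (fun m => clt_statistic p1 p2 q2 (M (p2 / n%:R) * E p2) \o X m)
    G (scale_mfun (Num.sqrt sigma2) N).
Proof.
move=> p1n M C E sigma2; clear hpq.
have [nu hnu] := row_law_exists hn hp1 hq1.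
have [e0 _] := cone_moment_spec hn hq1 hq2 hTheta1 hp2.
have n0 : 0 < n%:R :> R by rewrite ltr0n.
have cE : M (p2 / n%:R) * E p2 = row_scale n p1 `^ p2 * row_mean p1 q2 p2 Theta1.
  by rewrite /M /p1n (Mconst_row hn hp1 (ltW hp2)) -mulrA.
have [s0 lim] : 0 <= sigma2 /\ forall t, sigma2 != 0 \/ t != 0 ->
    fine (cdf (clt_statistic p1 p2 q2 (M (p2 / n%:R) * E p2) \o X m : {RV (P m) >-> R}) t)
      @[m --> \oo] --> gaussian_lim sigma2 t.
  have [p1E|[r p1E]] : p1 = +oo%E \/ exists r, p1 = r%:E.
    by case: (p1) hp1 => [r||]//; [right; exists r|left].
  - have sE := sigma2_infty hn hp1 hp2 (E (2 * p2)) p1E e0.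
    have vE := row_variance_infty hn hp1 hq1 hq2 hp2 hTheta1 hnu.
    split; first by rewrite /sigma2 sE -vE; apply: Rintegral_ge0 => y _; exact: sqr_ge0.
    move=> t; rewrite cE /sigma2 sE => H.
    exact: (limit_law_infty hn hp1 hq1 hq2 hp2 hTheta1 hX hnu p1E H).
  - have sE := sigma2_fin hn hp1 hp2 (E (2 * p2)) p1E e0.
    have vE := row_variance hn hp1 hq1 hq2 hp2 hTheta1 hnu p1E.
    split; first by rewrite /sigma2 sE -vE; apply: Rintegral_ge0 => y _; exact: sqr_ge0.
    move=> t; rewrite cE /sigma2 sE => H.
    exact: (limit_law_fin hn hp1 hq1 hq2 hp2 hTheta1 hX hnu p1E H).
split=> // t ct; rewrite (cdf_scaled_gaussian hN s0).
have {}lim := lim t (continuous_cdf_scaled_gaussian hN s0 ct).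
apply/fine_cvgP; split=> //; near=> m.
exact: fin_num_measure.
Unshelve. all: end_near. Qed.
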